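(* Let $X$ be a topological space admitting an amenable open cover $\mathcal{U}$ of multiplicity $k$. Then for every $n\geq k$ and every $\alpha\in H_n(X;\mathbb{R})$, the class $\alpha$ is $\ell^1$-invisible, i.e. $\iota_n(\alpha)=0$ in $H_n^{\ell^1}(X;\mathbb{R})$.
   Context: A subset $U\subseteq X$ (not necessarily path connected) is amenable in $X$ if for every $x_0\in U$ the image of $\pi_1(U,x_0)\to\pi_1(X,x_0)$ induced by inclusion is an amenable group. A cover $\mathcal{U}=\{U_i\}_{i\in I}$ of $X$ is open if each $U_i$ is open, amenable if each $U_i$ is amenable in $X$, and its multiplicity is $\sup\{\#J : J\subseteq I,\ \bigcap_{i\in J}U_i\neq\emptyset\}$. $H_*(X;\mathbb{R})$ is real singular homology. $C_n(X)$ denotes real singular $n$-chains with the $\ell^1$-norm $\|\sum a_\sigma\sigma\|_1=\sum|a_\sigma|$ (over singular simplices $\sigma$); $C_n^{\ell^1}(X)$ is its metric completion (possibly infinite combinations $\sum a_\sigma\sigma$ with $\sum|a_\sigma|<\infty$), with the boundary operator extended by continuity, and $H_*^{\ell^1}(X;\mathbb{R})$ is the homology of this complex ($\ell^1$-homology). $\iota_*\colon H_*(X;\mathbb{R})\to H_*^{\ell^1}(X;\mathbb{R})$ is induced by the inclusion $C_*(X)\hookrightarrow C_*^{\ell^1}(X)$. A class $\alpha$ is called $\ell^1$-invisible if $\iota_n(\alpha)=0$. *)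

(* Defs.v *)
From HB Require Import structures.
From mathcomp Require Import all_boot all_order all_algebra.
From mathcomp Require Import all_classical all_reals all_analysis.
From mathcomp Require Import Rstruct Rstruct_topology.
Set Implicit Arguments. Unset Strict Implicit. Unset Printing Implicit Defensive.
Import Order.TTheory GRing.Theory Num.Theory.
Import numFieldNormedType.Exports.
Local Open Scope classical_set_scope.
Local Open Scope ring_scope.

Notation RR := Rdefinitions.R.

(* Fundamental group data: loops parametrised on [0,1] (values outside    *)
(* [0,1] are irrelevant), homotopy rel endpoints, concatenation.          *)

Definition unit_interval : set RR := `[0, 1]%classic.

Definition loop_in (X : topologicalType) (U : set X) (x0 : X) (gam : RR -> X) : Prop :=
  {within unit_interval, continuous gam} /\
  (forall t, unit_interval t -> U (gam t)) /\ gam 0 = x0 /\ gam 1 = x0.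

Definition loop_homotopic (X : topologicalType) (x0 : X) (g h : RR -> X) : Prop :=
  exists H : RR * RR -> X,
    {within unit_interval `*` unit_interval, continuous H} /\
    (forall s, unit_interval s -> H (s, 0) = g s) /\
    (forall s, unit_interval s -> H (s, 1) = h s) /\
    (forall t, unit_interval t -> H (0, t) = x0 /\ H (1, t) = x0).

Definition loop_cat (X : Type) (g h : RR -> X) : RR -> X :=
  fun t => if t <= 2^-1 then g (2 * t) else h (2 * t - 1).

(* Bounded real functions on the image H of pi_1(U,x0) -> pi_1(X,x0):   *)
(* functions on U-loops, bounded, constant on homotopy classes in X.     *)
Definition linfty_image (X : topologicalType) (U : set X) (x0 : X)
    (f : (RR -> X) -> RR) : Prop :=
  (exists M : RR, forall g, loop_in U x0 g -> `|f g| <= M) /\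
  (forall g h, loop_in U x0 g -> loop_in U x0 h -> loop_homotopic x0 g h -> f g = f h).

Definition amenable_image (X : topologicalType) (U : set X) (x0 : X) : Prop :=
  exists m : ((RR -> X) -> RR) -> RR,
    (forall (a : RR) f g, linfty_image U x0 f -> linfty_image U x0 g ->
        m (fun gam => a * f gam + g gam) = a * m f + m g) /\
    (forall f, linfty_image U x0 f -> (forall gam, loop_in U x0 gam -> 0 <= f gam) ->
        0 <= m f) /\
    m (fun _ => 1) = 1 /\
    (forall f h, linfty_image U x0 f -> loop_in U x0 h ->
        m (fun gam => f (loop_cat h gam)) = m f).

Definition amenable_in (X : topologicalType) (U : set X) : Prop :=
  forall x0, U x0 -> amenable_image U x0.

Definition multiplicity_eq (X : Type) (I : Type) (U : I -> set X) (k : nat) : Prop :=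
  (forall J : set I, (exists x, forall i, J i -> U i x) -> (J #<= `I_k)%card) /\
  (exists J : set I, (exists x, forall i, J i -> U i x) /\ (`I_k #<= J)%card).

(* The standard n-simplex is a subset of 'rV_(n+1).  A singular n-simplex *)
(* is encoded by a map 'rV_(n+1) -> X continuous on the simplex and       *)
(* normalized (constant = value at vertex e_0 off the simplex), so that   *)
(* singular simplices correspond bijectively to such functions.           *)

Definition std_simplex (n : nat) : set 'rV[RR]_n.+1 :=
  [set t | (forall i, 0 <= t ord0 i) /\ \sum_(i < n.+1) t ord0 i = 1].

Arguments std_simplex : clear implicits.

Definition vertex0 (n : nat) : 'rV[RR]_n.+1 := \row_(j < n.+1) (j == ord0)%:R.

Arguments vertex0 : clear implicits.

Definition normalize (X : Type) (n : nat) (f : 'rV[RR]_n.+1 -> X) : 'rV[RR]_n.+1 -> X :=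
  fun t => if pselect (std_simplex n t) then f t else f (vertex0 n).

Definition is_singular_simplex (X : topologicalType) (n : nat)
    (f : 'rV[RR]_n.+1 -> X) : Prop :=
  {within std_simplex n, continuous f} /\ normalize f = f.

Definition face_incl (n : nat) (i : 'I_n.+2) (t : 'rV[RR]_n.+1) : 'rV[RR]_n.+2 :=
  \row_(j < n.+2) (if unlift i j is Some j' then t ord0 j' else 0).

Definition face (X : Type) (n : nat) (i : 'I_n.+2) (f : 'rV[RR]_n.+2 -> X)
  : 'rV[RR]_n.+1 -> X := normalize (f \o face_incl i).

Definition chain (X : Type) (n : nat) := ('rV[RR]_n.+1 -> X) -> RR.

Definition support (X : choiceType) (n : nat) (c : chain X n) : set ('rV[RR]_n.+1 -> X) :=
  [set f | c f != 0].

Definition is_chain (X : topologicalType) (n : nat) (c : chain X n) : Prop :=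
  finite_set (support c) /\ (forall f, support c f -> is_singular_simplex f).

Definition boundary (X : choiceType) (n : nat) (c : chain X n.+1) : chain X n :=
  fun tau => \sum_(f \in support c)
               \sum_(i < n.+2) (-1) ^+ i * c f * (asbool (face i f = tau))%:R.

Definition is_cycle (X : choiceType) (n : nat) : chain X n -> Prop :=
  match n with
  | 0 => fun _ => True
  | m.+1 => fun z => boundary z = (fun _ => 0)
  end.

Definition l1norm (X : choiceType) (n : nat) (c : chain X n) : RR :=
  \sum_(f \in support c) `|c f|.

(* z is a boundary in the l^1-completion: z = d(b) where b is the limit of *)
(* an l^1-Cauchy sequence of finite chains b_k and d is extended by         *)
(* continuity, i.e. d(b) = lim d(b_k) in l^1.                              *)
Definition l1_boundary (X : topologicalType) (n : nat) (z : chain X n) : Prop :=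
  exists b : nat -> chain X n.+1,
    (forall p, is_chain (b p)) /\
    (forall e : RR, 0 < e -> exists N, forall p q, (N <= p)%N -> (N <= q)%N ->
        l1norm (fun f => b p f - b q f) < e) /\
    (forall e : RR, 0 < e -> exists N, forall p, (N <= p)%N ->
        l1norm (fun f => boundary (b p) f - z f) < e).

(* Main.v *)
Require Import Defs.
From HB Require Import structures.
From mathcomp Require Import all_boot all_order all_algebra.
From mathcomp Require Import all_classical all_reals all_analysis.
From mathcomp Require Import Rstruct Rstruct_topology.
From mathcomp Require Import fingroup perm.
From mathcomp Require Import ring lra zify.
Set Implicit Arguments. Unset Strict Implicit. Unset Printing Implicit Defensive.
Import Order.TTheory GRing.Theory Num.Theory.
Import numFieldNormedType.Exports.
Local Open Scope classical_set_scope.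
Local Open Scope ring_scope.

(** Colour every vertex of a fine subdivision of a cycle by a member of the cover that
    contains the simplices it spans.  When the dimension is at least the multiplicity,
    two vertices of each simplex have the same colour, so that after alternation the
    cycle pairs to zero with every function that is invariant under homotopies moving
    each vertex inside the set of its colour.

    Let R_p ([hrel p] below) be homotopy relative to the (p-1)-skeleton, where for p = 0
    the vertices have to move inside the sets of their colours.  Suppose that a cycle
    almost vanishes on R_p-invariant functions.  Moving each of its p-faces by an
    independent random homotopy, drawn from an almost invariant probability on homotopy
    classes of motions, gives a homologous cycle of no larger norm that almost vanishes
    on R_(p+1)-invariant functions.  Such probabilities exist because the loops involved
    form an amenable group: by hypothesis for p = 0 (a mean gives almost invariant
    probabilities by Hahn-Banach), and for p > 0 since Eckmann-Hilton makes it abelian.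
    Above the top dimension R_p is equality, so the l^1-norm itself has become small,
    while the bounding chain is controlled by the norm of the initial cycle.  Iteration
    yields a convergent series of bounding chains. *)

(** Almost vanishing on R_p-invariant functions bounded by one means, dually, that the cycle has
    small l^1-norm modulo R_p. A motion of a vertex stays in the set of its colour, so averaging
    keeps the R_0-class of each simplex: exact vanishing on R_0-invariant functions survives a whole
    round, and the next round starts from it with a smaller norm. Only the chain bounding the
    initial subdivision is uncontrolled in norm, and it occurs once.

    Two simplices related by R_p have different p-faces in general, so the motions of corresponding
    faces start at different simplices; this is why almost invariance is proved on the groupoid of
    motions and not on its vertex groups alone. Only finitely many faces occur in a given cycle,
    hence finitely many arrows have to be handled.

    Averaging has to be a chain map. Therefore each face draws its motion from a law depending on
    that face only, independently of the others, and motions of p-faces are extended to higher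
    simplices by a choice that commutes with faces. Averages at R_p-related simplices are then
    compared by replacing one law at a time. *)

Lemma within_comp (S S' X : topologicalType) (A : set S') (B : set S)
    (f : S' -> X) (g : S -> S') :
  {within A, continuous f} -> {within B, continuous g} ->
  (forall x, B x -> A (g x)) -> {within B, continuous (f \o g)}.
Proof.
move=> /subspace_continuousP cf /subspace_continuousP cg gAB.
apply/subspace_continuousP => x Bx W /(cf _ (gAB _ Bx)) fW.
apply: (@filterS _ (nbhs x) _ _ _ _ (cg _ Bx _ fW)) => z h Bz.
exact: h Bz (gAB _ Bz).
Qed.

(* Inductive wrappers, because unification unfolds [continuous] to a product. *)
Variant cts (S S' : topologicalType) (f : S -> S') : Prop := Cts of continuous f.

Variant cton (S X : topologicalType) (A : set S) (f : S -> X) : Prop :=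
  Cton of {within A, continuous f}.

(** The workhorse for continuity on subsets: [h] has to agree with the composite on [B] only, so a
    function defined by cases is treated on each piece through the formula valid there. *)
Lemma cton_comp (S S' X : topologicalType) (A : set S') (B : set S)
    (f : S' -> X) (g : S -> S') (h : S -> X) :
  cton A f -> cts g -> (forall x, B x -> A (g x)) -> (forall x, B x -> h x = f (g x)) ->
  cton B h.
Proof.
move=> [cf] [cg] gAB hE; have c : {within B, continuous (f \o g)}.
  by apply: within_comp cf _ gAB; exact: continuous_subspaceT.
by split; apply: subspace_eq_continuous c => x /set_mem Bx; rewrite -[RHS]/(h x) hE.
Qed.

Lemma cton_eq (S X : topologicalType) (A : set S) (f g : S -> X) :
  cton A f -> (forall x, A x -> g x = f x) -> cton A g.
Proof.
by move=> [cf] fg; split; apply: subspace_eq_continuous cf => x /set_mem Ax; rewrite -[RHS]/(g x) fg.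
Qed.

(** * Continuity calculus *)

Section ContinuityRules.
Variable S : topologicalType.
Implicit Types (f g : S -> RR) (V : normedModType RR).

Lemma cts_id : cts (fun x : S => x).
Proof. by split=> x. Qed.

Lemma cts_cst (T : topologicalType) (c : T) : cts (fun _ : S => c).
Proof. by split=> x; exact: cvg_cst. Qed.

Lemma cts_comp (S' S'' : topologicalType) (f : S' -> S'') (g : S -> S') :
  cts f -> cts g -> cts (fun x => f (g x)).
Proof. by move=> [cf] [cg]; split=> x; apply: continuous_comp; [exact: cg|exact: cf]. Qed.

Lemma cts_pair (A B : topologicalType) (f : S -> A) (g : S -> B) :
  cts f -> cts g -> cts (fun x => (f x, g x)).
Proof. by move=> [cf] [cg]; split=> x; apply: cvg_pair; [exact: cf|exact: cg]. Qed.

Lemma cts_fst (A B : topologicalType) (f : S -> A * B) : cts f -> cts (fun x => (f x).1).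
Proof. by move=> [cf]; split=> x; apply: cvg_comp (cf x) _; exact: cvg_fst. Qed.

Lemma cts_snd (A B : topologicalType) (f : S -> A * B) : cts f -> cts (fun x => (f x).2).
Proof. by move=> [cf]; split=> x; apply: cvg_comp (cf x) _; exact: cvg_snd. Qed.

Lemma cts_add V (f g : S -> V) : cts f -> cts g -> cts (fun x => f x + g x).
Proof. by move=> [cf] [cg]; split=> x; exact: (continuousD (cf x) (cg x)). Qed.

Lemma cts_opp V (f : S -> V) : cts f -> cts (fun x => - f x).
Proof. by move=> [cf]; split=> x; exact: (continuousN (cf x)). Qed.

(** Real functions get rules of their own, proved through the regular module [RR^o]; the tactic
    below tries them before the rules for modules. *)
Lemma cts_addR f g : cts f -> cts g -> cts (fun x => f x + g x).
Proof. by move=> [cf] [cg]; split=> x; exact: (@continuousD RR RR^o S f g x (cf x) (cg x)). Qed.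

Lemma cts_oppR f : cts f -> cts (fun x => - f x).
Proof. by move=> [cf]; split=> x; exact: (@continuousN RR RR^o S f x (cf x)). Qed.

Lemma cts_mul f g : cts f -> cts g -> cts (fun x => f x * g x).
Proof. by move=> [cf] [cg]; split=> x; exact: (continuousM (cf x) (cg x)). Qed.

Lemma cts_scale V f (g : S -> V) : cts f -> cts g -> cts (fun x => f x *: g x).
Proof. by move=> [cf] [cg]; split=> x; exact: (cvgZ (cf x) (cg x)). Qed.

Lemma cts_inv f : cts f -> (forall x, f x != 0) -> cts (fun x => (f x)^-1).
Proof. by move=> [cf] f0; split=> x; exact: (continuousV (f0 x) (cf x)). Qed.

Lemma cts_max f g : cts f -> cts g -> cts (fun x => Num.max (f x) (g x)).
Proof. by move=> [cf] [cg]; split=> x; exact: (continuous_max (cf x) (cg x)). Qed.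

Lemma cts_min f g : cts f -> cts g -> cts (fun x => Num.min (f x) (g x)).
Proof. by move=> [cf] [cg]; split=> x; exact: (continuous_min (cf x) (cg x)). Qed.

Lemma cts_sum V (I : Type) (r : seq I) (F : I -> S -> V) :
  (forall i, cts (F i)) -> cts (fun x => \sum_(i <- r) F i x).
Proof.
move=> cF; elim: r => [|i r IH].
  by under eq_fun do rewrite big_nil; exact: cts_cst.
by under eq_fun do rewrite big_cons; apply: cts_add.
Qed.

Lemma cts_bigmax (I : Type) (r : seq I) (F : I -> S -> RR) (a : RR) :
  (forall i, cts (F i)) -> cts (fun x => \big[Num.max/a]_(i <- r) F i x).
Proof.
move=> cF; elim: r => [|i r IH].
  by under eq_fun do rewrite big_nil; exact: cts_cst.
by under eq_fun do rewrite big_cons; apply: cts_max.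
Qed.

Lemma cts_coord n (f : S -> 'rV[RR]_n.+1) i : cts f -> cts (fun x => f x ord0 i).
Proof.
move=> cf; apply: (@cts_comp _ _ (fun M : 'rV[RR]_n.+1 => M ord0 i)) cf.
by split; exact: coord_continuous.
Qed.
End ContinuityRules.

Ltac continuity := cbv beta; repeat (lazymatch goal with
  | |- cts (fun x => x) => exact: cts_id
  | |- cts (fun _ => ?c) => exact: cts_cst
  | |- cts fst => exact: (cts_fst (@cts_id _))
  | |- cts snd => exact: (cts_snd (@cts_id _))
  | |- cts (fun x => (@?f x, @?g x)) => refine (@cts_pair _ _ _ f g _ _)
  | |- cts (fun x => fst (@?f x)) => refine (@cts_fst _ _ _ f _)
  | |- cts (fun x => snd (@?f x)) => refine (@cts_snd _ _ _ f _)
  | |- cts (fun x => @GRing.add _ (@?f x) (@?g x)) =>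
    first [refine (@cts_addR _ f g _ _) | refine (@cts_add _ _ f g _ _)]
  | |- cts (fun x => @GRing.opp _ (@?f x)) =>
    first [refine (@cts_oppR _ f _) | refine (@cts_opp _ _ f _)]
  | |- cts (fun x => @GRing.mul _ (@?f x) (@?g x)) => refine (@cts_mul _ f g _ _)
  | |- cts (fun x => @GRing.inv _ (@?f x)) => refine (@cts_inv _ f _ _)
  | |- cts (fun x => @GRing.scale _ _ (@?f x) (@?g x)) => refine (@cts_scale _ _ f g _ _)
  | |- cts (fun x => @Order.max _ _ (@?f x) (@?g x)) => refine (@cts_max _ f g _ _)
  | |- cts (fun x => @Order.min _ _ (@?f x) (@?g x)) => refine (@cts_min _ f g _ _)
  | |- cts (fun x => @fun_of_matrix _ _ _ (@?f x) _ ?i) => refine (@cts_coord _ _ f i _)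
  | |- cts _ => assumption
  end; cbv beta).

Lemma unit_intervalE (t : RR) : unit_interval t = (0 <= t <= 1) :> Prop.
Proof. by rewrite /unit_interval /= in_itv. Qed.

Lemma unit_interval0 : unit_interval 0.
Proof. by rewrite unit_intervalE; lra. Qed.

Lemma unit_interval1 : unit_interval 1.
Proof. by rewrite unit_intervalE; lra. Qed.

(** * Affine maps of simplices *)

Section Affine.
Variable V : lmodType RR.

(** Linear in [x], hence defined and continuous on all row vectors; on the standard simplex it is
    the affine map sending vertex [i] to [p i]. *)
Definition aff k (p : 'I_k.+1 -> V) (x : 'rV[RR]_k.+1) : V :=
  \sum_i x ord0 i *: p i.

End Affine.

Definition basis n (i : 'I_n.+1) : 'rV[RR]_n.+1 := delta_mx ord0 i.

Definition act_map k n (th : 'I_k.+1 -> 'I_n.+1) : 'rV[RR]_k.+1 -> 'rV[RR]_n.+1 :=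
  aff (fun j => basis (th j)).

Lemma basisE n (i j : 'I_n.+1) : basis i ord0 j = (j == i)%:R.
Proof. by rewrite /basis mxE eqxx. Qed.

Lemma aff_basis (V : lmodType RR) k (p : 'I_k.+1 -> V) i : aff p (basis i) = p i.
Proof.
rewrite /aff (bigD1 i) //= basisE eqxx scale1r big1 ?addr0 // => j ji.
by rewrite basisE (negbTE ji) scale0r.
Qed.

Lemma affE k n (p : 'I_k.+1 -> 'rV[RR]_n.+1) x j :
  aff p x ord0 j = \sum_i x ord0 i * p i ord0 j.
Proof. by rewrite /aff summxE; apply: eq_bigr => i _; rewrite mxE. Qed.

Lemma aff_comp (V : lmodType RR) l k (p : 'I_k.+1 -> V) (q : 'I_l.+1 -> 'rV[RR]_k.+1) x :
  aff p (aff q x) = aff (fun j => aff p (q j)) x.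
Proof.
rewrite /aff (eq_bigr (fun i => \sum_j (x ord0 j * q j ord0 i) *: p i)); last first.
  by move=> i _; rewrite -scaler_suml -affE.
rewrite exchange_big /=; apply: eq_bigr => j _.
by rewrite scaler_sumr; apply: eq_bigr => i _; rewrite scalerA.
Qed.

Lemma aff_id n (x : 'rV[RR]_n.+1) : aff (@basis n) x = x.
Proof.
apply/rowP => j; rewrite affE (bigD1 j) //= basisE eqxx mulr1 big1 ?addr0 // => i ij.
by rewrite basisE eq_sym (negbTE ij) mulr0.
Qed.

Lemma aff_act (V : lmodType RR) k n (p : 'I_n.+1 -> V) (th : 'I_k.+1 -> 'I_n.+1) x :
  aff p (act_map th x) = aff (p \o th) x.
Proof. by rewrite /act_map aff_comp; congr aff; apply/funext => j /=; rewrite aff_basis. Qed.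

Lemma act_map_comp l k n (th : 'I_k.+1 -> 'I_n.+1) (et : 'I_l.+1 -> 'I_k.+1) x :
  act_map th (act_map et x) = act_map (th \o et) x.
Proof. by rewrite {1}/act_map aff_act. Qed.

Lemma act_map_id n (x : 'rV[RR]_n.+1) : act_map id x = x.
Proof. exact: aff_id. Qed.

Lemma act_map_basis k n (th : 'I_k.+1 -> 'I_n.+1) i : act_map th (basis i) = basis (th i).
Proof. by rewrite /act_map aff_basis. Qed.

Lemma act_mapE k n (th : 'I_k.+1 -> 'I_n.+1) x j :
  act_map th x ord0 j = \sum_(i | th i == j) x ord0 i.
Proof.
rewrite affE [RHS]big_mkcond /=; apply: eq_bigr => i _; rewrite basisE eq_sym.
by case: eqP => _; rewrite ?mulr1 ?mulr0.
Qed.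

Lemma act_map_inj k n (th : 'I_k.+1 -> 'I_n.+1) x j : injective th ->
  act_map th x ord0 (th j) = x ord0 j.
Proof.
move=> thI; rewrite act_mapE (bigD1 j) //= big1 ?addr0 // => i /andP[/eqP/thI -> ].
by rewrite eqxx.
Qed.

Lemma face_inclE n (i : 'I_n.+2) x : face_incl i x = act_map (lift i) x.
Proof.
apply/rowP => j; rewrite mxE; case: unliftP => [j' ->|->].
  by rewrite act_map_inj //; exact: lift_inj.
by rewrite act_mapE big1 // => k; rewrite eq_sym (negbTE (neq_lift _ _)).
Qed.

Lemma face_incl_inj n (i : 'I_n.+2) : injective (@face_incl n i).
Proof.
move=> x y /rowP e; apply/rowP => j; have := e (lift i j).
by rewrite !face_inclE !act_map_inj //; exact: lift_inj.
Qed.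

Lemma cts_aff (V : normedModType RR) k (p : 'I_k.+1 -> V) : cts (aff p).
Proof. by apply: cts_sum => i; continuity. Qed.

Lemma simplex_coord_le1 n x (i : 'I_n.+1) : std_simplex n x -> x ord0 i <= 1.
Proof.
case=> x0 <-; rewrite (bigD1 i) //= lerDl; apply: sumr_ge0 => j _; exact: x0.
Qed.

Lemma aff_simplex k n (p : 'I_k.+1 -> 'rV[RR]_n.+1) x :
  (forall i, std_simplex n (p i)) -> std_simplex k x -> std_simplex n (aff p x).
Proof.
move=> hp [x0 x1]; split=> [j|].
  rewrite affE; apply: sumr_ge0 => i _; apply: mulr_ge0 => //; exact: (hp i).1.
under eq_bigr do rewrite affE.
rewrite exchange_big /= -[RHS]x1; apply: eq_bigr => i _.
by rewrite -mulr_sumr (hp i).2 mulr1.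
Qed.

Lemma basis_simplex n (i : 'I_n.+1) : std_simplex n (basis i).
Proof.
split=> [j|]; first by rewrite basisE.
by rewrite (bigD1 i) //= basisE eqxx big1 ?addr0 // => j ji; rewrite basisE (negbTE ji).
Qed.

Lemma act_map_simplex k n (th : 'I_k.+1 -> 'I_n.+1) x :
  std_simplex k x -> std_simplex n (act_map th x).
Proof. by apply: aff_simplex => i; exact: basis_simplex. Qed.

Lemma face_incl_simplex n (i : 'I_n.+2) x :
  std_simplex n x -> std_simplex n.+1 (face_incl i x).
Proof. by rewrite face_inclE; exact: act_map_simplex. Qed.

Lemma vertex0E n : vertex0 n = basis ord0.
Proof. by apply/rowP => j; rewrite mxE basisE. Qed.

Lemma vertex0_simplex n : std_simplex n (vertex0 n).
Proof. by rewrite vertex0E; exact: basis_simplex. Qed.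

Definition del_coord n (i : 'I_n.+2) (x : 'rV[RR]_n.+2) : 'rV[RR]_n.+1 :=
  \row_j x ord0 (lift i j).

Lemma face_inclK n (i : 'I_n.+2) : cancel (@face_incl n i) (del_coord i).
Proof.
by move=> x; apply/rowP => j; rewrite !mxE liftK.
Qed.

Lemma del_coordK n (i : 'I_n.+2) (x : 'rV[RR]_n.+2) : x ord0 i = 0 -> face_incl i (del_coord i x) = x.
Proof.
move=> xi; apply/rowP => j; rewrite mxE; case: unliftP => [j' ->|->] //.
by rewrite mxE.
Qed.

Lemma del_coord_simplex n (i : 'I_n.+2) x :
  std_simplex n.+1 x -> x ord0 i = 0 -> std_simplex n (del_coord i x).
Proof.
move=> [x0 x1] xi; split=> [j|]; first by rewrite mxE.
rewrite -x1 (bigD1_ord i) //= xi add0r; apply: eq_bigr => j _.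
by rewrite mxE.
Qed.

Lemma face_incl_coord n (i : 'I_n.+2) x : face_incl i x ord0 i = 0.
Proof. by rewrite mxE unlift_none. Qed.

Lemma cts_del_coord n (i : 'I_n.+2) : cts (@del_coord n i).
Proof.
have -> : @del_coord n i = (fun x => \sum_j x ord0 (lift i j) *: basis j).
  apply/funext => x; rewrite -[LHS]aff_id; apply: eq_bigr => j _; by rewrite mxE.
by apply: cts_sum => j; continuity.
Qed.

(** The cosimplicial identity without an order between [i] and [j]: both composites omit exactly
    these two vertices. The simplicial identities below take the conclusion as their hypothesis,
    which avoids case distinctions on indices. *)
Lemma lift_exchange n (i j : 'I_n.+3) (k l : 'I_n.+2) :
  lift i k = j -> lift j l = i -> i != j ->
  forall m : 'I_n.+1, lift i (lift k m) = lift j (lift l m).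
Proof.
move=> /(congr1 val) /= + /(congr1 val) /= + /eqP ij m.
have {}ij : (i : nat) <> j by move/val_inj.
move=> e1 e2; apply/val_inj => /=; move: e1 e2 ij; rewrite /bump /=.
case: (i : nat) (j : nat) (k : nat) (l : nat) (m : nat) => [|i'] j' k' l' m'; lia.
Qed.

(** Two different facets meet in a face of codimension two; maps given on the facets are compared
    there. *)
Lemma face_incl_exchange n (i j : 'I_n.+3) x x' :
  i != j -> face_incl i x = face_incl j x' -> std_simplex n.+1 x ->
  exists (k l : 'I_n.+2) (y : 'rV[RR]_n.+1),
    [/\ std_simplex n y, x = face_incl k y, x' = face_incl l y
      & forall m, lift i (lift k m) = lift j (lift l m)].
Proof.
move=> ij e sx.
have [k ek|/esym/eqP] := unliftP i j; last by rewrite (negbTE ij).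
have [l el|/eqP] := unliftP j i; last by rewrite (negbTE ij).
have ex := lift_exchange (esym ek) (esym el) ij.
have xk : x ord0 k = 0.
  have := face_incl_coord j x'; rewrite -e {1}ek face_inclE act_map_inj //; exact: lift_inj.
exists k, l, (del_coord k x); split => //.
- exact: del_coord_simplex.
- by rewrite del_coordK.
- apply: (@face_incl_inj _ j); rewrite -e -{1}(del_coordK xk) !face_inclE !act_map_comp.
  by congr act_map; apply/funext => m /=.
Qed.

Lemma face_incl_exchange0 (i j : 'I_2) x x' :
  i != j -> face_incl i x = face_incl j x' -> std_simplex 0 x -> False.
Proof.
move=> ij e [_ +]; rewrite big_ord1 => x1.
have [k ek|/esym/eqP] := unliftP i j; last by rewrite (negbTE ij).
have := face_incl_coord j x'; rewrite -e {1}ek face_inclE act_map_inj; last exact: lift_inj.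
by rewrite (ord1 k) x1 => /eqP; rewrite oner_eq0.
Qed.

(** * Pasting over finite closed covers *)

Lemma closed_le_fun (S : topologicalType) (f : S -> RR) (c : RR) :
  cts f -> closed [set q | f q <= c].
Proof.
move=> [/continuous_closedP cf].
exact: (cf [set y | y <= c] (@closed_le RR c)).
Qed.

Lemma closed_ge_fun (S : topologicalType) (f : S -> RR) (c : RR) :
  cts f -> closed [set q | c <= f q].
Proof.
move=> [/continuous_closedP cf].
exact: (cf [set y | c <= y] (@closed_ge RR c)).
Qed.

Lemma closed_eq_fun (S : topologicalType) (f : S -> RR) (c : RR) :
  cts f -> closed [set q | f q = c].
Proof.
move=> [/continuous_closedP cf].
exact: (cf [set y | y = c] (@closed_eq RR c)).
Qed.

(** A closed piece that misses a point misses a neighbourhood of it, so only the pieces through the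
    point constrain the values nearby. *)
Lemma cton_paste (S X : topologicalType) (I : finType) (D : set S) (C : I -> set S)
    (f : S -> X) :
  (forall i, closed (C i)) -> (forall x, D x -> exists i, C i x) ->
  (forall i, cton (D `&` C i) f) -> cton D f.
Proof.
move=> clC covC cf; split; apply/subspace_continuousP => x Dx W fW.
have h (i : I) : \forall y \near nbhs x, D y -> C i y -> W (f y).
  have [Cx|nCx] := pselect (C i x).
    have [/subspace_continuousP/(_ x (conj Dx Cx) W fW) h] := cf i.
    by apply: (@filterS _ (nbhs x) _ _ _ _ h) => y hy Dy Cy; exact: hy.
  have oC : open (~` C i) by exact: closed_openC.
  by apply: filterS (open_nbhs_nbhs (conj oC nCx)) => y nCy Dy Cy.
have H : nbhs x [set y | forall i, D y -> C i y -> W (f y)] by exact: filter_forall.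
apply: (@filterS _ (nbhs x) _ _ _ _ H) => y hy Dy.
by have [i Ciy] := covC y Dy; exact: hy i Dy Ciy.
Qed.

(** * Homotopy extension *)

Section Gauge.
Variable n : nat.
Implicit Types (p x : 'rV[RR]_n.+1) (s : RR).

(** On the simplex this is the Minkowski gauge about the interior point [p]: 0 at [p], 1 on the
    boundary, with homothetic copies of the simplex as sublevel sets. *)
Definition gauge p x : RR := \big[Num.max/0]_i (1 - x ord0 i / p ord0 i).

Lemma gauge_ge p x i : 1 - x ord0 i / p ord0 i <= gauge p x.
Proof. exact: (le_bigmax _ (fun i => 1 - x ord0 i / p ord0 i)). Qed.

Lemma gauge_le p x c : 0 <= c -> (forall i, 1 - x ord0 i / p ord0 i <= c) -> gauge p x <= c.
Proof. by move=> c0 h; apply: bigmax_le => // i _; exact: h. Qed.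

Lemma gauge_attained p x : 0 < gauge p x -> exists i, gauge p x = 1 - x ord0 i / p ord0 i.
Proof.
apply: contraPP => /forallNP h; apply/negP; rewrite -leNgt.
suff : gauge p x = 0 \/ exists i, gauge p x = 1 - x ord0 i / p ord0 i.
  by case=> [->//|[i /(h i)]].
rewrite /gauge; elim/big_ind: _ => [|a b ha hb|i _]; [by left| |by right; exists i].
by rewrite /Num.max; case: ifP.
Qed.

Lemma gauge_le1 p x : (forall i, 0 < p ord0 i) -> std_simplex n x -> gauge p x <= 1.
Proof.
move=> p0 [x0 _]; apply: gauge_le => // i.
by rewrite gerBl divr_ge0 // ltW.
Qed.

Lemma gauge_boundary p x i : (forall i, 0 < p ord0 i) -> std_simplex n x ->
  x ord0 i = 0 -> gauge p x = 1.
Proof.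
move=> p0 sx xi; apply/eqP; rewrite eq_le gauge_le1 //=.
by have := gauge_ge p x i; rewrite xi mul0r subr0.
Qed.

Lemma cts_gauge (S : topologicalType) p (f : S -> 'rV[RR]_n.+1) :
  cts f -> cts (fun q => gauge p (f q)).
Proof. by move=> cf; apply: cts_bigmax => i; continuity. Qed.

(** The homothety about [p] with ratio [m^-1]. It blows the ball of gauge at most [m] up to the
    whole simplex and sends gauge exactly [m] to the boundary. *)
Definition expand p (m : RR) x : 'rV[RR]_n.+1 := p + m^-1 *: (x - p).

Lemma expandE p m x i : expand p m x ord0 i = p ord0 i + m^-1 * (x ord0 i - p ord0 i).
Proof. by rewrite !mxE. Qed.

Lemma expand1 p x : expand p 1 x = x.
Proof. by rewrite /expand invr1 scale1r addrC subrK. Qed.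

Lemma expand_simplex p m x : std_simplex n p -> (forall i, 0 < p ord0 i) ->
  std_simplex n x -> 0 < m -> gauge p x <= m -> std_simplex n (expand p m x).
Proof.
move=> [_ p1] p0 [_ x1] m0 gm; split=> [i|]; last first.
  under eq_bigr do rewrite expandE.
  by rewrite big_split /= -mulr_sumr sumrB x1 p1 subrr mulr0 addr0.
have := le_trans (gauge_ge p x i) gm; have pi0 := p0 i => h.
rewrite expandE.
have -> : p ord0 i + m^-1 * (x ord0 i - p ord0 i) =
    m^-1 * p ord0 i * (m - (1 - x ord0 i / p ord0 i)).
  by field; rewrite !gt_eqF.
by rewrite !mulr_ge0 ?subr_ge0 // ?invr_ge0 ltW.
Qed.

Lemma expand_boundary p m x : (forall i, 0 < p ord0 i) -> 0 < m -> gauge p x = m ->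
  exists i, expand p m x ord0 i = 0.
Proof.
move=> p0 m0 gm; have [|i gi] := @gauge_attained p x; first by rewrite gm.
exists i; rewrite expandE.
have -> : x ord0 i = p ord0 i * (1 - m) by rewrite -gm gi; field; rewrite gt_eqF.
by field; rewrite gt_eqF.
Qed.

Lemma cts_expand (S : topologicalType) p (m : S -> RR) (f : S -> 'rV[RR]_n.+1) :
  (forall q, m q != 0) -> cts m -> cts f ->
  cts (fun q => expand p (m q) (f q)).
Proof. by move=> m0 cm cf; rewrite /expand; continuity. Qed.

Definition bary : 'rV[RR]_n.+1 := \row_i (n.+1%:R)^-1.

Lemma bary_gt0 i : 0 < bary ord0 i.
Proof. by rewrite mxE invr_gt0 ltr0n. Qed.

Lemma bary_simplex : std_simplex n bary.
Proof.
split=> [i|]; first exact: ltW (bary_gt0 i).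
under eq_bigr do rewrite mxE.
by rewrite sumr_const card_ord -[_ *+ _]mulr_natr mulVf // pnatr_eq0.
Qed.

(* The radial retraction of [std_simplex * unit_interval] onto its bottom and sides,
   projecting from the point (barycenter, 2). *)
Definition retr_scale (x : 'rV[RR]_n.+1) (s : RR) : RR :=
  Num.max (Num.max (gauge bary x) (1 - s / 2)) (2^-1).

(** The ray from (barycentre, 2) through (x, s), parametrised by the inverse of a scale [m], meets
    the bottom at [m = 1 - s / 2] and the sides at [m = gauge bary x]; the larger of the two is met
    first. *)
Definition retr_pt x s := expand bary (retr_scale x s) x.
Definition retr_ht x s : RR := 2 - (2 - s) / retr_scale x s.

Lemma retr_scale_gt0 x s : 0 < retr_scale x s.
Proof. by rewrite /retr_scale lt_max invr_gt0 ltr0n orbT. Qed.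

(** The cutoff at one half keeps the scale nonzero, and the division by it continuous, for all real
    [s]; on the unit interval [1 - s / 2] already exceeds it. *)
Lemma retr_scaleE x s : 0 <= s <= 1 ->
  retr_scale x s = Num.max (gauge bary x) (1 - s / 2).
Proof.
move=> s01; rewrite /retr_scale; apply/max_idPl; rewrite le_max.
by apply/orP; right; lra.
Qed.

Lemma retr_pt_simplex x s : std_simplex n x -> std_simplex n (retr_pt x s).
Proof.
move=> sx; apply: expand_simplex => //; [exact: bary_simplex|exact: bary_gt0|exact: retr_scale_gt0|].
by rewrite /retr_scale !le_max lexx.
Qed.

Lemma retr_cases x s : std_simplex n x -> 0 <= s <= 1 ->
  0 <= retr_ht x s <= 1 /\ (retr_ht x s = 0 \/ exists i, retr_pt x s ord0 i = 0).
Proof.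
move=> sx s01; have m0 := retr_scale_gt0 x s.
have g1 := gauge_le1 bary_gt0 sx.
rewrite /retr_pt /retr_ht; move: m0; rewrite retr_scaleE // => m0.
have hm : 1 - s / 2 <= Num.max (gauge bary x) (1 - s / 2) by rewrite le_max lexx orbT.
have hm1 : Num.max (gauge bary x) (1 - s / 2) <= 1 by rewrite ge_max g1; lra.
split.
  move: (Num.max _ _ : RR) m0 hm hm1 => m m0 hm hm1.
  have -> : 2 - (2 - s) / m = (2 * m - (2 - s)) / m by field; rewrite gt_eqF.
  apply/andP; split; first by apply: divr_ge0; lra.
  by rewrite ler_pdivrMr //; lra.
have [h|h] := leP (gauge bary x) (1 - s / 2).
  left; rewrite (max_idPr h) in m0 *.
  by field; rewrite gt_eqF //; lra.
right; rewrite (max_idPl (ltW h)) in m0 *.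
by apply: expand_boundary => //; exact: bary_gt0.
Qed.

Lemma retr_bottom x : std_simplex n x -> retr_pt x 0 = x /\ retr_ht x 0 = 0.
Proof.
move=> sx; rewrite /retr_pt /retr_ht.
have -> : retr_scale x 0 = 1.
  rewrite retr_scaleE ?lexx ?ler01 // mul0r subr0; apply/max_idPr; exact: gauge_le1 bary_gt0 sx.
by rewrite expand1; split=> //; lra.
Qed.

Lemma retr_side x s i : std_simplex n x -> 0 <= s <= 1 -> x ord0 i = 0 ->
  retr_pt x s = x /\ retr_ht x s = s.
Proof.
move=> sx s01 xi; rewrite /retr_pt /retr_ht.
have -> : retr_scale x s = 1.
  rewrite retr_scaleE // (gauge_boundary bary_gt0 sx xi); apply/max_idPl; lra.
by rewrite expand1; split=> //; lra.
Qed.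

Lemma cts_retr_scale :
  cts (fun q : ('rV[RR]_n.+1 * RR) * RR => retr_scale q.1.1 q.2).
Proof. by rewrite /retr_scale; continuity; apply: cts_gauge; continuity. Qed.

End Gauge.

Definition cyl1 n : set ('rV[RR]_n.+1 * RR) := std_simplex n `*` unit_interval.
Definition cyl2 n : set (('rV[RR]_n.+1 * RR) * RR) := @cyl1 n `*` unit_interval.
Arguments cyl1 : clear implicits.
Arguments cyl2 : clear implicits.

(** For a point of the simplex, one more than the dimension of the open face containing it. *)
Definition nzc n (x : 'rV[RR]_n.+1) : nat := #|[pred i | x ord0 i != 0]|.

Lemma nzc_face n (i : 'I_n.+2) x : nzc (face_incl i x) = nzc x.
Proof.
rewrite /nzc -(fintype.card_image (@lift_inj _ i)); apply: eq_card => j; rewrite !inE.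
apply/idP/fintype.imageP => [|[k]].
  case: (unliftP i j) => [k ->|->]; last by rewrite face_incl_coord eqxx.
  rewrite face_inclE act_map_inj; last exact: lift_inj.
  by exists k.
by rewrite inE => h ->; rewrite face_inclE act_map_inj //; exact: lift_inj.
Qed.

Lemma nzc_lt n (x : 'rV[RR]_n.+1) : (nzc x < n.+1)%N -> exists i, x ord0 i = 0.
Proof.
move=> h; apply/not_existsP => h0; move: h; apply/negP; rewrite -leqNgt /nzc.
rewrite -[X in (X <= _)%N](card_ord n.+1); apply: subset_leq_card; apply/fintype.subsetP => i _.
by rewrite inE; apply/eqP; exact: h0.
Qed.

Lemma nzc_gt0 n (x : 'rV[RR]_n.+1) : std_simplex n x -> (0 < nzc x)%N.
Proof.
move=> [_ x1]; apply/card_gt0P; apply/not_existsP => h.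
move: x1; rewrite big1 => [/eqP|i _]; first by rewrite eq_sym oner_eq0.
by apply/eqP/negPn/negP => xi; apply: (h i); rewrite inE.
Qed.

(** A point with at most [q] nonzero coordinates lies on an iterated face of dimension below [q];
    face-compatible statements therefore descend to those dimensions. *)
Lemma skeleton_ind (T : nat -> Type) (d : forall n, 'I_n.+2 -> T n.+1 -> T n)
    (q : nat) (P : forall n, T n -> 'rV[RR]_n.+1 -> Prop) :
  (forall n t x, (n < q)%N -> std_simplex n x -> P n t x) ->
  (forall n t i x, std_simplex n x -> P n (d n i t) x -> P n.+1 t (face_incl i x)) ->
  forall n t x, std_simplex n x -> (nzc x <= q)%N -> P n t x.
Proof.
move=> h0 h1; elim=> [|n IH] t x sx xq.
  by apply: h0 => //; exact: leq_trans (nzc_gt0 sx) xq.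
have [nq|qn] := ltnP n.+1 q; first exact: h0.
have [i xi] : exists i, x ord0 i = 0 by apply: nzc_lt; rewrite ltnS (leq_trans xq).
rewrite -(del_coordK xi); apply: h1; first exact: del_coord_simplex.
apply: IH; first exact: del_coord_simplex.
by rewrite -(nzc_face i) del_coordK.
Qed.

Section Fill.
Variable X : topologicalType.
Variable n : nat.
Implicit Types (b : 'rV[RR]_n.+2 * RR -> X)
  (h : 'I_n.+2 -> ('rV[RR]_n.+1 * RR) * RR -> X).

(** Whichever facet through the point is picked, the value is the same, because the [h i] agree on
    overlaps. *)
Definition box_map b h (q : ('rV[RR]_n.+2 * RR) * RR) : X :=
  if [pick i | q.1.1 ord0 i == 0] is Some i then h i (del_coord i q.1.1, q.1.2, q.2)
  else b q.1.

Definition fill b h (q : ('rV[RR]_n.+2 * RR) * RR) : X :=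
  box_map b h (retr_pt q.1.1 q.2, q.1.2, retr_ht q.1.1 q.2).

Variables (b : 'rV[RR]_n.+2 * RR -> X) (h : 'I_n.+2 -> ('rV[RR]_n.+1 * RR) * RR -> X).
Hypothesis cb : cton (cyl1 n.+1) b.
Hypothesis ch : forall i, cton (cyl2 n) (h i).
Hypothesis h0 : forall i x y, std_simplex n x -> unit_interval y ->
  h i (x, y, 0) = b (face_incl i x, y).
Hypothesis hh : forall i j x x' y s, std_simplex n x -> std_simplex n x' ->
  unit_interval y -> unit_interval s -> face_incl i x = face_incl j x' ->
  h i (x, y, s) = h j (x', y, s).

Lemma box_map_side i x y s : std_simplex n.+1 x -> unit_interval y -> unit_interval s ->
  x ord0 i = 0 -> box_map b h (x, y, s) = h i (del_coord i x, y, s).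
Proof.
move=> sx Iy Is xi; rewrite /box_map /=; case: pickP => [j /eqP xj|/(_ i)]; last by rewrite xi eqxx.
by apply: hh => //; [exact: del_coord_simplex|exact: del_coord_simplex|rewrite !del_coordK].
Qed.

Lemma box_map_bottom x y : std_simplex n.+1 x -> unit_interval y ->
  box_map b h (x, y, 0) = b (x, y).
Proof.
move=> sx Iy; rewrite /box_map /=; case: pickP => [j /eqP xj|//].
by rewrite h0 ?del_coordK //; exact: del_coord_simplex.
Qed.

Let box : set (('rV[RR]_n.+2 * RR) * RR) :=
  cyl2 n.+1 `&` [set q : ('rV[RR]_n.+2 * RR) * RR | q.2 = 0 \/ exists i, q.1.1 ord0 i = 0].

Lemma box_map_continuous : cton box (box_map b h).
Proof.
pose C (o : option 'I_n.+2) : set (('rV[RR]_n.+2 * RR) * RR) :=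
  if o is Some i then [set q : ('rV[RR]_n.+2 * RR) * RR | q.1.1 ord0 i = 0]
  else [set q | q.2 = 0].
apply: (@cton_paste _ _ _ _ C).
- by case=> [i|] /=; apply: closed_eq_fun; continuity.
- by move=> q [_ [q0|[i qi]]]; [exists None|exists (Some i)].
case=> [i|] /=.
  refine (cton_comp (g := fun q : ('rV[RR]_n.+2 * RR) * RR =>
    (del_coord i q.1.1, q.1.2, q.2)) (ch i) _ _ _).
  - by continuity; refine (cts_comp (@cts_del_coord _ i) _); continuity.
  - move=> [[x y] s] [[[[sx Iy] Is] _]] /= xi; split=> //; split=> //=; exact: del_coord_simplex.
  - by move=> [[x y] s] [[[[sx Iy] Is] _]] /= xi; rewrite (box_map_side sx Iy Is xi).
refine (cton_comp (g := fst) cb _ _ _); first by continuity.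
- by move=> [[x y] s] [[[[sx Iy] Is] _]].
- by move=> [[x y] s] [[[[sx Iy] Is] _]] /= ->; rewrite box_map_bottom.
Qed.

Lemma fill_continuous : cton (cyl2 n.+1) (fill b h).
Proof.
refine (cton_comp (g := fun q : ('rV[RR]_n.+2 * RR) * RR =>
  (retr_pt q.1.1 q.2, q.1.2, retr_ht q.1.1 q.2)) box_map_continuous _ _ _) => //.
  have m0 (q : ('rV[RR]_n.+2 * RR) * RR) : retr_scale q.1.1 q.2 != 0.
    by rewrite gt_eqF // retr_scale_gt0.
  refine (cts_pair _ _); [refine (cts_pair _ _)|].
  - by apply: cts_expand => //; [exact: cts_retr_scale|continuity].
  - by continuity.
  - by rewrite /retr_ht; continuity => //; first exact: cts_retr_scale.
move=> [[x y] s] [[/= sx Iy]]; rewrite unit_intervalE => Is.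
have [h1 h2] := retr_cases sx Is; split=> /=.
  by split; [split=> //=; exact: retr_pt_simplex|rewrite unit_intervalE].
by case: h2; [left|right].
Qed.

Lemma fill_bottom x y : std_simplex n.+1 x -> unit_interval y ->
  fill b h (x, y, 0) = b (x, y).
Proof.
by move=> sx Iy; rewrite /fill /=; have [-> ->] := retr_bottom sx; exact: box_map_bottom.
Qed.

Lemma fill_face i x y s : std_simplex n x -> unit_interval y -> unit_interval s ->
  fill b h (face_incl i x, y, s) = h i (x, y, s).
Proof.
move=> sx Iy Is; rewrite /fill /=.
have sf := face_incl_simplex i sx.
have := Is; rewrite unit_intervalE => Is'.
have [-> ->] := retr_side sf Is' (face_incl_coord i x).
by rewrite (box_map_side sf Iy Is (face_incl_coord i x)) face_inclK.
Qed.
End Fill.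

(** * Extension of homotopies, natural in the simplex *)

Section Extension.
Variable X : topologicalType.
(** [T] is a semisimplicial set of labels, realised by [b] with one extra parameter. It will consist
    of simplices with chosen motions, the parameter being held at 0, and then of linked pairs of
    these, the parameter running along a closed path. *)
Variables (T : nat -> Type) (d : forall n, 'I_n.+2 -> T n.+1 -> T n).
Hypothesis dd : forall n (t : T n.+2) (i j : 'I_n.+3) (k l : 'I_n.+2),
  (forall m, lift i (lift k m) = lift j (lift l m)) -> d k (d i t) = d l (d j t).
Variable b : forall n, T n -> 'rV[RR]_n.+1 * RR -> X.
Hypothesis cb : forall n (t : T n), cton (cyl1 n) (b t).
Hypothesis bd : forall n (t : T n.+1) i x y, std_simplex n x -> unit_interval y ->
  b (d i t) (x, y) = b t (face_incl i x, y).
Variable p : nat.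
Variable g : forall n, T n -> ('rV[RR]_n.+1 * RR) * RR -> X.
Hypothesis cg : forall n (t : T n), n = p -> cton (cyl2 n) (g t).
Hypothesis g0 : forall n (t : T n) x y, n = p -> std_simplex n x -> unit_interval y ->
  g t (x, y, 0) = b t (x, y).
Hypothesis gside : forall n (t : T n) i x y s, n = p -> std_simplex n x ->
  unit_interval y -> unit_interval s -> x ord0 i = 0 -> g t (x, y, s) = b t (x, y).

(* Extends the prescribed homotopies [g] of the [p]-simplices: constant in lower
   dimensions, filled by the homotopy extension property in higher ones. *)
Fixpoint ext n : T n -> ('rV[RR]_n.+1 * RR) * RR -> X :=
  match n with
  | 0 => fun t => if (0 < p)%N then fun q => b t q.1 else @g 0 t
  | m.+1 => fun t => if (m.+1 < p)%N then fun q => b t q.1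
                     else if m.+1 == p then @g m.+1 t
                     else fill (b t) (fun i => ext (d i t))
  end.

Lemma ext_lt n (t : T n) q : (n < p)%N -> ext t q = b t q.1.
Proof. by case: n t q => [|n] t q /= ->. Qed.

Lemma ext_eq n (t : T n) : n = p -> ext t = g t.
Proof.
case: n t => [|n] t /= np; first by rewrite -np.
have -> : (n.+1 < p)%N = false by rewrite -np ltnn.
by have -> : (n.+1 == p) = true by apply/eqP.
Qed.

(** The properties are proved together: filling in dimension [n.+1] requires homotopies that agree
    where facets meet, which is compatibility with faces in dimension [n]. The match is there
    because dimension 0 has no faces. *)
Lemma ext_spec n :
  (forall t : T n, cton (cyl2 n) (ext t) /\
    (forall x y, std_simplex n x -> unit_interval y -> ext t (x, y, 0) = b t (x, y))) /\
  (if n is m.+1 then fun U : T m.+1 -> _ => forall (t : T m.+1) i x y s,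
     std_simplex m x -> unit_interval y -> unit_interval s ->
     ext (d i t) (x, y, s) = U t (face_incl i x, y, s) else fun _ => True) (@ext n).
Proof.
elim: n => [|n [IH1 IH2]].
  split=> // t; have [p0|p0] := posnP p.
    rewrite ext_eq //; split; [exact: cg|move=> x y sx Iy; exact: g0].
  split=> [|x y sx Iy]; last by rewrite ext_lt.
  refine (cton_comp (g := fst) (cb t) _ _ _); first by continuity.
    by move=> q [].
  by move=> q _; rewrite ext_lt.
have [np|pn|np] := ltngtP n.+1 p.
- split=> [t|t i x y s sx Iy Is]; last first.
    by rewrite !ext_lt //=; [exact: bd|exact: ltnW].
  split=> [|x y sx Iy]; last by rewrite ext_lt.
  refine (cton_comp (g := fst) (cb t) _ _ _); first by continuity.
    by move=> q [].
  by move=> q _; rewrite ext_lt.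
- have E (t : T n.+1) : ext t = fill (b t) (fun i => ext (d i t)).
    by rewrite /= ltnNge (ltnW pn) /= gtn_eqF.
  have h0 (t : T n.+1) i x y : std_simplex n x -> unit_interval y ->
      ext (d i t) (x, y, 0) = b t (face_incl i x, y).
    by move=> sx Iy; rewrite (IH1 _).2 // bd.
  have hh (t : T n.+1) i j x x' y s : std_simplex n x -> std_simplex n x' ->
      unit_interval y -> unit_interval s -> face_incl i x = face_incl j x' ->
      ext (d i t) (x, y, s) = ext (d j t) (x', y, s).
    move=> sx sx' Iy Is e; have [ij|ij] := eqVneq i j.
      by rewrite -ij in e *; move/face_incl_inj: e => ->.
    case: n t i j x x' {IH1 h0 E pn} sx sx' e ij IH2 => [|n] t i j x x' sx sx' e ij IH2.
      by have := face_incl_exchange0 ij e sx.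
    (* The common point lies on a codimension-two face, reached from both facets through the same
       iterated face of [t]. *)
    have [k [l [z [sz -> -> klE]]]] := face_incl_exchange ij e sx.
    by rewrite -!IH2 // (dd _ klE).
  split=> [t|t i x y s sx Iy Is]; last first.
    by rewrite E fill_face //; exact: hh.
  split=> [|x y sx Iy]; rewrite E; last by rewrite fill_bottom //; exact: h0.
  by apply: fill_continuous => //; [move=> i; exact: (IH1 _).1|exact: h0|exact: hh].
- split=> [t|t i x y s sx Iy Is]; last first.
    rewrite [RHS](congr1 (fun f => f _) (ext_eq t np)).
    rewrite (gside _ _ _ _ _ (face_incl_coord i x)) //; last exact: face_incl_simplex.
    by rewrite ext_lt -?np //= bd.
  by rewrite ext_eq //; split; [exact: cg|move=> x y sx Iy; exact: g0].
Qed.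

Lemma ext_continuous n (t : T n) : cton (cyl2 n) (ext t).
Proof. exact: ((ext_spec n).1 t).1. Qed.

Lemma ext_bottom n (t : T n) x y : std_simplex n x -> unit_interval y ->
  ext t (x, y, 0) = b t (x, y).
Proof. exact: ((ext_spec n).1 t).2. Qed.

Lemma ext_face n (t : T n.+1) i x y s :
  std_simplex n x -> unit_interval y -> unit_interval s ->
  ext (d i t) (x, y, s) = ext t (face_incl i x, y, s).
Proof. exact: (ext_spec n.+1).2. Qed.

Lemma ext_skeleton n (t : T n) x y s : std_simplex n x -> (nzc x <= p)%N ->
  unit_interval y -> unit_interval s -> ext t (x, y, s) = b t (x, y).
Proof.
move=> sx xp Iy Is.
apply: (skeleton_ind (q := p) (d := d)
  (P := fun n t x => ext t (x, y, s) = b t (x, y))) sx xp => {n t x}.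
- by move=> n t x np sx; rewrite ext_lt.
- by move=> n t i x sx; rewrite ext_face // bd.
Qed.
End Extension.

(** * Chains as weighted lists *)

(* A chain is a list of weighted simplices.  Two chains are the same when they have the
   same pairing with every function, so that no quotient is needed. *)
Definition fchain (T : Type) := seq (RR * T).

Section Pairing.
Variable T : Type.
Implicit Types (z : fchain T) (f g : T -> RR).

Definition pairing f z : RR := \sum_(x <- z) x.1 * f x.2.
Definition mass z : RR := \sum_(x <- z) `|x.1|.
Definition scale_chain (a : RR) z : fchain T := [seq (a * x.1, x.2) | x <- z].

(** Recursive, since list membership would require decidable equality on [T]. *)
Fixpoint supported (P : T -> Prop) z : Prop :=
  if z is x :: z' then P x.2 /\ supported P z' else True.

Lemma pairing_nil f : pairing f [::] = 0.
Proof. exact: big_nil. Qed.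

Lemma pairing_cons f x z : pairing f (x :: z) = x.1 * f x.2 + pairing f z.
Proof. exact: big_cons. Qed.

Lemma pairing_cat f z1 z2 : pairing f (z1 ++ z2) = pairing f z1 + pairing f z2.
Proof. exact: big_cat. Qed.

Lemma pairing_scale f a z : pairing f (scale_chain a z) = a * pairing f z.
Proof.
rewrite /pairing big_map mulr_sumr; apply: eq_bigr => x _ /=; by rewrite mulrA.
Qed.

Lemma pairingB f g z : pairing (fun x => f x - g x) z = pairing f z - pairing g z.
Proof. rewrite /pairing -sumrB; apply: eq_bigr => x _; exact: mulrBr. Qed.

Lemma pairingZ a f z : pairing (fun x => a * f x) z = a * pairing f z.
Proof. rewrite /pairing mulr_sumr; apply: eq_bigr => x _; exact: mulrCA. Qed.

Lemma pairing_sum (I : Type) (r : seq I) (F : I -> T -> RR) z :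
  pairing (fun x => \sum_(i <- r) F i x) z = \sum_(i <- r) pairing (F i) z.
Proof.
rewrite /pairing exchange_big /=; apply: eq_bigr => x _; exact: mulr_sumr.
Qed.

Lemma mass_ge0 z : 0 <= mass z.
Proof. by apply: sumr_ge0. Qed.

Lemma mass_nil : mass [::] = 0.
Proof. exact: big_nil. Qed.

Lemma mass_cat z1 z2 : mass (z1 ++ z2) = mass z1 + mass z2.
Proof. exact: big_cat. Qed.

Lemma mass_scale a z : mass (scale_chain a z) = `|a| * mass z.
Proof. rewrite /mass big_map mulr_sumr; apply: eq_bigr => x _ /=; exact: normrM. Qed.

Lemma eq_supported (P Q : T -> Prop) z :
  (forall x, P x -> Q x) -> supported P z -> supported Q z.
Proof. by move=> PQ; elim: z => [//|x z IH] /= [/PQ ? /IH]. Qed.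

Lemma supported_cat (P : T -> Prop) z1 z2 :
  supported P z1 -> supported P z2 -> supported P (z1 ++ z2).
Proof. by elim: z1 => [//|x z IH] /= [? /IH h] /h. Qed.

Lemma supported_scale (P : T -> Prop) a z : supported P z -> supported P (scale_chain a z).
Proof. by elim: z => [//|x z IH] /= [? /IH]. Qed.

Lemma eq_pairing (P : T -> Prop) f g z : supported P z ->
  (forall x, P x -> f x = g x) -> pairing f z = pairing g z.
Proof.
move=> + fg; elim: z => [|x z IH]; first by rewrite !pairing_nil.
by move=> /= [Px /IH h]; rewrite !pairing_cons h fg.
Qed.

Lemma eq_pairingT f g z : f =1 g -> pairing f z = pairing g z.
Proof. by move=> fg; apply: eq_bigr => x _; rewrite fg. Qed.

Lemma pairing_bound (P : T -> Prop) f z C : supported P z ->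
  (forall x, P x -> `|f x| <= C) -> `|pairing f z| <= C * mass z.
Proof.
move=> + fC; elim: z => [|x z IH] /=; first by rewrite pairing_nil mass_nil normr0 mulr0.
move=> [Px /IH h]; rewrite pairing_cons /mass big_cons mulrDr.
apply: le_trans (ler_normD _ _) _; apply: lerD => //.
by rewrite normrM mulrC ler_wpM2r // fC.
Qed.

Lemma supportedT z : supported (fun _ => True) z.
Proof. by elim: z. Qed.
End Pairing.

Arguments supported {T}.

Section Bind.
Variables T T' : Type.
Implicit Types (z : fchain T).

Definition map_chain (h : T -> T') z : fchain T' := [seq (x.1, h x.2) | x <- z].

Definition bind z (F : T -> fchain T') : fchain T' :=
  flatten [seq scale_chain x.1 (F x.2) | x <- z].

Lemma pairing_map (h : T -> T') f z : pairing f (map_chain h z) = pairing (f \o h) z.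
Proof. by rewrite /pairing big_map. Qed.

Lemma mass_map (h : T -> T') z : mass (map_chain h z) = mass z.
Proof. by rewrite /mass big_map. Qed.

Lemma supported_map (P : T' -> Prop) (h : T -> T') z :
  supported P (map_chain h z) <-> supported (fun x => P (h x)) z.
Proof. by elim: z => [//|x z IH] /=; rewrite IH. Qed.

Lemma pairing_bind F f z : pairing f (bind z F) = pairing (fun x => pairing f (F x)) z.
Proof.
elim: z => [|x z IH]; first by rewrite !pairing_nil.
by rewrite /bind /= pairing_cat pairing_scale pairing_cons -IH.
Qed.

Lemma mass_bind F z C : (forall x, mass (F x) <= C) -> mass (bind z F) <= C * mass z.
Proof.
move=> FC; elim: z => [|x z IH]; first by rewrite /bind !mass_nil mulr0.
rewrite /bind /= mass_cat mass_scale [mass (x :: z)]big_cons mulrDr; apply: lerD => //.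
by rewrite mulrC ler_wpM2r.
Qed.

Lemma supported_bind (P : T -> Prop) (Q : T' -> Prop) F z :
  supported P z -> (forall x, P x -> supported Q (F x)) -> supported Q (bind z F).
Proof.
move=> + PQ; elim: z => [//|x z IH] /= [/PQ h /IH ?].
by apply: supported_cat => //; exact: supported_scale.
Qed.
End Bind.

(** The coboundary: [pairing (cob d f) z] is the pairing of [f] with the boundary of [z], so
    identities between boundaries are stated by quantifying over [f]. *)
Definition cob (A B : Type) n (d : 'I_n -> A -> B) (f : B -> RR) (t : A) : RR :=
  \sum_(i < n) (-1) ^+ i * f (d i t).

Definition signed_sum (T : Type) n (F : 'I_n -> fchain T) : fchain T :=
  flatten [seq scale_chain ((-1) ^+ (i : 'I_n)) (F i) | i <- enum 'I_n].

Lemma pairing_signed_sum (T : Type) n (F : 'I_n -> fchain T) f :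
  pairing f (signed_sum F) = \sum_(i < n) (-1) ^+ i * pairing f (F i).
Proof.
rewrite /signed_sum.
have -> : \sum_(i < n) (-1) ^+ i * pairing f (F i) =
  \sum_(i <- enum 'I_n) (-1) ^+ i * pairing f (F i) by rewrite big_enum.
elim: (enum 'I_n) => [|i r IH] /=; first by rewrite pairing_nil big_nil.
by rewrite pairing_cat pairing_scale IH big_cons.
Qed.

Lemma supported_signed_sum (T : Type) n (F : 'I_n -> fchain T) (P : T -> Prop) :
  (forall i, supported P (F i)) -> supported P (signed_sum F).
Proof.
move=> FP; rewrite /signed_sum; elim: (enum 'I_n) => [//|i r IH] /=.
by apply: supported_cat => //; exact: supported_scale.
Qed.

(* The double sum vanishes because the pairs (i, k) and (j, l) removing the same two
   vertices in the two possible orders carry opposite signs. *)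
Lemma signed_sum2_eq0 n (F : 'I_n.+3 -> 'I_n.+2 -> RR) :
  (forall i j k l, (forall m, lift i (lift k m) = lift j (lift l m)) -> F i k = F j l) ->
  \sum_(i < n.+3) (-1) ^+ i * (\sum_(k < n.+2) (-1) ^+ k * F i k) = 0.
Proof.
move=> hF.
pose tau (x : 'I_n.+3 * 'I_n.+2) : 'I_n.+3 * 'I_n.+2 :=
  (lift x.1 x.2, odflt x.2 (unlift (lift x.1 x.2) x.1)).
have tauP x : lift (tau x).1 (tau x).2 = x.1.
  rewrite /tau /=; case: unliftP => [l <- //|/eqP].
  by rewrite (negbTE (neq_lift _ _)).
have tauK : involutive tau.
  move=> [i k]; have e1 : (tau (tau (i, k))).1 = i by exact: (tauP (i, k)).
  have := tauP (tau (i, k)); rewrite e1 => h.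
  have e2 : (tau (tau (i, k))).2 = k by apply: (@lift_inj _ i); rewrite h.
  by rewrite [LHS]surjective_pairing e1 e2.
have tauS x : (-1) ^+ (tau x).1 * (-1) ^+ (tau x).2 = - ((-1) ^+ x.1 * (-1) ^+ x.2) :> RR.
  have e : odd ((tau x).1 + (tau x).2) = ~~ odd (x.1 + x.2).
    have := congr1 val (tauP x); have : val (tau x).1 = bump x.1 x.2 by [].
    move: (tau x) => [j l]; rewrite /= /bump; lia.
  have sg (m : nat) : (-1) ^+ m = (if odd m then -1 else 1) :> RR by rewrite -signr_odd; case: odd.
  by rewrite -!exprD !sg e; case: (odd _); rewrite /= ?opprK.
under eq_bigr do rewrite mulr_sumr.
rewrite pair_bigA /=; set S := \sum_p _; suff : S = - S by lra.
rewrite {1}/S (reindex_inj (can_inj tauK)) /= -sumrN; apply: eq_bigr => x _.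
rewrite !mulrA tauS mulNr; congr (- (_ * _)).
apply: hF => m; apply/esym.
by apply: (lift_exchange (erefl _) (tauP x)); rewrite neq_lift.
Qed.

(** * Chains of tuples of points: cones and alternation *)

Section Tuples.
Variable E : Type.

Definition tface k (i : 'I_k.+2) (p : 'I_k.+2 -> E) : 'I_k.+1 -> E := p \o lift i.

Definition tcons k (v : E) (p : 'I_k.+1 -> E) : 'I_k.+2 -> E :=
  fun i => if unlift ord0 i is Some j then p j else v.

Definition cone k v (z : fchain ('I_k.+1 -> E)) : fchain ('I_k.+2 -> E) :=
  map_chain (tcons v) z.

Lemma tface_tcons0 k v (p : 'I_k.+1 -> E) : tface ord0 (tcons v p) = p.
Proof. by apply/funext => i; rewrite /tface /tcons /= liftK. Qed.

Lemma tface_tcons k v (p : 'I_k.+2 -> E) (i : 'I_k.+2) :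
  tface (lift ord0 i) (tcons v p) = tcons v (tface i p).
Proof.
apply/funext => j; rewrite /tface /tcons /=.
case: (unliftP ord0 j) => [j' ->|->].
  have -> : lift (lift ord0 i) (lift ord0 j') = lift ord0 (lift i j') by apply/val_inj => /=; rewrite /bump; lia.
  by rewrite liftK.
have -> : lift (lift ord0 i) ord0 = ord0 :> 'I_k.+3 by apply/val_inj => /=; rewrite /bump; lia.
by rewrite unlift_none.
Qed.

Lemma tface1_tcons v (p : 'I_1 -> E) i : tface (lift ord0 i) (tcons v p) = (fun _ => v).
Proof.
apply/funext => j; rewrite /tface /tcons /=.
have -> : lift (lift ord0 i) j = ord0 by apply/val_inj; rewrite /= !ord1.
by rewrite unlift_none.
Qed.

(** The boundary of a cone is its base minus the cone over the boundary of the base. *)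
Lemma pairing_cob_cone k v (z : fchain ('I_k.+2 -> E)) f :
  pairing (cob (@tface k.+1) f) (cone v z) =
  pairing f z - pairing (cob (@tface k) (f \o tcons v)) z.
Proof.
rewrite pairing_map -pairingB; apply: eq_pairingT => p /=.
rewrite /cob big_ord_recl /= expr0 mul1r tface_tcons0; congr (_ + _).
rewrite -sumrN; apply: eq_bigr => i _.
by rewrite tface_tcons /bump /= exprS mulN1r mulNr.
Qed.

Lemma pairing_cob_cone0 v (z : fchain ('I_1 -> E)) f :
  pairing (cob (@tface 0) f) (cone v z) =
  pairing f z - f (fun _ => v) * pairing (fun _ => 1) z.
Proof.
rewrite pairing_map -pairingZ -pairingB; apply: eq_pairingT => p /=.
rewrite /cob big_ord_recl big_ord1 /= expr0 mul1r tface_tcons0 tface1_tcons.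
by rewrite /bump /= expr1 mulN1r mulr1.
Qed.

Definition alt k (p : 'I_k.+1 -> E) : fchain ('I_k.+1 -> E) :=
  [seq ((k.+1)`!%:R^-1 * (-1) ^+ (s : 'S_k.+1), p \o s) | s <- enum 'S_k.+1].

Lemma pairing_alt k f (p : 'I_k.+1 -> E) :
  pairing f (alt p) = (k.+1)`!%:R^-1 * \sum_(s : 'S_k.+1) (-1) ^+ s * f (p \o s).
Proof.
by rewrite /pairing big_map big_enum /= mulr_sumr; apply: eq_bigr => s _; rewrite mulrA.
Qed.

(** A permutation is determined by the image [j] of [i] and by what remains after deleting [i] and
    [j]. *)
Lemma sum_lift_perm k (i : 'I_k.+2) (G : 'S_k.+2 -> RR) :
  \sum_s G s = \sum_(j < k.+2) \sum_(s' : 'S_k.+1) G (lift_perm i j s').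
Proof.
rewrite (partition_big (fun s : 'S_k.+2 => s i) xpredT) //=; apply: eq_bigr => j0 _.
rewrite (reindex (lift_perm i j0)); last first.
  pose ulsf i (s : 'S_k.+2) k := odflt k (unlift (s i) (s (lift i k))).
  have ulsfK i' (s : 'S_k.+2) k' : lift (s i') (ulsf i' s k') = s (lift i' k').
    rewrite /ulsf; have:= neq_lift i' k'.
    by rewrite -(can_eq (permK s)) => /unlift_some[] ? ? ->.
  have inj_ulsf: injective (ulsf i _).
    move=> s; apply: can_inj (ulsf (s i) s^-1%g) _ => k'.
    by rewrite {1}/ulsf ulsfK !permK liftK.
  exists (fun s => perm (inj_ulsf s)) => [s _ | s].
    by apply/permP=> k'; rewrite permE /ulsf lift_perm_lift lift_perm_id liftK.
  move/(s _ =P _) => si0; apply/permP=> k'.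
  case: (unliftP i k') => [k''|] ->; rewrite ?lift_perm_id //.
  by rewrite lift_perm_lift -si0 permE ulsfK.
by apply: eq_bigl => s; rewrite lift_perm_id eqxx.
Qed.

(** Alternation is a chain map. A permutation taking [i] to [j] turns face [i] into face [j] of the
    original tuple, with matching sign; each of the [k.+2] values of [i] contributes the same sum,
    which accounts for the quotient of the two factorials. *)
Lemma alt_cob k f (p : 'I_k.+2 -> E) :
  pairing (cob (@tface k) f) (alt p) =
  cob (@tface k) (fun q => pairing f (alt q)) p.
Proof.
rewrite pairing_alt /cob.
under eq_bigr do rewrite mulr_sumr.
rewrite exchange_big /=.
under [RHS]eq_bigr do rewrite pairing_alt mulrCA.
rewrite -mulr_sumr.
have h (i : 'I_k.+2) : \sum_(s : 'S_k.+2) (-1) ^+ s * ((-1) ^+ i * f (tface i (p \o s))) =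
    \sum_(j < k.+2) (-1) ^+ j * \sum_(s' : 'S_k.+1) (-1) ^+ s' * f (tface j p \o s').
  rewrite (sum_lift_perm i); apply: eq_bigr => j _; rewrite mulr_sumr; apply: eq_bigr => s' _.
  have -> : tface i (p \o lift_perm i j s') = tface j p \o s'.
    by apply/funext => m; rewrite /tface /= lift_perm_lift.
  rewrite odd_lift_perm (signr_addb _ (odd i (+) odd j)) (signr_addb _ (odd i)) (signr_odd _ i) (signr_odd _ j).
  have a2 : (-1) ^+ i * (-1) ^+ i = 1 :> RR by rewrite -expr2 sqrr_sign.
  move: ((-1) ^+ i : RR) a2 ((-1) ^+ j : RR) ((-1) ^+ s' : RR) (f _ : RR) => a a2 b c F.
  by rewrite -[RHS]mul1r -a2; ring.
under eq_bigr do rewrite h.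
rewrite sumr_const card_ord -[X in _ * X]mulr_natr mulrA mulrAC; congr (_ * _).
rewrite [in LHS]factS natrM invfM mulrAC mulVf ?mul1r // pnatr_eq0 //.
Qed.

(* Swapping two entries is a sign-reversing bijection of the permutations. *)
Lemma pairing_alt_swap k f (p : 'I_k.+1 -> E) (a b : 'I_k.+1) : a != b ->
  (forall s : 'S_k.+1, f (p \o s) = f (p \o (tperm a b \o s))) -> pairing f (alt p) = 0.
Proof.
move=> ab h; rewrite pairing_alt.
suff -> : \sum_(s : 'S_k.+1) (-1) ^+ s * f (p \o s) = 0 by rewrite mulr0.
set S := \sum_s _; suff : S = - S by lra.
rewrite {1}/S (reindex_inj (mulIg (tperm a b))) /= -sumrN; apply: eq_bigr => s _.
rewrite odd_permM odd_tperm ab signr_addb /= expr1 mulrN1 mulNr; congr (- (_ * _)).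
by rewrite h; congr f; apply/funext => i /=; rewrite permM tpermK.
Qed.
End Tuples.

Lemma supported_cone (E : Type) (G : E -> Prop) k v (z : fchain ('I_k.+1 -> E)) :
  G v -> supported (fun p => forall a, G (p a)) z ->
  supported (fun p => forall a, G (p a)) (cone v z).
Proof.
move=> Gv Gz; apply/supported_map; apply: eq_supported Gz => p Gp a.
by rewrite /tcons; case: unliftP.
Qed.

(** * Natural chain homotopies and subdivision by coning *)

Section Cosimplicial.
Variable E : nat -> Type.
Variable push : forall n, 'I_n.+2 -> E n -> E n.+1.
Hypothesis push_push : forall n (i j : 'I_n.+3) (k l : 'I_n.+2),
  (forall m, lift i (lift k m) = lift j (lift l m)) ->
  forall x : E n, push i (push k x) = push j (push l x).
Variable v : forall n, E n.
Variable good : forall n, E n -> Prop.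
Hypothesis good_v : forall n, good (v n).
Hypothesis good_push : forall n i (x : E n), good x -> good (push i x).

Definition tpush n k (i : 'I_n.+2) (p : 'I_k.+1 -> E n) : 'I_k.+1 -> E n.+1 := push i \o p.

Lemma supported_tpush n k i (z : fchain ('I_k.+1 -> E n)) :
  supported (fun p => forall a, good (p a)) z ->
  supported (fun p => forall a, good (p a)) (map_chain (tpush i) z).
Proof.
move=> h; apply/supported_map; apply: eq_supported h => p hp a; exact: good_push.
Qed.

Section Homotopy.
Variable Phi : forall n, fchain ('I_n.+1 -> E n).
Hypothesis Phi_chain : forall n f, pairing (cob (@tface _ n) f) (Phi n.+1) =
  \sum_(i < n.+2) (-1) ^+ i * pairing (f \o tpush i) (Phi n).
Hypothesis Phi_aug : pairing (fun _ => 1) (Phi 0) = 0.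
Hypothesis Phi_good : forall n, supported (fun p => forall a, good (p a)) (Phi n).

(** Acyclic models with the cone as contraction. [Phi], a difference of natural chain maps, vanishes
    on augmentations; the homotopy in one dimension is the cone over the defect left by the previous
    one. *)
Fixpoint hmtp n : fchain ('I_n.+2 -> E n) :=
  match n with
  | 0 => cone (v 0) (Phi 0)
  | m.+1 => cone (v m.+1) (Phi m.+1 ++
      scale_chain (-1) (signed_sum (fun i => map_chain (tpush i) (hmtp m))))
  end.

Lemma hmtp_good n : supported (fun p => forall a, good (p a)) (hmtp n).
Proof.
elim: n => [|n IH]; apply: supported_cone => //.
apply: supported_cat => //; apply: supported_scale; apply: supported_signed_sum => i.
exact: supported_tpush.
Qed.

Lemma hmtp0 f : pairing (cob (@tface _ 0) f) (hmtp 0) = pairing f (Phi 0).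
Proof. by rewrite pairing_cob_cone0 Phi_aug mulr0 subr0. Qed.

Lemma hmtpS n f : pairing (cob (@tface _ n.+1) f) (hmtp n.+1) =
  pairing f (Phi n.+1) - \sum_(i < n.+2) (-1) ^+ i * pairing (f \o tpush i) (hmtp n).
Proof.
elim: n f => [|n IH] f.
  rewrite pairing_cob_cone !pairing_cat !pairing_scale !pairing_signed_sum.
  rewrite !mulN1r Phi_chain.
  under eq_bigr do rewrite pairing_map.
  rewrite [X in _ - X](_ : _ = 0) ?subr0 //.
  rewrite -sumrB big1 // => i _; rewrite -mulrBr pairing_map.
  rewrite -[X in X - _](hmtp0 _) /=.
  by rewrite subrr mulr0.
rewrite pairing_cob_cone !pairing_cat !pairing_scale !pairing_signed_sum.
rewrite !mulN1r Phi_chain.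
under eq_bigr do rewrite pairing_map.
(* What is coned off is a cycle: [Phi_chain] and the induction hypothesis leave a double sum over
   codimension-two faces. *)
rewrite [X in _ - X](_ : _ = 0) ?subr0 //.
rewrite -sumrB.
under eq_bigr => i _.
  rewrite -mulrBr pairing_map [X in _ - X](_ : _ = pairing (cob (@tface _ n.+1) ((f \o tcons (v n.+2)) \o tpush i)) (hmtp n.+1)) //.
  rewrite IH opprB addrC subrK.
  over.
apply: signed_sum2_eq0 => i j k l e; apply: eq_pairingT => p /=; congr (f (tcons _ _)).
by apply/funext => a /=; exact: push_push.
Qed.
End Homotopy.

Section Subdivision.
Variables (T : nat -> Type) (d : forall n, 'I_n.+2 -> T n.+1 -> T n).
Hypothesis dd : forall n (t : T n.+2) (i j : 'I_n.+3) (k l : 'I_n.+2),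
  (forall m, lift i (lift k m) = lift j (lift l m)) -> d k (d i t) = d l (d j t).
Variables (Col : Type) (col : forall n, T n -> Col).

Definition cpush n k (i : 'I_n.+2) (p : 'I_k.+1 -> E n * Col) : 'I_k.+1 -> E n.+1 * Col :=
  fun a => (push i (p a).1, (p a).2).

(** Barycentric subdivision once [v] is the barycentre. The entries of a tuple are the cone points
    of a descending flag of faces, beginning with the whole simplex, and each carries the colour of
    its face; on a common face the colours thus agree. *)
Fixpoint sdiv n : T n -> fchain ('I_n.+1 -> E n * Col) :=
  match n with
  | 0 => fun t => [:: (1, fun _ => (v 0, col t))]
  | m.+1 => fun t => cone (v m.+1, col t)
                       (signed_sum (fun i => map_chain (cpush i) (sdiv (d i t))))
  end.

Lemma sdiv_cob n (t : T n.+1) f : pairing (cob (@tface _ n) f) (sdiv t) =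
  \sum_(i < n.+2) (-1) ^+ i * pairing (f \o cpush i) (sdiv (d i t)).
Proof.
elim: n t f => [|n IH] t f.
  rewrite pairing_cob_cone0 !pairing_signed_sum !big_ord_recl !big_ord0 /=.
  by rewrite /pairing !big_cons !big_nil /= /bump /= !expr0; ring.
rewrite pairing_cob_cone !pairing_signed_sum.
under eq_bigr do rewrite pairing_map.
rewrite [X in _ - X](_ : _ = 0) ?subr0 //.
under eq_bigr => i _.
  rewrite pairing_map [X in _ * X](_ : _ = pairing (cob (@tface _ n) ((f \o tcons (v n.+2, col t)) \o cpush i)) (sdiv (d i t))) //.
  rewrite IH.
  over.
apply: signed_sum2_eq0 => i j k l e; rewrite (dd _ e); apply: eq_pairingT => p /=.
congr (f (tcons _ _)).
by apply/funext => a /=; congr (_, _); exact: push_push.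
Qed.

Lemma sdiv_good n (t : T n) : supported (fun p => forall a, good (p a).1) (sdiv t).
Proof.
elim: n t => [|n IH] t /=; first by split.
apply: (@supported_cone _ (fun x : E n.+1 * Col => good x.1)) => //.
apply: supported_signed_sum => i; apply/supported_map.
by apply: eq_supported (IH (d i t)) => p hp a; apply: good_push.
Qed.
End Subdivision.
End Cosimplicial.

(** * Paths of maps *)

Lemma maxl (a b : RR) : b <= a -> Num.max a b = a. Proof. by move/max_idPl. Qed.
Lemma maxr (a b : RR) : a <= b -> Num.max a b = b. Proof. by move/max_idPr. Qed.
Lemma minl (a b : RR) : a <= b -> Num.min a b = a. Proof. by move/min_idPl. Qed.
Lemma minr (a b : RR) : b <= a -> Num.min a b = b. Proof. by move/min_idPr. Qed.

Section Paths.
Variables (S X : topologicalType) (A B : set S).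
Implicit Types (c e b : S * RR -> X) (k : S * RR * RR -> X).

Definition pcat c e (q : S * RR) : X :=
  if q.2 <= 2^-1 then c (q.1, 2 * q.2) else e (q.1, 2 * q.2 - 1).

Definition pathinv c (q : S * RR) : X := c (q.1, 1 - q.2).

Definition pcst (f : S -> X) (q : S * RR) : X := f q.1.

(** A path of maps on [A], stationary on [B], written as one map on the product so that no topology
    on mapping spaces enters. *)
Definition is_path c : Prop :=
  cton (A `*` unit_interval) c /\
  forall x t, A x -> B x -> unit_interval t -> c (x, t) = c (x, 0).

Definition path_eqv c e : Prop :=
  exists k, [/\ cton ((A `*` unit_interval) `*` unit_interval) k,
    forall x t, A x -> unit_interval t -> k (x, t, 0) = c (x, t),
    forall x t, A x -> unit_interval t -> k (x, t, 1) = e (x, t),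
    forall x s, A x -> unit_interval s -> k (x, 0, s) = c (x, 0) /\ k (x, 1, s) = c (x, 1) &
    forall x t s, A x -> B x -> unit_interval t -> unit_interval s -> k (x, t, s) = c (x, 0)].

Lemma pcat0 c e x : pcat c e (x, 0) = c (x, 0).
Proof. by rewrite /pcat /= mulr0 invr_ge0 ler0n. Qed.

Lemma pcat1 c e x : pcat c e (x, 1) = e (x, 1).
Proof.
rewrite /pcat /= ifN; first by congr (e (_, _)); lra.
by apply/negP => h; lra.
Qed.

Lemma pathinv0 c x : pathinv c (x, 0) = c (x, 1).
Proof. by rewrite /pathinv /= subr0. Qed.

Lemma pathinv1 c x : pathinv c (x, 1) = c (x, 0).
Proof. by rewrite /pathinv /= subrr. Qed.

Lemma pcat_continuous c e : cton (A `*` unit_interval) c -> cton (A `*` unit_interval) e ->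
  (forall x, A x -> c (x, 1) = e (x, 0)) -> cton (A `*` unit_interval) (pcat c e).
Proof.
move=> cc ce ends.
pose C (b : bool) : set (S * RR) := if b then [set q | q.2 <= 2^-1] else [set q | 2^-1 <= q.2].
apply: (@cton_paste _ _ _ _ C).
- by case; [apply: closed_le_fun|apply: closed_ge_fun]; continuity.
- move=> [x t] _; have [h|/ltW h] := leP t 2^-1; [by exists true|by exists false].
case=> /=.
  apply: (cton_comp (g := fun q : S * RR => (q.1, 2 * q.2)) cc); first by continuity.
    move=> [x t] [[/= Ax]]; rewrite !unit_intervalE => It h; split=> //=.
    by rewrite ?unit_intervalE; lra.
  by move=> [x t] [_ /= h]; rewrite /pcat /= h.
apply: (cton_comp (g := fun q : S * RR => (q.1, 2 * q.2 - 1)) ce); first by continuity.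
  move=> [x t] [[/= Ax]]; rewrite !unit_intervalE => It h; split=> //=.
  by rewrite ?unit_intervalE; lra.
move=> [x t] [[/= Ax _] h]; rewrite /pcat /=; case: ifP => // h'.
have -> : t = 2^-1 by lra.
by rewrite divff // subrr ends.
Qed.

Lemma pcat_path c e : is_path c -> is_path e -> (forall x, A x -> c (x, 1) = e (x, 0)) ->
  is_path (pcat c e).
Proof.
move=> [cc Bc] [ce Be] ends; split; first exact: pcat_continuous.
move=> x t Ax Bx; rewrite unit_intervalE => It; rewrite pcat0 /pcat /=; case: ifP => h.
  by rewrite Bc // unit_intervalE; lra.
have h' : 2^-1 < t by rewrite ltNge h.
rewrite Be // ?unit_intervalE; last by lra.
by rewrite -ends // (Bc x 1) //; exact: unit_interval1.
Qed.

Lemma pathinv_path c : is_path c -> is_path (pathinv c).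
Proof.
move=> [cc Bc]; split.
  apply: (cton_comp (g := fun q : S * RR => (q.1, 1 - q.2)) cc) => //; first by continuity.
  by move=> [x t] [/= Ax]; rewrite !unit_intervalE => It; split=> //=; rewrite ?unit_intervalE; lra.
move=> x t Ax Bx; rewrite unit_intervalE => It.
by rewrite pathinv0 /pathinv /= !Bc //; [exact: unit_interval1|rewrite ?unit_intervalE; lra].
Qed.

Lemma pcst_path (f : S -> X) : cton A f -> is_path (pcst f).
Proof.
move=> cf; split=> //.
apply: (cton_comp (g := fst) cf) => //; first by continuity.
by move=> q [].
Qed.

Lemma path_eqv_refl c : is_path c -> path_eqv c c.
Proof.
move=> [cc Bc]; exists (fun q => c q.1); split=> //.
- apply: (cton_comp (g := fst) cc) => //; first by continuity.
  by move=> q [].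
- by move=> x t s *; exact: Bc.
Qed.

Lemma path_eqv_ends c e x : path_eqv c e -> A x -> c (x, 0) = e (x, 0) /\ c (x, 1) = e (x, 1).
Proof.
move=> [k [_ k0 k1 ks _]] Ax; have [e0 e1] := ks x 1 Ax unit_interval1.
by rewrite -e0 -e1 !k1 //; [exact: unit_interval1|exact: unit_interval0].
Qed.

Lemma path_eqv_sym c e : path_eqv c e -> path_eqv e c.
Proof.
move=> h; have ends := path_eqv_ends h; move: h => [k [ck k0 k1 ks kB]].
exists (fun q => k (q.1, 1 - q.2)).
have I1 s : unit_interval s -> unit_interval (1 - s) by rewrite !unit_intervalE; lra.
split.
- apply: (cton_comp (g := fun q : S * RR * RR => (q.1, 1 - q.2)) ck) => //; first by continuity.
  by move=> q [h1 h2]; split=> //=; exact: I1.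
- by move=> x t Ax It /=; rewrite subr0 k1.
- by move=> x t Ax It /=; rewrite subrr k0.
- move=> x s Ax Is /=; have [<- <-] := ends x Ax.
  by apply: ks => //; exact: I1.
- move=> x t s Ax Bx It Is /=; rewrite kB //; last exact: I1.
  by have [] := ends x Ax.
Qed.

Lemma path_eqv_trans c e b : path_eqv c e -> path_eqv e b -> path_eqv c b.
Proof.
move=> h h'; have ends := path_eqv_ends h.
move: h h' => [k [ck k0 k1 ks kB]] [l [cl l0 l1 ls lB]].
exists (fun q => if q.2 <= 2^-1 then k (q.1, 2 * q.2) else l (q.1, 2 * q.2 - 1)).
split.
- pose C (b : bool) : set (S * RR * RR) :=
    if b then [set q | q.2 <= 2^-1] else [set q | 2^-1 <= q.2].
  apply: (@cton_paste _ _ _ _ C).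
  + by case; [apply: closed_le_fun|apply: closed_ge_fun]; continuity.
  + move=> [x t] _; have [h|/ltW h] := leP t 2^-1; [by exists true|by exists false].
  case=> /=.
    apply: (cton_comp (g := fun q : S * RR * RR => (q.1, 2 * q.2)) ck); first by continuity.
      move=> [x t] [[/= Ax]]; rewrite !unit_intervalE => It h; split=> //=.
      by rewrite ?unit_intervalE; lra.
    by move=> [x t] [_ /= h]; rewrite /= h.
  apply: (cton_comp (g := fun q : S * RR * RR => (q.1, 2 * q.2 - 1)) cl); first by continuity.
    move=> [x t] [[/= Ax]]; rewrite !unit_intervalE => It h; split=> //=.
    by rewrite ?unit_intervalE; lra.
  move=> [[x t] s] [[/= [Ax It] _] h] /=; case: ifP => // h'.
  have -> : s = 2^-1 by lra.
  by rewrite divff // subrr k1 // l0.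
- by move=> x t Ax It /=; rewrite mulr0 invr_ge0 ler0n k0.
- move=> x t Ax It /=; rewrite ifN; last by apply/negP => h; lra.
  by rewrite (_ : 2 * 1 - 1 = 1) ?l1 //; lra.
- move=> x s Ax; rewrite unit_intervalE => Is /=; case: ifP => h.
    by apply: ks => //; rewrite ?unit_intervalE; lra.
  have h' : 2^-1 < s by rewrite ltNge h.
  have [-> ->] := ends x Ax; apply: ls => //; rewrite ?unit_intervalE; lra.
- move=> x t s Ax Bx It; rewrite unit_intervalE => Is /=; case: ifP => h.
    by apply: kB => //; rewrite ?unit_intervalE; lra.
  have h' : 2^-1 < s by rewrite ltNge h.
  have [-> _] := ends x Ax; apply: lB => //; rewrite ?unit_intervalE; lra.
Qed.

Lemma path_eqv_ext c e : is_path c -> (forall x t, A x -> unit_interval t -> c (x, t) = e (x, t)) ->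
  path_eqv c e.
Proof.
move=> hc ce; have [k [ck k0 k1 ks kB]] := path_eqv_refl hc.
by exists k; split=> // x t Ax It; rewrite k1 // ce.
Qed.

Lemma path_eqv_cat c c' e e' : path_eqv c c' -> path_eqv e e' ->
  (forall x, A x -> c (x, 1) = e (x, 0)) -> path_eqv (pcat c e) (pcat c' e').
Proof.
move=> [k [ck k0 k1 ks kB]] [l [cl l0 l1 ls lB]] ends.
have lB' x t s : A x -> B x -> unit_interval t -> unit_interval s -> l (x, t, s) = c (x, 0).
  move=> Ax Bx It Is; rewrite lB // -ends // -(ks x s Ax Is).2.
  by rewrite kB //; exact: unit_interval1.
exists (fun q => if q.1.2 <= 2^-1 then k (q.1.1, 2 * q.1.2, q.2) else l (q.1.1, 2 * q.1.2 - 1, q.2)).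
split.
- pose C (b : bool) : set (S * RR * RR) :=
    if b then [set q | q.1.2 <= 2^-1] else [set q | 2^-1 <= q.1.2].
  apply: (@cton_paste _ _ _ _ C).
  + by case; [apply: closed_le_fun|apply: closed_ge_fun]; continuity.
  + move=> [[x t] s] _; have [h|/ltW h] := leP t 2^-1; [by exists true|by exists false].
  case=> /=.
    apply: (cton_comp (g := fun q : S * RR * RR => (q.1.1, 2 * q.1.2, q.2)) ck); first by continuity.
      move=> [[x t] s] [[[/= Ax It] Is] /= h]; split=> //; split=> //.
      by move: It; rewrite !unit_intervalE /=; lra.
    by move=> [[x t] s] [_ /= h]; rewrite /= h.
  apply: (cton_comp (g := fun q : S * RR * RR => (q.1.1, 2 * q.1.2 - 1, q.2)) cl); first by continuity.
    move=> [[x t] s] [[[/= Ax It] Is] /= h]; split=> //; split=> //.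
    by move: It; rewrite !unit_intervalE /=; lra.
  move=> [[x t] s] [[/= [Ax It] Is] h] /=; case: ifP => // h'.
  have -> : t = 2^-1 by move: h h' => /= h h'; lra.
  by rewrite divff // subrr (ks x s Ax Is).2 (ls x s Ax Is).1 ends.
- move=> x t Ax; rewrite unit_intervalE => It /=; rewrite /pcat /=; case: ifP => h.
    by rewrite k0 // unit_intervalE; lra.
  have h' : 2^-1 < t by rewrite ltNge h.
  by rewrite l0 // unit_intervalE; lra.
- move=> x t Ax; rewrite unit_intervalE => It /=; rewrite /pcat /=; case: ifP => h.
    by rewrite k1 // unit_intervalE; lra.
  have h' : 2^-1 < t by rewrite ltNge h.
  by rewrite l1 // unit_intervalE; lra.
- move=> x s Ax Is /=; rewrite pcat0 pcat1 mulr0 invr_ge0 ler0n; split; first exact: (ks x s Ax Is).1.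
  rewrite ifN; last by apply/negP => h; lra.
  rewrite (_ : 2 * 1 - 1 = 1); [exact: (ls x s Ax Is).2|lra].
- move=> x t s Ax Bx; rewrite unit_intervalE => It Is /=; rewrite pcat0; case: ifP => h.
    by apply: kB => //; rewrite ?unit_intervalE; lra.
  have h' : 2^-1 < t by rewrite ltNge h.
  by apply: lB' => //; rewrite ?unit_intervalE; lra.
Qed.

Lemma path_eqv_inv c e : path_eqv c e -> path_eqv (pathinv c) (pathinv e).
Proof.
move=> [k [ck k0 k1 ks kB]].
have I1 s : unit_interval s -> unit_interval (1 - s) by rewrite !unit_intervalE; lra.
exists (fun q => k (q.1.1, 1 - q.1.2, q.2)); split.
- apply: (cton_comp (g := fun q : S * RR * RR => (q.1.1, 1 - q.1.2, q.2)) ck) => //; first by continuity.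
  by move=> q [[h1 h2] h3]; split=> //; split=> //=; exact: I1.
- by move=> x t Ax It; rewrite /= k0 //; exact: I1.
- by move=> x t Ax It; rewrite /= k1 //; exact: I1.
- by move=> x s Ax Is /=; rewrite pathinv0 pathinv1 subr0 subrr; have [] := ks x s Ax Is.
- move=> x t s Ax Bx It Is /=; rewrite pathinv0 kB //; last exact: I1.
  by have [_ <-] := ks x s Ax Is; rewrite kB //; exact: unit_interval1.
Qed.

(** Convex combination of the two reparametrisations. The associativity, unit and inverse laws below
    reduce to it. *)
Lemma path_eqv_reparam c (f g : RR -> RR) : is_path c -> cts f -> cts g ->
  (forall t, unit_interval t -> unit_interval (f t)) ->
  (forall t, unit_interval t -> unit_interval (g t)) -> f 0 = g 0 -> f 1 = g 1 ->
  path_eqv (fun q => c (q.1, f q.2)) (fun q => c (q.1, g q.2)).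
Proof.
move=> [cc Bc] cf cg If Ig fg0 fg1.
have I01 t s : unit_interval t -> unit_interval s ->
    unit_interval ((1 - s) * f t + s * g t).
  move=> It; have := If t It; have := Ig t It; rewrite !unit_intervalE => ? ? ?; nra.
exists (fun q => c (q.1.1, (1 - q.2) * f q.1.2 + q.2 * g q.1.2)); split.
- apply: (cton_comp (g := fun q : S * RR * RR =>
    (q.1.1, (1 - q.2) * f q.1.2 + q.2 * g q.1.2)) cc) => //.
    by continuity; apply: cts_comp => //; continuity.
  by move=> q [[h1 h2] h3]; split=> //=; exact: I01.
- by move=> x t Ax It /=; rewrite subr0 mul1r mul0r addr0.
- by move=> x t Ax It /=; rewrite subrr mul1r mul0r add0r.
- by move=> x s Ax Is /=; rewrite -fg0 -fg1 -!mulrDl subrK !mul1r.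
- move=> x t s Ax Bx It Is /=; rewrite !Bc //; last exact: I01.
  exact: (If 0 unit_interval0).
Qed.

Lemma path_eqv_assoc c e b : is_path c -> is_path e -> is_path b ->
  (forall x, A x -> c (x, 1) = e (x, 0)) -> (forall x, A x -> e (x, 1) = b (x, 0)) ->
  path_eqv (pcat (pcat c e) b) (pcat c (pcat e b)).
Proof.
move=> hc he hb ce eb.
have hG : is_path (pcat (pcat c e) b).
  by apply: pcat_path => //; [exact: pcat_path|move=> x Ax; rewrite pcat1 eb].
(* The change of parameter with slopes 1/2, 1 and 2; being convex it is a maximum of affine
   functions, and so visibly continuous. *)
pose f (t : RR) : RR := Num.max (t / 2) (Num.max (t - 4^-1) (2 * t - 1)).
have If t : unit_interval t -> unit_interval (f t).
  rewrite !unit_intervalE /f => It; rewrite le_max !ge_max; lra.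
have fE1 t : t <= 2^-1 -> f t = t / 2 by move=> h; rewrite /f maxl // ge_max; lra.
have fE2 t : 2^-1 <= t -> t <= 3 / 4 -> f t = t - 4^-1.
  by move=> h h'; rewrite /f (@maxl (t - 4^-1)) ?maxr //; lra.
have fE3 t : 3 / 4 <= t -> f t = 2 * t - 1.
  by move=> h; rewrite /f (@maxr (t - 4^-1)) ?maxr //; lra.
have f0 : f 0 = 0 by rewrite fE1 ?mul0r // invr_ge0.
have f1 : f 1 = 1 by rewrite fE3; lra.
have cf : cts f by rewrite /f; continuity.
have h := @path_eqv_reparam _ id f hG (@cts_id _) cf (fun t It => It) If (esym f0) (esym f1).
apply: path_eqv_trans (path_eqv_trans h _).
  by apply: path_eqv_ext => // -[].
have hG' : is_path (fun q => pcat (pcat c e) b (q.1, f q.2)).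
  split.
    apply: (cton_comp (g := fun q : S * RR => (q.1, f q.2)) hG.1) => //.
      by continuity; apply: cts_comp => //; continuity.
    by move=> q [h1 h2]; split=> //=; exact: If.
  by move=> x t Ax Bx It /=; rewrite f0 hG.2 //; exact: If.
apply: path_eqv_ext => // x t Ax; rewrite unit_intervalE => It /=.
have [t1|t1] := leP t 2^-1.
  rewrite fE1 //.
  rewrite /pcat /= t1; have -> : t / 2 <= 2^-1 by lra.
  have -> : 2 * (t / 2) <= 2^-1 by lra.
  by congr (c (_, _)); lra.
have [t2|t2] := leP t (3 / 4).
  rewrite fE2 ?(ltW t1) //.
  rewrite /pcat /=; have -> : t - 4^-1 <= 2^-1 by lra.
  have -> : (2 * (t - 4^-1) <= 2^-1) = false by apply/negbTE; rewrite -ltNge; lra.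
  have -> : (t <= 2^-1) = false by apply/negbTE; rewrite -ltNge; lra.
  have -> : 2 * t - 1 <= 2^-1 by lra.
  by congr (e (_, _)); lra.
rewrite fE3 ?(ltW t2) //.
rewrite /pcat /=; have -> : (2 * t - 1 <= 2^-1) = false by apply/negbTE; rewrite -ltNge; lra.
have -> : (t <= 2^-1) = false by apply/negbTE; rewrite -ltNge; lra.
by congr (b (_, _)); lra.
Qed.

Lemma reparam_path c f : is_path c -> cts f ->
  (forall t, unit_interval t -> unit_interval (f t)) -> is_path (fun q => c (q.1, f q.2)).
Proof.
move=> [cc Bc] cf If; split.
  apply: (cton_comp (g := fun q : S * RR => (q.1, f q.2)) cc) => //.
    by continuity; apply: cts_comp => //; continuity.
  by move=> q [h1 h2]; split=> //=; exact: If.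
by move=> x t Ax Bx It /=; rewrite !(Bc _ (f _)) //; apply: If => //; exact: unit_interval0.
Qed.

Lemma path_eqv_cst_l c f : is_path c -> (forall x, A x -> c (x, 0) = f x) ->
  path_eqv (pcat (pcst f) c) c.
Proof.
move=> hc cf.
pose g (t : RR) : RR := Num.max 0 (2 * t - 1).
have Ig t : unit_interval t -> unit_interval (g t).
  rewrite !unit_intervalE /g => It; rewrite le_max !ge_max; lra.
have g0 : g 0 = 0 by rewrite /g maxl //; lra.
have g1 : g 1 = 1 by rewrite /g maxr; lra.
have cg : cts g by rewrite /g; continuity.
apply: path_eqv_sym.
apply: path_eqv_trans (path_eqv_trans (@path_eqv_reparam _ id g hc (@cts_id _) cg (fun t It => It) Ig (esym g0) (esym g1)) _).
  by apply: path_eqv_ext => // -[].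
apply: path_eqv_ext; first exact: reparam_path.
move=> x t Ax It; rewrite /pcat /pcst /g /=; case: ifP => h.
  by rewrite -cf // maxl //; lra.
have h' : 2^-1 < t by rewrite ltNge h.
by rewrite maxr //; lra.
Qed.

Lemma path_eqv_cst_r c f : is_path c -> (forall x, A x -> c (x, 1) = f x) ->
  path_eqv (pcat c (pcst f)) c.
Proof.
move=> hc cf.
pose g (t : RR) : RR := Num.min 1 (2 * t).
have Ig t : unit_interval t -> unit_interval (g t).
  rewrite !unit_intervalE /g => It; rewrite ge_min !le_min; lra.
have g0 : g 0 = 0 by rewrite /g minr; lra.
have g1 : g 1 = 1 by rewrite /g minl //; lra.
have cg : cts g by rewrite /g; continuity.
apply: path_eqv_sym.
apply: path_eqv_trans (path_eqv_trans (@path_eqv_reparam _ id g hc (@cts_id _) cg (fun t It => It) Ig (esym g0) (esym g1)) _).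
  by apply: path_eqv_ext => // -[].
apply: path_eqv_ext; first exact: reparam_path.
move=> x t Ax It; rewrite /pcat /pcst /g /=; case: ifP => h.
  by rewrite minr //; lra.
have h' : 2^-1 < t by rewrite ltNge h.
by rewrite -cf // minl //; lra.
Qed.

Lemma path_eqv_inv_r c f : is_path c -> (forall x, A x -> c (x, 0) = f x) ->
  path_eqv (pcat c (pathinv c)) (pcst f).
Proof.
move=> hc cf.
(* Going out and back is [c] along a tent function, which is deformed to the constant 0. *)
pose g (t : RR) : RR := Num.min (2 * t) (2 - 2 * t).
have Ig t : unit_interval t -> unit_interval (g t).
  rewrite !unit_intervalE /g => It; rewrite ge_min !le_min; lra.
have g0 : g 0 = 0 by rewrite /g minl; lra.
have g1 : g 1 = 0 by rewrite /g minr; lra.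
have cg : cts g by rewrite /g; continuity.
have I0 (t : RR) : unit_interval t -> unit_interval (0 : RR) by move=> _; exact: unit_interval0.
have h := @path_eqv_reparam _ g (fun _ => 0) hc cg (@cts_cst _ _ _) Ig I0 g0 g1.
apply: path_eqv_trans (path_eqv_trans h _).
  apply: path_eqv_sym; apply: path_eqv_ext; first exact: reparam_path.
  move=> x t Ax It; rewrite /pcat /pathinv /g /=; case: ifP => h'.
    by rewrite minl //; lra.
  have h'' : 2^-1 < t by rewrite ltNge h'.
  by rewrite minr; [congr (c (_, _)); lra|lra].
apply: path_eqv_ext; last by move=> x t Ax It; rewrite /pcst /= cf.
exact: (reparam_path hc (@cts_cst _ _ _) I0).
Qed.

Lemma path_eqv_inv_l c f : is_path c -> (forall x, A x -> c (x, 1) = f x) ->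
  path_eqv (pcat (pathinv c) c) (pcst f).
Proof.
move=> hc cf; have hi := pathinv_path hc.
have h := path_eqv_inv_r hi (f := f) (fun x Ax => etrans (pathinv0 c x) (cf x Ax)).
apply: path_eqv_trans h; apply: path_eqv_ext.
  by apply: pcat_path => // x Ax; rewrite pathinv1.
move=> x t Ax It; rewrite /pcat /pathinv /=; case: ifP => // _.
by congr (c (_, _)); lra.
Qed.
End Paths.

(** * Coloured singular simplices *)

Definition bdy n : set 'rV[RR]_n.+1 := [set x | exists i, x ord0 i = 0].
(* [skel p n] is the (p-1)-skeleton. *)
Definition skel p n : set 'rV[RR]_n.+1 := [set x | (nzc x <= p)%N].
Arguments bdy : clear implicits.
Arguments skel : clear implicits.

Lemma bdy_skel n x : bdy n x -> skel n n x.
Proof.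
case=> i xi; rewrite /skel /= /nzc -ltnS -[X in (_ < X)%N](card_ord n.+1).
apply: proper_card; apply/properP; split; first exact/fintype.subsetP.
by exists i => //; rewrite inE xi eqxx.
Qed.

Lemma skel_all n x : skel n.+1 n x.
Proof. by rewrite /skel /= -[X in (_ <= X)%N](card_ord n.+1) max_card. Qed.

Lemma nzc_act k n (th : 'I_k.+1 -> 'I_n.+1) x : (nzc (act_map th x) <= nzc x)%N.
Proof.
rewrite /nzc; apply: leq_trans (leq_image_card th _); apply: subset_leq_card.
apply/fintype.subsetP => j; rewrite inE => hj.
have [i ij xi] : exists2 i, th i = j & x ord0 i != 0.
  apply/not_exists2P => h; move: hj; rewrite act_mapE big1 ?eqxx // => i /eqP ij.
  by have [//|/negP/negPn/eqP] := h i.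
by apply/fintype.imageP; exists i => //; rewrite inE.
Qed.

Section Simplices.
Variable X : topologicalType.

Definition sing n := {f : 'rV[RR]_n.+1 -> X | is_singular_simplex f}.

Lemma sing_cton n (s : sing n) : cton (std_simplex n) (sval s).
Proof. by have [cf _] := svalP s; exact: Cton cf. Qed.

Lemma normalizeE n (f : 'rV[RR]_n.+1 -> X) x : std_simplex n x -> normalize f x = f x.
Proof. by move=> sx; rewrite /normalize; case: pselect. Qed.

Lemma normalizeN n (f : 'rV[RR]_n.+1 -> X) x : ~ std_simplex n x ->
  normalize f x = f (vertex0 n).
Proof. by move=> sx; rewrite /normalize; case: pselect. Qed.

Lemma eq_normalize n (f g : 'rV[RR]_n.+1 -> X) :
  (forall x, std_simplex n x -> f x = g x) -> normalize f = normalize g.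
Proof.
move=> fg; apply/funext => x; have [sx|sx] := pselect (std_simplex n x).
  by rewrite !normalizeE // fg.
by rewrite !normalizeN // fg //; exact: vertex0_simplex.
Qed.

Lemma normalize_singular n (f : 'rV[RR]_n.+1 -> X) :
  cton (std_simplex n) f -> is_singular_simplex (normalize f).
Proof.
move=> cf; split; last by apply: eq_normalize => x sx; rewrite normalizeE.
by have [] := cton_eq cf (g := normalize f) (fun x sx => normalizeE _ sx).
Qed.

Lemma cst_cton n (a : X) : cton (std_simplex n) (fun _ => a).
Proof. by split; apply: continuous_subspaceT; case: (@cts_cst 'rV[RR]_n.+1 X a). Qed.

(** Total, with a constant simplex as value on discontinuous maps, so that operations on simplices
    take no continuity proof as argument. *)
Definition to_sing n (f : 'rV[RR]_n.+1 -> X) : sing n :=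
  match pselect (cton (std_simplex n) f) with
  | left h => exist _ _ (normalize_singular h)
  | right _ => exist _ _ (normalize_singular (cst_cton n (f (vertex0 n))))
  end.

Lemma to_singE n (f : 'rV[RR]_n.+1 -> X) x :
  cton (std_simplex n) f -> std_simplex n x -> sval (to_sing f) x = f x.
Proof. by move=> cf sx; rewrite /to_sing; case: pselect => //= ?; exact: normalizeE. Qed.

Lemma sing_ext n (s s' : sing n) :
  (forall x, std_simplex n x -> sval s x = sval s' x) -> s = s'.
Proof.
move=> h; have [_ e] := svalP s; have [_ e'] := svalP s'.
case: s s' h e e' => [f hf] [f' hf'] /= h e e'; apply: eq_exist.
by rewrite -e -e'; exact: eq_normalize.
Qed.

Definition act k n (th : 'I_k.+1 -> 'I_n.+1) (s : sing n) : sing k :=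
  to_sing (sval s \o act_map th).

Lemma cts_act_map k n (th : 'I_k.+1 -> 'I_n.+1) : cts (act_map th).
Proof. exact: cts_aff. Qed.

Lemma actE k n (th : 'I_k.+1 -> 'I_n.+1) (s : sing n) x : std_simplex k x ->
  sval (act th s) x = sval s (act_map th x).
Proof.
move=> sx; rewrite to_singE //.
apply: (cton_comp (g := act_map th) (sing_cton s)) => //; first exact: cts_act_map.
by move=> y; exact: act_map_simplex.
Qed.

Lemma act_comp l k n (th : 'I_k.+1 -> 'I_n.+1) (et : 'I_l.+1 -> 'I_k.+1) (s : sing n) :
  act et (act th s) = act (th \o et) s.
Proof.
apply: sing_ext => x sx; rewrite !actE //; last exact: act_map_simplex.
by rewrite act_map_comp.
Qed.

Definition dS n (i : 'I_n.+2) (s : sing n.+1) : sing n := act (lift i) s.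

Lemma dSE n (i : 'I_n.+2) (s : sing n.+1) x : std_simplex n x ->
  sval (dS i s) x = sval s (face_incl i x).
Proof. by move=> sx; rewrite actE // face_inclE. Qed.

Lemma dS_face n (i : 'I_n.+2) (s : sing n.+1) : sval (dS i s) = face i (sval s).
Proof.
rewrite /face; have [_ <-] := svalP (dS i s).
by apply: eq_normalize => x sx; rewrite dSE.
Qed.

Variables (Col : Type) (U : Col -> set X).

(** Colours are bare data: a vertex need not lie in the set of its colour, and if it does not,
    [allowed] keeps it in place up to homotopy. *)
Definition csing n := (sing n * ('I_n.+1 -> Col))%type.

Definition actT k n (th : 'I_k.+1 -> 'I_n.+1) (t : csing n) : csing k :=
  (act th t.1, t.2 \o th).

Definition dT n (i : 'I_n.+2) (t : csing n.+1) : csing n := actT (lift i) t.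

Lemma dT_dT n (t : csing n.+2) (i j : 'I_n.+3) (k l : 'I_n.+2) :
  (forall m, lift i (lift k m) = lift j (lift l m)) -> dT k (dT i t) = dT l (dT j t).
Proof.
move=> e; rewrite /dT /actT /= !act_comp.
have e' : lift i \o lift k = lift j \o lift l by exact/funext.
by congr (_, _); [rewrite e'|apply/funext => a /=; rewrite e].
Qed.

Lemma csing_ext n (t t' : csing n) : t.2 = t'.2 ->
  (forall x, std_simplex n x -> sval t.1 x = sval t'.1 x) -> t = t'.
Proof. by case: t t' => [s c] [s' c'] /= -> h; congr (_, _); exact: sing_ext. Qed.

(** Up to [seqv], the loops of this kind at a p-simplex form a copy of pi_(p+1)(X), abelian for p >
    0. *)
Definition spath n := is_path (X := X) (std_simplex n) (bdy n).
Definition seqv n := path_eqv (X := X) (std_simplex n) (bdy n).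
Arguments spath : clear implicits.
Arguments seqv : clear implicits.

(* Only vertices are constrained: simplices of positive dimension may move freely. *)
Definition allowed p (c : 'I_p.+1 -> Col) (g : 'rV[RR]_p.+1 * RR -> X) : Prop :=
  p = 0%N -> exists2 e, seqv p g e &
    (forall x t, std_simplex p x -> unit_interval t -> e (x, t) = e (x, 0)) \/
    (forall x t, std_simplex p x -> unit_interval t -> U (c ord0) (e (x, t))).

Lemma allowed_eqv p c g g' : seqv p g g' -> allowed c g -> allowed c g'.
Proof.
move=> gg' h /h [e ge he]; exists e => //.
exact: path_eqv_trans (path_eqv_sym gg') ge.
Qed.

Lemma allowed_cst p c (f : 'rV[RR]_p.+1 -> X) : cton (std_simplex p) f ->
  allowed c (pcst f).
Proof.
move=> cf _; exists (pcst f); last by left.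
by apply: path_eqv_refl; exact: pcst_path.
Qed.

Lemma allowed_inv p c g : allowed (p := p) c g -> allowed c (pathinv g).
Proof.
move=> h /h [e ge he]; exists (pathinv e); first exact: path_eqv_inv.
have I1 s : unit_interval s -> unit_interval (1 - s) by rewrite !unit_intervalE; lra.
case: he => he; [left|right] => x t sx It; rewrite /pathinv /=.
  by rewrite !he //; apply: I1 => //; exact: unit_interval0.
by apply: he => //; exact: I1.
Qed.

Lemma path_eqv_is_path n (g e : 'rV[RR]_n.+1 * RR -> X) : seqv n g e -> spath n e.
Proof.
move=> h; have ends := path_eqv_ends h; move: h => [k [ck k0 k1 ks kB]]; split.
  apply: (cton_comp (g := fun q : 'rV[RR]_n.+1 * RR => (q, 1 : RR)) ck); first by continuity.
    by move=> q [h1 h2]; split=> //; exact: unit_interval1.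
  by move=> [x t] [h1 h2]; rewrite k1.
move=> x t sx bx It; rewrite -k1 // kB //; last exact: unit_interval1.
by have [-> _] := ends x sx.
Qed.

(** Constant paths and paths inside the set are together not closed under concatenation; a constant
    factor can be removed by a homotopy, which is why [allowed] is defined up to [seqv]. *)
Lemma allowed_cat p c g g' : spath p g -> spath p g' ->
  (forall x, std_simplex p x -> g (x, 1) = g' (x, 0)) ->
  allowed (p := p) c g -> allowed c g' -> allowed c (pcat g g').
Proof.
move=> hg hg' ends h h' p0; have [e ge he] := h p0; have [e' ge' he'] := h' p0.
have hp := path_eqv_is_path ge; have hp' := path_eqv_is_path ge'.
have ends' x : std_simplex p x -> e (x, 1) = e' (x, 0).
  move=> sx; have [_ <-] := path_eqv_ends ge sx; have [<- _] := path_eqv_ends ge' sx.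
  exact: ends.
have hc := path_eqv_cat ge ge' ends.
have ext_cst f (hf : spath p f) : (forall x t, std_simplex p x -> unit_interval t -> f (x, t) = f (x, 0)) ->
    seqv p f (pcst (fun x => f (x, 0))).
  by move=> hcst; apply: path_eqv_ext => // x t sx It; rewrite /pcst /= hcst.
case: he => he.
  exists e' => //; apply: path_eqv_trans hc _.
  have h1 : seqv p (pcat e e') (pcat (pcst (fun x => e (x, 0))) e').
    by apply: path_eqv_cat => //; [exact: ext_cst|exact: path_eqv_refl].
  apply: path_eqv_trans h1 _; apply: path_eqv_cst_l => // x sx.
  by rewrite -ends' // he //; exact: unit_interval1.
case: he' => he'.
  exists e; last by right.
  apply: path_eqv_trans hc _.
  have h1 : seqv p (pcat e e') (pcat e (pcst (fun x => e' (x, 0)))).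
    by apply: path_eqv_cat => //; [exact: path_eqv_refl|exact: ext_cst].
  apply: path_eqv_trans h1 _; apply: path_eqv_cst_r => // x sx.
exists (pcat e e') => //; right=> x t sx; rewrite unit_intervalE => It.
rewrite /pcat /=; case: ifP => h1.
  by apply: he => //; rewrite unit_intervalE; lra.
have h2 : 2^-1 < t by rewrite ltNge h1.
by apply: he' => //; rewrite unit_intervalE; lra.
Qed.

Definition trace k n (th : 'I_k.+1 -> 'I_n.+1) (H : 'rV[RR]_n.+1 * RR -> X)
  (q : 'rV[RR]_k.+1 * RR) : X := H (act_map th q.1, q.2).

Lemma trace_continuous k n (th : 'I_k.+1 -> 'I_n.+1) (H : 'rV[RR]_n.+1 * RR -> X) :
  cton (cyl1 n) H -> cton (cyl1 k) (trace th H).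
Proof.
move=> cH; apply: (cton_comp (g := fun q : 'rV[RR]_k.+1 * RR => (act_map th q.1, q.2)) cH) => //.
  by continuity; apply: cts_comp; [exact: cts_act_map|continuity].
by move=> q [h1 h2]; split=> //; exact: act_map_simplex.
Qed.

Lemma trace_path p n (th : 'I_p.+1 -> 'I_n.+1) H :
  is_path (std_simplex n) (skel p n) H -> spath p (trace th H).
Proof.
move=> [cH BH]; split; first exact: trace_continuous.
move=> x t sx bx It; apply: BH => //; first exact: act_map_simplex.
by apply: leq_trans (nzc_act _ _) _; exact: bdy_skel.
Qed.

Lemma trace_skel p k n (th : 'I_k.+1 -> 'I_n.+1) H :
  is_path (std_simplex n) (skel p n) H -> is_path (X := X) (std_simplex k) (skel p k) (trace th H).
Proof.
move=> [cH BH]; split; first exact: trace_continuous.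
move=> x t sx bx It; apply: BH => //; first exact: act_map_simplex.
exact: leq_trans (nzc_act _ _) bx.
Qed.

(** The relation R_p. Colours have to agree, because the simplex alone does not determine where its
    vertices may move. *)
Definition hrel p n (t t' : csing n) : Prop := t.2 = t'.2 /\
  exists H, [/\ is_path (std_simplex n) (skel p n) H,
    forall x, std_simplex n x -> H (x, 0) = sval t.1 x,
    forall x, std_simplex n x -> H (x, 1) = sval t'.1 x &
    forall th : 'I_p.+1 -> 'I_n.+1, injective th -> allowed (t.2 \o th) (trace th H)].

Lemma hrel_refl p n (t : csing n) : hrel p t t.
Proof.
split=> //; exists (pcst (sval t.1)); split=> //.
  by apply: pcst_path; exact: sing_cton.
move=> th _; apply: (@allowed_cst _ _ (fun x => sval t.1 (act_map th x))).
apply: (cton_comp (g := act_map th) (sing_cton t.1)) => //; first exact: cts_act_map.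
by move=> x; exact: act_map_simplex.
Qed.

Lemma hrel_sym p n (t t' : csing n) : hrel p t t' -> hrel p t' t.
Proof.
move=> [e [H [hH H0 H1 Ha]]]; split=> //; exists (pathinv H); split.
- exact: pathinv_path.
- by move=> x sx; rewrite pathinv0 H1.
- by move=> x sx; rewrite pathinv1 H0.
- by move=> th thI; rewrite -e; exact: allowed_inv (Ha th thI).
Qed.

Lemma hrel_trans p n (t t' t'' : csing n) : hrel p t t' -> hrel p t' t'' -> hrel p t t''.
Proof.
move=> [e [H [hH H0 H1 Ha]]] [e' [H' [hH' H0' H1' Ha']]].
have ends x : std_simplex n x -> H (x, 1) = H' (x, 0) by move=> sx; rewrite H1 // H0'.
split; first by rewrite e.
exists (pcat H H'); split.
- exact: pcat_path.
- by move=> x sx; rewrite pcat0 H0.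
- by move=> x sx; rewrite pcat1 H1'.
- move=> th thI; apply: (@allowed_cat _ _ (trace th H) (trace th H')).
  + exact: trace_path.
  + exact: trace_path.
  + by move=> x sx; apply: ends; exact: act_map_simplex.
  + exact: Ha.
  + by rewrite e; exact: Ha'.
Qed.

Lemma hrel_top n (t t' : csing n) : hrel n.+1 t t' -> t = t'.
Proof.
move=> [e [H [hH H0 H1 _]]]; apply: csing_ext => // x sx.
rewrite -H0 // -H1 //; apply/esym; apply: hH.2 => //; [exact: skel_all|exact: unit_interval1].
Qed.

(** * Pushing a simplex along motions of its p-faces *)

Section Push.
Variable p : nat.

Definition ppath := 'rV[RR]_p.+1 * RR -> X.

Definition valid n (t : csing n) (b : ('I_p.+1 -> 'I_n.+1) -> ppath) : Prop :=
  forall th, injective th ->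
    [/\ spath p (b th), forall x, std_simplex p x -> b th (x, 0) = sval t.1 (act_map th x)
      & allowed (t.2 \o th) (b th)].

(** No compatibility between the motions is imposed: distinct p-faces meet in their boundaries,
    where motions are stationary. *)
Definition mtn n :=
  {tb : csing n * (('I_p.+1 -> 'I_n.+1) -> ppath) | valid tb.1 tb.2}.

Lemma valid_act k n (th : 'I_k.+1 -> 'I_n.+1) t b : injective th -> valid t b ->
  valid (actT th t) (fun et => b (th \o et)).
Proof.
move=> thI h et etI; have [h1 h2 h3] := h (th \o et) (inj_comp thI etI); split=> // x sx.
by rewrite h2 //= actE ?act_map_comp //; exact: act_map_simplex.
Qed.

Definition dM n (i : 'I_n.+2) (m : mtn n.+1) : mtn n :=
  exist (fun tb => valid tb.1 tb.2) (dT i (sval m).1, fun et => (sval m).2 (lift i \o et))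
    (valid_act (@lift_inj _ i) (svalP m)).

Lemma dM_dM n (t : mtn n.+2) (i j : 'I_n.+3) (k l : 'I_n.+2) :
  (forall m, lift i (lift k m) = lift j (lift l m)) -> dM k (dM i t) = dM l (dM j t).
Proof.
move=> e; apply: eq_exist => /=; congr (_, _); first exact: dT_dT.
apply/funext => et; congr ((sval t).2 _); apply/funext => a /=; exact: e.
Qed.

Definition mbot n (m : mtn n) (q : 'rV[RR]_n.+1 * RR) : X := sval (sval m).1.1 q.1.

(** [ext] takes a family over all dimensions, of which dimension [p] counts; [inord], the identity
    there, replaces a transport along [n = p]. *)
Definition mpre n (m : mtn n) (q : 'rV[RR]_n.+1 * RR * RR) : X :=
  (sval m).2 (fun i => inord i) (act_map (fun i : 'I_n.+1 => inord i : 'I_p.+1) q.1.1, q.2).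

Lemma inordE : (fun i : 'I_p.+1 => inord i) = id :> ('I_p.+1 -> 'I_p.+1).
Proof. by apply/funext => i; rewrite inord_val. Qed.

Lemma mpreE (m : mtn p) x y s : mpre m (x, y, s) = (sval m).2 id (x, s).
Proof. by rewrite /mpre /= inordE act_map_id. Qed.

Lemma mbot_cton n (m : mtn n) : cton (cyl1 n) (mbot m).
Proof.
apply: (cton_comp (g := fst) (sing_cton (sval m).1.1)) => //; first by continuity.
by move=> q [].
Qed.

Lemma mbot_face n (m : mtn n.+1) i x y : std_simplex n x -> unit_interval y ->
  mbot (dM i m) (x, y) = mbot m (face_incl i x, y).
Proof. by move=> sx _; rewrite /mbot /= -/(dS i _) dSE. Qed.

Lemma mpre_cton n (m : mtn n) : n = p -> cton (cyl2 n) (mpre m).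
Proof.
move=> np; case: _ / (esym np) m => m.
have [[cb _] _ _] := svalP m id (@inj_id _).
apply: (cton_comp (g := fun q : 'rV[RR]_p.+1 * RR * RR => (q.1.1, q.2)) cb).
- by continuity.
- by move=> q [[h1 h2] h3].
- by move=> [[x y] s] _; rewrite mpreE.
Qed.

Lemma mpre_bot n (m : mtn n) x y : n = p -> std_simplex n x -> unit_interval y ->
  mpre m (x, y, 0) = mbot m (x, y).
Proof.
move=> np; case: _ / (esym np) m x => m x sx _.
by have [_ h _] := svalP m id (@inj_id _); rewrite mpreE h // act_map_id.
Qed.

Lemma mpre_side n (m : mtn n) i x y s : n = p -> std_simplex n x ->
  unit_interval y -> unit_interval s -> x ord0 i = 0 -> mpre m (x, y, s) = mbot m (x, y).
Proof.
move=> np; case: _ / (esym np) m i x => m i x sx _ Is xi.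
have [[_ hB] h _] := svalP m id (@inj_id _); rewrite mpreE hB ?h ?act_map_id //.
by exists i.
Qed.

(** The extra parameter of [ext] is held at 0, the bottom map being independent of it. *)
Definition hom n (m : mtn n) (q : 'rV[RR]_n.+1 * RR) : X :=
  ext dM mbot p mpre m (q.1, 0, q.2).

Lemma hom_cton n (m : mtn n) : cton (cyl1 n) (hom m).
Proof.
have := ext_continuous dM_dM mbot_cton mbot_face mpre_cton mpre_bot mpre_side m => h.
apply: (cton_comp (g := fun q : 'rV[RR]_n.+1 * RR => (q.1, 0 : RR, q.2)) h) => //.
  by continuity.
by move=> q [h1 h2]; split=> //; split=> //; exact: unit_interval0.
Qed.

Lemma hom0 n (m : mtn n) x : std_simplex n x -> hom m (x, 0) = sval (sval m).1.1 x.
Proof.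
move=> sx; exact: (ext_bottom dM_dM mbot_cton mbot_face mpre_cton mpre_bot mpre_side m
  sx unit_interval0).
Qed.

Lemma hom_face n (m : mtn n.+1) i x s : std_simplex n x -> unit_interval s ->
  hom (dM i m) (x, s) = hom m (face_incl i x, s).
Proof.
move=> sx Is; exact: (ext_face dM_dM mbot_cton mbot_face mpre_cton mpre_bot mpre_side m i
  sx unit_interval0 Is).
Qed.

Lemma hom_path n (m : mtn n) : is_path (std_simplex n) (skel p n) (hom m).
Proof.
split; first exact: hom_cton.
move=> x s sx xp Is; rewrite hom0 //.
exact: (ext_skeleton dM_dM mbot_cton mbot_face mpre_cton mpre_bot mpre_side m
  sx xp unit_interval0 Is).
Qed.

Lemma hom_pre (m : mtn p) q : hom m q = (sval m).2 id q.
Proof. by rewrite /hom ext_eq // mpreE; case: q. Qed.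

Definition hend n (m : mtn n) : csing n :=
  (to_sing (fun x => hom m (x, 1)), (sval m).1.2).

Lemma hendE n (m : mtn n) x : std_simplex n x -> sval (hend m).1 x = hom m (x, 1).
Proof.
move=> sx; rewrite to_singE //.
apply: (cton_comp (g := fun x : 'rV[RR]_n.+1 => (x, 1 : RR)) (hom_cton m)) => //.
  by continuity.
by move=> y sy; split=> //; exact: unit_interval1.
Qed.

Lemma hend_face n (m : mtn n.+1) i : hend (dM i m) = dT i (hend m).
Proof.
apply: csing_ext => // x sx; rewrite hendE // -/(dS i _) dSE // hendE.
  by rewrite hom_face //; exact: unit_interval1.
exact: face_incl_simplex.
Qed.

End Push.

(** In positive dimension some facet contains the vertex, and [hom] is compatible with facets. *)
Lemma hom_vertex n (m : mtn 0 n) (th : 'I_1 -> 'I_n.+1) x s :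
  std_simplex 0 x -> unit_interval s -> hom m (act_map th x, s) = (sval m).2 th (x, s).
Proof.
elim: n m th => [|n IH] m th sx Is.
  have -> : th = id by apply/funext => a; rewrite ord1 [RHS]ord1.
  by rewrite hom_pre act_map_id.
have [i hi] : exists i, th ord0 != i.
  have [e|e] := eqVneq (th ord0) ord0; [exists ord_max|by exists ord0].
  by rewrite e.
pose th' (a : 'I_1) := odflt ord0 (unlift i (th a)).
have thE : th = lift i \o th'.
  apply/funext => a /=; rewrite /th' (ord1 a); case: unliftP => [j ->//|e].
  by move: hi; rewrite -e eqxx.
rewrite thE -act_map_comp -face_inclE -hom_face //; first by rewrite IH.
exact: act_map_simplex.
Qed.

Lemma hend_hrel0 p n (m : mtn p n) : hrel 0 (sval m).1 (hend m).
Proof.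
split=> //; exists (hom m); split.
- split; first exact: hom_cton.
  by move=> x t sx; rewrite /skel /= leqn0 => /eqP x0; have := nzc_gt0 sx; rewrite x0.
- by move=> x sx; rewrite hom0.
- by move=> x sx; rewrite hendE.
move=> th thI; case: p m => [|p] m.
  have [h1 h2 h3] := svalP m th thI; apply: allowed_eqv h3.
  by apply: path_eqv_ext => // x t sx It; rewrite /trace /= hom_vertex.
have cs : cton (std_simplex 0) (fun x => sval (sval m).1.1 (act_map th x)).
  apply: (cton_comp (g := act_map th) (sing_cton (sval m).1.1)) => //.
    exact: cts_act_map.
  by move=> x; exact: act_map_simplex.
apply: allowed_eqv (allowed_cst _ cs); apply: path_eqv_ext; first exact: pcst_path.
move=> x t sx It; rewrite /trace /pcst /= -hom0; last exact: act_map_simplex.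
apply/esym; apply: (hom_path m).2 => //; first exact: act_map_simplex.
rewrite /skel /=; apply: leq_trans (nzc_act _ _) _; apply: (@leq_trans 1) => //.
exact: skel_all.
Qed.
End Simplices.

Arguments spath {X} n _.
Arguments seqv {X} n _ _.

Lemma pcat_eq (S S' X : topologicalType) (c e : S * RR -> X) (c' e' : S' * RR -> X) x x' t :
  (forall t, unit_interval t -> c (x, t) = c' (x', t)) ->
  (forall t, unit_interval t -> e (x, t) = e' (x', t)) ->
  unit_interval t -> pcat c e (x, t) = pcat c' e' (x', t).
Proof.
move=> hc he; rewrite unit_intervalE => It; rewrite /pcat /=; case: ifP => h.
  by apply: hc; rewrite unit_intervalE; lra.
have h' : 2^-1 < t by rewrite ltNge h.
by apply: he; rewrite unit_intervalE; lra.
Qed.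

Lemma pathinv_eq (S S' X : topologicalType) (c : S * RR -> X) (c' : S' * RR -> X) x x' t :
  (forall t, unit_interval t -> c (x, t) = c' (x', t)) ->
  unit_interval t -> pathinv c (x, t) = pathinv c' (x', t).
Proof.
move=> hc It; rewrite /pathinv /=; apply: hc; move: It; rewrite !unit_intervalE; lra.
Qed.

Lemma is_path_sub (S X : topologicalType) (A B B' : set S) (c : S * RR -> X) :
  (forall x, B' x -> B x) -> is_path A B c -> is_path A B' c.
Proof. by move=> BB [cc hB]; split=> // x t Ax /BB; exact: hB. Qed.

(** * Ends of homotopic motions *)

Section EndRelation.
Variables (X : topologicalType) (Col : Type) (U : Col -> set X) (p : nat).
Local Notation M := (mtn U p).

(** On each p-face the triangle formed by the connecting homotopy and the two motions commutes up to
    homotopy. *)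
Definition linked n (x : M n * M n * ('rV[RR]_n.+1 * RR -> X)) : Prop :=
  [/\ is_path (std_simplex n) (skel p n) x.2,
    forall y, std_simplex n y -> x.2 (y, 0) = sval (sval x.1.1).1.1 y,
    forall y, std_simplex n y -> x.2 (y, 1) = sval (sval x.1.2).1.1 y &
    forall th, injective th ->
      seqv p (pcat (trace th x.2) ((sval x.1.2).2 th)) ((sval x.1.1).2 th)].

(** Linked pairs again form a semisimplicial set, so that homotopies of [loopback] can be extended
    naturally. *)
Definition lnk n := {x : M n * M n * ('rV[RR]_n.+1 * RR -> X) | linked x}.

Lemma linked_face n (i : 'I_n.+2) (x : M n.+1 * M n.+1 * ('rV[RR]_n.+2 * RR -> X)) :
  linked x -> linked (dM i x.1.1, dM i x.1.2, trace (lift i) x.2).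
Proof.
move=> [h1 h2 h3 h4]; split=> /=.
- exact: trace_skel.
- by move=> y sy; rewrite actE // -h2 //; exact: act_map_simplex.
- by move=> y sy; rewrite actE // -h3 //; exact: act_map_simplex.
- move=> th thI; have := h4 _ (inj_comp (@lift_inj _ i) thI).
  congr (seqv _ (pcat _ _) _); apply/funext => q.
  by rewrite /trace /= act_map_comp.
Qed.

Definition dL n (i : 'I_n.+2) (x : lnk n.+1) : lnk n := exist _ _ (linked_face i (svalP x)).

Lemma dL_dL n (t : lnk n.+2) (i j : 'I_n.+3) (k l : 'I_n.+2) :
  (forall m, lift i (lift k m) = lift j (lift l m)) -> dL k (dL i t) = dL l (dL j t).
Proof.
move=> e; apply: eq_exist => /=; congr (_, _, _); [exact: dM_dM|exact: dM_dM|].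
apply/funext => q; rewrite /trace /= !act_map_comp.
by have -> : lift i \o lift k = lift j \o lift l by apply/funext => m /=; exact: e.
Qed.

Definition loopback n (x : lnk n) : 'rV[RR]_n.+1 * RR -> X :=
  pcat (pcat (pathinv (hom (sval x).1.1)) (sval x).2) (hom (sval x).1.2).

Lemma loopback_path n (x : lnk n) : is_path (std_simplex n) (skel p n) (loopback x).
Proof.
have [h1 h2 h3 h4] := svalP x.
apply: pcat_path; [apply: pcat_path => //| |].
- by apply: pathinv_path; exact: hom_path.
- by move=> y sy; rewrite pathinv1 h2 // hom0.
- exact: hom_path.
- by move=> y sy; rewrite pcat1 h3 // hom0.
Qed.

Lemma loopback0 n (x : lnk n) y : loopback x (y, 0) = hom (sval x).1.1 (y, 1).
Proof. by rewrite /loopback !pcat0 pathinv0. Qed.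

Lemma loopback1 n (x : lnk n) y : loopback x (y, 1) = hom (sval x).1.2 (y, 1).
Proof. by rewrite /loopback pcat1. Qed.

Lemma loopback_face n (x : lnk n.+1) i y t : std_simplex n y -> unit_interval t ->
  loopback (dL i x) (y, t) = loopback x (face_incl i y, t).
Proof.
move=> sy It; apply: pcat_eq => // {t It} t It; last by rewrite hom_face.
apply: pcat_eq => // {t It} t It; last by rewrite /trace /= face_inclE.
by apply: pathinv_eq => // {t It} t It; rewrite hom_face.
Qed.

Lemma loopback_trivial n (x : lnk n) : n = p ->
  path_eqv (std_simplex n) (bdy n) (loopback x) (pcst (fun y => hom (sval x).1.1 (y, 1))).
Proof.
move=> np; case: _ / (esym np) x => x.
have [h1 h2 h3 h4] := svalP x.
have cp : spath p (sval x).2 by apply: is_path_sub h1; exact: bdy_skel.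
have hp m : spath p (hom (m : M p)) by apply: is_path_sub (hom_path m); exact: bdy_skel.
have e1 : forall y, std_simplex p y -> pathinv (hom (sval x).1.1) (y, 1) = (sval x).2 (y, 0).
  by move=> y sy; rewrite pathinv1 h2 // hom0.
have e2 : forall y, std_simplex p y -> (sval x).2 (y, 1) = hom (sval x).1.2 (y, 0).
  by move=> y sy; rewrite h3 // hom0.
have hi := pathinv_path (hp (sval x).1.1).
apply: path_eqv_trans (path_eqv_assoc hi cp (hp _) e1 e2) _.
have hh : seqv p (pcat (sval x).2 (hom (sval x).1.2)) (hom (sval x).1.1).
  have := h4 id (@inj_id _); congr (seqv _ (pcat _ _) _); apply/funext => q.
  - by rewrite /trace act_map_id -surjective_pairing.
  - by rewrite hom_pre.
  - by rewrite hom_pre.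
apply: path_eqv_trans (path_eqv_cat (path_eqv_refl hi) hh _) _.
  by move=> y sy; rewrite pcat0 e1.
by apply: path_eqv_inv_l; first exact: hp.
Qed.

(** Going back along the first motion, across by [c] and out along the second is null-homotopic on
    every p-face. Homotopy extension replaces this path by one with the same ends that is fixed on
    the p-skeleton. *)
Lemma hend_hrel n (m m' : M n) c : (sval m).1.2 = (sval m').1.2 -> linked (m, m', c) ->
  hrel U p.+1 (hend m) (hend m').
Proof.
move=> ecol hl.
(* The null-homotopy is chosen in dimension [p], with a dummy elsewhere, since [ext] takes a total
   family. *)
have exk n' (x : lnk n') : exists k : 'rV[RR]_n'.+1 * RR * RR -> X, n' = p ->
    let: c := loopback x in let: e := pcst (fun y => hom (sval x).1.1 (y, 1)) in
    [/\ cton (cyl2 n') k,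
    forall x t, std_simplex n' x -> unit_interval t -> k (x, t, 0) = c (x, t),
    forall x t, std_simplex n' x -> unit_interval t -> k (x, t, 1) = e (x, t),
    forall x s, std_simplex n' x -> unit_interval s -> k (x, 0, s) = c (x, 0) /\ k (x, 1, s) = c (x, 1) &
    forall x t s, std_simplex n' x -> bdy n' x -> unit_interval t -> unit_interval s -> k (x, t, s) = c (x, 0)].
  have [np|np] := pselect (n' = p); last by exists (fun q => loopback x q.1).
  by have [k hk] := loopback_trivial x np; exists k.
pose g n' (x : lnk n') := projT1 (cid (exk n' x)).
have gP n' (x : lnk n') := projT2 (cid (exk n' x)).
have cb n' (x : lnk n') : cton (cyl1 n') (loopback x) by have [] := loopback_path x.
have cg n' (x : lnk n') : n' = p -> cton (cyl2 n') (g n' x) by move=> /(gP n' x) [].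
have g0 n' (x : lnk n') y t : n' = p -> std_simplex n' y -> unit_interval t ->
    g n' x (y, t, 0) = loopback x (y, t) by move=> /(gP n' x) [_ h _ _ _]; exact: h.
have gs n' (x : lnk n') i y t s : n' = p -> std_simplex n' y -> unit_interval t ->
    unit_interval s -> y ord0 i = 0 -> g n' x (y, t, s) = loopback x (y, t).
  move=> np sy It Is yi; have [_ _ _ _ h] := gP _ x np.
  rewrite /g h //; last by exists i.
  apply/esym; apply: (loopback_path x).2 => //; rewrite -np.
  by apply: bdy_skel; exists i.
pose W := ext dL loopback p g.
have W0 n' (x : lnk n') y t : std_simplex n' y -> unit_interval t ->
    W n' x (y, t, 0) = loopback x (y, t).
  exact: (ext_bottom dL_dL cb loopback_face cg g0 gs).
have cW n' (x : lnk n') : cton (cyl2 n') (W n' x).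
  exact: (ext_continuous dL_dL cb loopback_face cg g0 gs).
have Wf n' (x : lnk n'.+1) i y t s : std_simplex n' y -> unit_interval t -> unit_interval s ->
    W n' (dL i x) (y, t, s) = W n'.+1 x (face_incl i y, t, s).
  exact: (ext_face dL_dL cb loopback_face cg g0 gs).
(* On faces of dimension at most [p], three sides of the parameter square are constant: in dimension
   [p] by the null-homotopy, below because nothing moves. *)
have Wsk n' (x : lnk n') y : std_simplex n' y -> (nzc y <= p.+1)%N ->
    forall t s, unit_interval t -> unit_interval s ->
    [/\ W n' x (y, 0, s) = hom (sval x).1.1 (y, 1), W n' x (y, 1, s) = hom (sval x).1.1 (y, 1)
      & W n' x (y, t, 1) = hom (sval x).1.1 (y, 1)].
  apply: (skeleton_ind (d := dL) (P := fun n' x y => forall t s, unit_interval t -> unit_interval s ->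
    [/\ W n' x (y, 0, s) = hom (sval x).1.1 (y, 1), W n' x (y, 1, s) = hom (sval x).1.1 (y, 1)
      & W n' x (y, t, 1) = hom (sval x).1.1 (y, 1)])) => {n' x y}.
    move=> n' x y; rewrite ltnS leq_eqVlt => /orP[/eqP np|np] sy t s It Is.
      have [_ h0 h1 hs _] := gP _ x np; have [hs0 hs1] := hs y s sy Is.
      have [_ hs1'] := hs y 1 sy unit_interval1.
      rewrite /W ext_eq // /g hs0 hs1 h1 // loopback0; split=> //.
      by rewrite -hs1' h1 //; exact: unit_interval1.
    have lb t' : unit_interval t' -> loopback x (y, t') = hom (sval x).1.1 (y, 1).
      move=> It'; rewrite -loopback0; apply: (loopback_path x).2 => //.
      exact: leq_trans (skel_all _) np.
    rewrite /W !ext_lt //=; split; apply: lb => //; [exact: unit_interval0|exact: unit_interval1].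
  move=> n' x i y sy h t s It Is; have [h1 h2 h3] := h t s It Is.
  rewrite -!Wf //; try exact: unit_interval0; try exact: unit_interval1.
  by rewrite -hom_face //; exact: unit_interval1.
pose x : lnk n := exist _ _ hl.
(* Those three sides, followed in turn, join the ends of [loopback], which is the fourth side. *)
pose Q1 (q : 'rV[RR]_n.+1 * RR) := W n x (q.1, 0, q.2).
pose Q2 (q : 'rV[RR]_n.+1 * RR) := W n x (q.1, q.2, 1).
pose Q3 (q : 'rV[RR]_n.+1 * RR) := W n x (q.1, 1, q.2).
have hQ1 : is_path (std_simplex n) (skel p.+1 n) Q1.
  split.
    apply: (cton_comp (g := fun q : 'rV[RR]_n.+1 * RR => (q.1, 0 : RR, q.2)) (cW n x)) => //.
      by continuity.
    by move=> q [a1 a2]; split=> //; split=> //; exact: unit_interval0.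
  move=> y t sy yp It; rewrite /Q1 /=; have [-> _ _] := Wsk n x y sy yp t t It It.
  by have [-> _ _] := Wsk n x y sy yp 0 0 unit_interval0 unit_interval0.
have hQ2 : is_path (std_simplex n) (skel p.+1 n) Q2.
  split.
    apply: (cton_comp (g := fun q : 'rV[RR]_n.+1 * RR => (q.1, q.2, 1 : RR)) (cW n x)) => //.
      by continuity.
    by move=> q [a1 a2]; split=> //; exact: unit_interval1.
  move=> y t sy yp It; rewrite /Q2 /=; have [_ _ ->] := Wsk n x y sy yp t t It It.
  by have [_ _ ->] := Wsk n x y sy yp 0 0 unit_interval0 unit_interval0.
have hQ3 : is_path (std_simplex n) (skel p.+1 n) Q3.
  split.
    apply: (cton_comp (g := fun q : 'rV[RR]_n.+1 * RR => (q.1, 1 : RR, q.2)) (cW n x)) => //.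
      by continuity.
    by move=> q [a1 a2]; split=> //; split=> //; exact: unit_interval1.
  move=> y t sy yp It; rewrite /Q3 /=; have [_ -> _] := Wsk n x y sy yp t t It It.
  by have [_ -> _] := Wsk n x y sy yp 0 0 unit_interval0 unit_interval0.
split=> //; exists (pcat (pcat Q1 Q2) (pathinv Q3)); split.
- apply: pcat_path; [exact: pcat_path|exact: pathinv_path|].
  by move=> y sy; rewrite pcat1 pathinv0.
- by move=> y sy; rewrite !pcat0 /Q1 /= W0 //; [rewrite loopback0 hendE|exact: unit_interval0].
- move=> y sy; rewrite pcat1 pathinv1 /Q3 /= W0 //; [|exact: unit_interval1].
  by rewrite loopback1 hendE.
- by move=> th thI.
Qed.
End EndRelation.

(** * Almost invariant probabilities on groupoids *)

Definition is_prob (T : Type) (D : fchain T) : Prop :=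
  all (fun x => 0 <= x.1) D /\ pairing (fun _ => 1) D = 1.

Lemma mass_prob (T : Type) (D : fchain T) : is_prob D -> mass D = 1.
Proof.
move=> [D0 <-]; rewrite /mass /pairing; elim: D D0 => [|x D IH] /=; first by rewrite !big_nil.
by case/andP => x0 /IH e; rewrite !big_cons e mulr1 ger0_norm.
Qed.

Lemma is_prob1 (T : Type) (x : T) : is_prob [:: (1, x)].
Proof. by split; rewrite /= ?ler01 // pairing_cons pairing_nil mul1r addr0. Qed.

Lemma is_prob_map (T T' : Type) (h : T -> T') (D : fchain T) :
  is_prob D -> is_prob (map_chain h D).
Proof.
move=> [D0 D1]; split; last by rewrite pairing_map.
by rewrite /map_chain all_map.
Qed.

Section Groupoid.
Variables (O P : Type) (arr : O -> O -> P -> Prop) (eqv : P -> P -> Prop).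
Variables (cat : P -> P -> P) (inv : P -> P) (one : O -> P).
Hypothesis arr_cat : forall o o' o'' c e, arr o o' c -> arr o' o'' e -> arr o o'' (cat c e).
Hypothesis arr_inv : forall o o' c, arr o o' c -> arr o' o (inv c).
Hypothesis arr_one : forall o, arr o o (one o).
Hypothesis eqv_refl : forall o o' c, arr o o' c -> eqv c c.
Hypothesis eqv_sym : forall c e, eqv c e -> eqv e c.
Hypothesis eqv_trans : forall c e b, eqv c e -> eqv e b -> eqv c b.
Hypothesis eqv_cat : forall o o' o'' c c' e e', arr o o' c -> arr o' o'' e ->
  eqv c c' -> eqv e e' -> eqv (cat c e) (cat c' e').
Hypothesis cat_assoc : forall o o' o'' o''' c e b,
  arr o o' c -> arr o' o'' e -> arr o'' o''' b -> eqv (cat (cat c e) b) (cat c (cat e b)).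
Hypothesis cat_one_l : forall o o' c, arr o o' c -> eqv (cat (one o) c) c.
Hypothesis cat_inv_r : forall o o' c, arr o o' c -> eqv (cat c (inv c)) (one o).

Definition test (L : P -> Prop) (f : P -> RR) : Prop :=
  (forall c, L c -> `|f c| <= 1) /\ (forall c e, L c -> L e -> eqv c e -> f c = f e).

(** Reiter's condition for the vertex group at [o]. Testing against bounded invariant functions
    takes the place of the l^1-norm on classes. *)
Definition reiter (o : O) : Prop :=
  forall r (h : 'I_r -> P) (eps : RR), (forall k, arr o o (h k)) -> 0 < eps ->
  exists D : fchain P, [/\ is_prob D, supported (arr o o) D &
    forall k f, test (arr o o) f ->
      `|pairing (fun g => f (cat (h k) g)) D - pairing f D| <= eps].

Section Abelian.
Variable o : O.
Hypothesis comm : forall c e, arr o o c -> arr o o e -> eqv (cat c e) (cat e c).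

Fixpoint lpow (h : P) (j : nat) : P := if j is j'.+1 then cat h (lpow h j') else one o.

Lemma arr_lpow h j : arr o o h -> arr o o (lpow h j).
Proof. by move=> hh; elim: j => //= j IH; exact: arr_cat hh IH. Qed.

(** Induction on the number of translations. The law for the others is averaged over powers of the
    new element: translating by that element telescopes, and commutativity preserves the almost
    invariance already obtained. *)
Lemma reiter_abelian : reiter o.
Proof.
elim=> [|r IH] h eps hh e0.
  exists [:: (1, one o)]; split=> [||[]//]; first exact: is_prob1.
  by split.
have [D [Dp Ds Dh]] := IH (h \o lift ord0) eps (fun k => hh _) e0.
set h0 := h ord0.
(* Telescoping leaves two terms, hence an error of at most [2 / K.+1]. *)
have [K hK] : exists K : nat, 2 / eps < K.+1%:R.
  exists (Num.truncn (2 / eps)); exact: truncnS_gt.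
have K0 : (0 : RR) < K.+1%:R by rewrite ltr0n.
pose D' : fchain P := flatten [seq scale_chain (K.+1%:R^-1) (map_chain (cat (lpow h0 j)) D) | j <- iota 0 K.+1].
have pD' f : pairing f D' = K.+1%:R^-1 * \sum_(0 <= j < K.+1) pairing (fun g => f (cat (lpow h0 j) g)) D.
  rewrite /D' /index_iota subn0; elim: (iota 0 K.+1) => [|j s IHs] /=.
    by rewrite pairing_nil big_nil mulr0.
  by rewrite pairing_cat pairing_scale IHs big_cons mulrDr pairing_map.
have allD' : all (fun x => 0 <= x.1) D'.
  rewrite /D'; elim: (iota 0 K.+1) => [//|j s IHs] /=; rewrite all_cat IHs andbT.
  rewrite /scale_chain /map_chain -map_comp all_map.
  by apply: sub_all Dp.1 => x x0 /=; rewrite mulr_ge0 // invr_ge0 ltW.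
have supD' : supported (arr o o) D'.
  rewrite /D'; elim: (iota 0 K.+1) => [//|j s IHs] /=; apply: supported_cat => //.
  apply: supported_scale; apply/supported_map; apply: eq_supported Ds => g hg.
  by apply: arr_cat hg; apply: arr_lpow; exact: hh.
exists D'; split=> //.
  split=> //; rewrite pD'; under eq_bigr do rewrite Dp.2.
  by rewrite sumr_const_nat subn0 -[X in _ * X]mulr_natr mul1r mulVf // gt_eqF.
move=> k f [f1 fe].
have f2 c e : arr o o c -> arr o o e -> `|f c - f e| <= 2.
  move=> hc he; apply: le_trans (ler_normB _ _) _; rewrite (natrD _ 1 1).
  by apply: lerD; apply: f1.
rewrite !pD' -mulrBr normrM [`|_^-1|]ger0_norm; last by rewrite invr_ge0 ltW.
have [j ->|->] := unliftP ord0 k; last first.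
  rewrite -/h0.
  have -> : \sum_(0 <= j < K.+1) pairing (fun g => f (cat h0 (cat (lpow h0 j) g))) D =
      \sum_(0 <= j < K.+1) pairing (fun g => f (cat (lpow h0 j.+1) g)) D.
    apply: eq_bigr => j _; apply: (eq_pairing Ds) => g hg; apply: fe.
    - by do 2 (apply: arr_cat; [exact: hh || exact: arr_lpow (hh _)|]).
    - by apply: arr_cat hg; exact: arr_lpow (hh _).
    - by apply: eqv_sym; apply: cat_assoc (hh _) (arr_lpow _ (hh _)) hg.
  rewrite -sumrB telescope_sumr // -pairingB.
  have hb : `|pairing (fun g => f (cat (lpow h0 K.+1) g) - f (cat (lpow h0 0) g)) D| <= 2 * mass D.
    apply: (pairing_bound Ds) => g hg; apply: f2; apply: arr_cat hg; exact: arr_lpow (hh _).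
  rewrite (mass_prob Dp) mulr1 in hb.
  rewrite mulrC ler_pdivrMr //; apply: le_trans hb _.
  by move: hK; rewrite ltr_pdivrMr // mulrC => /ltW.
rewrite -sumrB mulrC ler_pdivrMr //.
apply: le_trans (ler_norm_sum _ _ _) _.
have -> : eps * K.+1%:R = \sum_(0 <= j < K.+1) eps by rewrite sumr_const_nat subn0 mulr_natr.
apply: ler_sum => i _.
have hi := arr_lpow i (hh ord0).
pose f' g := f (cat (lpow h0 i) g).
have tf' : test (arr o o) f'.
  split=> [c hc|c e hc he ce]; first by apply: f1; exact: arr_cat hi hc.
  apply: fe; [exact: arr_cat hi hc|exact: arr_cat hi he|].
  exact: eqv_cat hi hc (eqv_refl hi) ce.
have := Dh j f' tf'; congr (`|_ - _| <= _); apply: (eq_pairing Ds) => g hg /=.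
apply: fe.
- by apply: arr_cat hi _; exact: arr_cat (hh _) hg.
- by apply: arr_cat (hh _) _; exact: arr_cat hi hg.
have hj := hh (lift ord0 j).
apply: eqv_trans (eqv_sym (cat_assoc hi hj hg)) _.
apply: eqv_trans (eqv_cat (arr_cat hi hj) hg (comm hi hj) (eqv_refl hg)) _.
exact: cat_assoc hj hi hg.
Qed.
End Abelian.

(** Commutation may be checked after conjugation by [q]; it serves to move loops to where they have
    disjoint supports. *)
Lemma conj_commute o o1 k l q k2 l2 :
  (forall o o' c, arr o o' c -> eqv (cat c (one o')) c) ->
  arr o o k -> arr o o l -> arr o o1 q -> arr o1 o1 k2 -> arr o1 o1 l2 ->
  eqv (cat k q) (cat q k2) -> eqv (cat l q) (cat q l2) -> eqv (cat k2 l2) (cat l2 k2) ->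
  eqv (cat k l) (cat l k).
Proof.
move=> cat_one_r hk hl hq hk2 hl2 ekq elq ekl.
have right_cancel c : arr o o c -> eqv (cat (cat c q) (inv q)) c.
  move=> hc; apply: eqv_trans (cat_assoc hc hq (arr_inv hq)) _.
  apply: eqv_trans (eqv_cat hc (arr_cat hq (arr_inv hq)) (eqv_refl hc) (cat_inv_r hq)) _.
  exact: cat_one_r hc.
have move2 a b a2 b2 : arr o o a -> arr o o b -> arr o1 o1 a2 -> arr o1 o1 b2 ->
    eqv (cat a q) (cat q a2) -> eqv (cat b q) (cat q b2) ->
    eqv (cat (cat a b) q) (cat q (cat a2 b2)).
  move=> ha hb ha2 hb2 ea eb.
  apply: eqv_trans (cat_assoc ha hb hq) _.
  apply: eqv_trans (eqv_cat ha (arr_cat hb hq) (eqv_refl ha) eb) _.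
  apply: eqv_trans (eqv_sym (cat_assoc ha hq hb2)) _.
  apply: eqv_trans (eqv_cat (arr_cat ha hq) hb2 ea (eqv_refl hb2)) _.
  exact: cat_assoc hq ha2 hb2.
have h : eqv (cat (cat k l) q) (cat (cat l k) q).
  apply: eqv_trans (move2 k l k2 l2 hk hl hk2 hl2 ekq elq) _.
  apply: eqv_trans (eqv_sym (move2 l k l2 k2 hl hk hl2 hk2 elq ekq)).
  exact: eqv_cat hq (arr_cat hk2 hl2) (eqv_refl hq) ekl.
apply: eqv_trans (eqv_sym (right_cancel _ (arr_cat hk hl))) _.
apply: eqv_trans (right_cancel _ (arr_cat hl hk)).
exact: eqv_cat (arr_cat (arr_cat hk hl) hq) (arr_inv hq) h (eqv_refl (arr_inv hq)).
Qed.

Definition conn o o' := exists c, arr o o' c.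
Definition from o c := exists o', arr o o' c.

Definition orep o : O := match pselect (exists o', conn o o') with
  | left h => projT1 (cid h) | right _ => o end.

Lemma conn_refl o : conn o o. Proof. by exists (one o). Qed.

Lemma orep_conn o : conn o (orep o).
Proof.
rewrite /orep; case: pselect => [h|[]]; first exact: projT2 (cid h).
by exists o; exact: conn_refl.
Qed.

(** The choice depends on the predicate [conn o] only, and connected objects have equal
    predicates. *)
Lemma orep_eq o o' : conn o o' -> orep o = orep o'.
Proof.
move=> [c hc].
have E : conn o = conn o'.
  apply/predeqP => a; split=> [[b hb]|[b hb]].
    by exists (cat (inv c) b); exact: arr_cat (arr_inv hc) hb.
  by exists (cat c b); exact: arr_cat hc hb.
rewrite /orep E; case: pselect => // -[]; exists o'; exact: conn_refl.
Qed.

(** Each object is joined by [q] to the representative of its component, and its law is the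
    translate by [q] of an almost invariant law there. Moving along [c k] then amounts to
    translating that law by the loop [h k]. *)
Lemma amenable_groupoid : (forall o, reiter o) ->
  forall r (c : 'I_r -> P) (src tgt : 'I_r -> O) (eps : RR),
  (forall k, arr (src k) (tgt k) (c k)) -> 0 < eps ->
  exists (N : nat) (w : O -> 'I_N.+1 -> RR) (x : O -> 'I_N.+1 -> P),
  [/\ forall o i, 0 <= w o i, forall o, \sum_i w o i = 1, forall o i, from o (x o i) &
    forall k f, test (from (src k)) f ->
     `|\sum_i w (tgt k) i * f (cat (c k) (x (tgt k) i)) - \sum_i w (src k) i * f (x (src k) i)| <= eps].
Proof.
move=> R r c src tgt eps hc e0.
have [q hq] := choice orep_conn.
pose h k := cat (cat (inv (q (src k))) (c k)) (q (tgt k)).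
have rE k : orep (tgt k) = orep (src k) by apply/esym; apply: orep_eq; exists (c k).
have hh k : arr (orep (src k)) (orep (src k)) (h k).
  apply: (@arr_cat _ (tgt k)); first by apply: arr_cat (hc k); exact: arr_inv (hq _).
  by have := hq (tgt k); rewrite rE.
have exD rho : exists D : fchain P, [/\ is_prob D, supported (arr rho rho) D,
    (forall k, orep (src k) = rho -> forall f, test (arr rho rho) f ->
      `|pairing (fun g => f (cat (h k) g)) D - pairing f D| <= eps) &
    (~ (exists k, orep (src k) = rho)) -> size D = 1%N].
  have [[k0 hk0]|no] := pselect (exists k, orep (src k) = rho); last first.
    exists [:: (1, one rho)]; split=> //; first exact: is_prob1.
    by move=> k hk; case: no; exists k.
  have /choice[h' hh'] k : exists g, arr rho rho g /\ (orep (src k) = rho -> g = h k).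
    have [e|ne] := pselect (orep (src k) = rho); last by exists (one rho).
    by exists (h k); rewrite -e.
  have [D [D1 D2 D3]] := R rho r h' eps (fun k => (hh' k).1) e0.
  exists D; split=> // [k hk f tf|[]]; last by exists k0.
  by have := D3 k f tf; rewrite (hh' k).2.
have [D hD] := choice exD.
(* Finitely many components carry an arrow, and on the others the law is a point mass; so all lists
   have length at most [N.+1] and can be padded with weight 0. *)
pose N := \max_(k < r) size (D (orep (src k))).
have szN rho : (size (D rho) <= N.+1)%N.
  have [_ _ _ hs] := hD rho.
  have [[k <-]|no] := pselect (exists k, orep (src k) = rho); last by rewrite (hs no).
  by apply: leqW; exact: (@leq_bigmax _ (fun k => size (D (orep (src k)))) k).
pose w o (i : 'I_N.+1) := (nth (0, one o) (D (orep o)) i).1.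
pose x o (i : 'I_N.+1) := cat (q o) (nth (0, one (orep o)) (D (orep o)) i).2.
have sumE o f : \sum_i w o i * f (x o i) = pairing (fun g => f (cat (q o) g)) (D (orep o)).
  rewrite /pairing (big_nth (0, one (orep o))) big_mkord.
  rewrite (big_ord_widen _ (fun i => (nth (0, one (orep o)) (D (orep o)) i).1 *
     f (cat (q o) (nth (0, one (orep o)) (D (orep o)) i).2)) (szN _)).
  rewrite [RHS]big_mkcond /=; apply: eq_bigr => i _; rewrite /w /x.
  case: ltnP => hi; last by rewrite !nth_default // mul0r.
  by congr (_.1 * _); apply: set_nth_default.
exists N, w, x; split.
- move=> o i; rewrite /w; have [[h0 _] _ _ _] := hD (orep o).
  have [hi|hi] := ltnP i (size (D (orep o))); last by rewrite nth_default.
  by move: h0 => /(all_nthP (0, one o)) /(_ i hi).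
- move=> o; have [[_ h1] _ _ _] := hD (orep o).
  have := sumE o (fun _ => 1); rewrite h1 => <-; apply: eq_bigr => i _; by rewrite mulr1.
- move=> o i; exists (orep o); rewrite /x; apply: arr_cat (hq o) _.
  have [_ h2 _ _] := hD (orep o).
  move: (nat_of_ord i) => j; elim: (D _) j h2 => [|a s IH] [|j] //=; [by case|].
  by move=> [_ /IH].
move=> k f [f1 fe].
rewrite (sumE (tgt k) (fun b => f (cat (c k) b))) (sumE (src k)) rE.
have [_ Ds h3 _] := hD (orep (src k)).
pose f' g := f (cat (q (src k)) g).
have tf' : test (arr (orep (src k)) (orep (src k))) f'.
  split=> [a ha|a e ha he ae].
    by apply: f1; exists (orep (src k)); exact: arr_cat (hq _) ha.
  apply: fe; [by exists (orep (src k)); exact: arr_cat (hq _) ha|by exists (orep (src k)); exact: arr_cat (hq _) he|].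
  exact: eqv_cat (hq _) ha (eqv_refl (hq _)) ae.
have := h3 k erefl f' tf'; congr (`|_ - _| <= _); apply: (eq_pairing Ds) => g hg.
have hqt : arr (tgt k) (orep (src k)) (q (tgt k)) by have := hq (tgt k); rewrite rE.
have hqs := hq (src k).
have hqi := arr_inv hqs.
have h1 := arr_cat hqi (hc k).
apply: fe; [by exists (orep (src k)); exact: arr_cat hqs (arr_cat (hh k) hg)|
  by exists (orep (src k)); exact: arr_cat (hc k) (arr_cat hqt hg)|].
apply: eqv_trans (eqv_sym (cat_assoc hqs (hh k) hg)) _.
apply: eqv_trans (cat_assoc (hc k) hqt hg).
apply: eqv_cat (arr_cat hqs (hh k)) hg _ (eqv_refl hg).
apply: eqv_trans (eqv_sym (cat_assoc hqs h1 hqt)) _.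
apply: eqv_cat (arr_cat hqs h1) hqt _ (eqv_refl hqt).
apply: eqv_trans (eqv_sym (cat_assoc hqs hqi (hc k))) _.
apply: eqv_trans (eqv_cat (arr_cat hqs hqi) (hc k) (cat_inv_r hqs) (eqv_refl (hc k))) _.
exact: cat_one_l (hc k).
Qed.
End Groupoid.

(** * Homotopy squares and the groupoid of paths of simplices *)

Section Square.
Variables (S X : topologicalType) (A B : set S).

(** Bottom then right is [t -> (a t, b t)] and left then top is [t -> (b t, a t)]; the square is
    convex, so the two routes are interpolated linearly. *)
Lemma path_eqv_square (T : S * RR * RR -> X) (k q p k1 : S * RR -> X) :
  cton ((A `*` unit_interval) `*` unit_interval) T ->
  (forall x u, A x -> unit_interval u -> T (x, u, 0) = k (x, u)) ->
  (forall x s, A x -> unit_interval s -> T (x, 1, s) = q (x, s)) ->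
  (forall x s, A x -> unit_interval s -> T (x, 0, s) = p (x, s)) ->
  (forall x u, A x -> unit_interval u -> T (x, u, 1) = k1 (x, u)) ->
  (forall x u s, A x -> B x -> unit_interval u -> unit_interval s -> T (x, u, s) = k (x, 0)) ->
  path_eqv A B (pcat k q) (pcat p k1).
Proof.
move=> cT Tk Tq Tp Tk1 TB.
pose a (t : RR) : RR := Num.min (2 * t) 1; pose b (t : RR) : RR := Num.max (2 * t - 1) 0.
have Ia t : unit_interval t -> unit_interval (a t).
  by rewrite !unit_intervalE /a => It; rewrite le_min !ge_min; lra.
have Ib t : unit_interval t -> unit_interval (b t).
  by rewrite !unit_intervalE /b => It; rewrite le_max !ge_max; lra.
have ca : cts a by rewrite /a; continuity.
have cb : cts b by rewrite /b; continuity.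
have Ic u v s : unit_interval u -> unit_interval v -> unit_interval s ->
    unit_interval ((1 - s) * u + s * v).
  by rewrite !unit_intervalE => ? ? ?; nra.
have a1 t : t <= 2^-1 -> a t = 2 * t by move=> h; rewrite /a minl //; lra.
have a2 t : 2^-1 < t -> a t = 1 by move=> h; rewrite /a minr //; lra.
have b1 t : t <= 2^-1 -> b t = 0 by move=> h; rewrite /b maxr //; lra.
have b2 t : 2^-1 < t -> b t = 2 * t - 1 by move=> h; rewrite /b maxl //; lra.
exists (fun z => T (z.1.1, (1 - z.2) * a z.1.2 + z.2 * b z.1.2,
                           (1 - z.2) * b z.1.2 + z.2 * a z.1.2)); split.
- apply: (cton_comp (g := fun z : S * RR * RR => (z.1.1, (1 - z.2) * a z.1.2 + z.2 * b z.1.2,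
                           (1 - z.2) * b z.1.2 + z.2 * a z.1.2)) cT) => //.
    by continuity; apply: cts_comp => //; continuity.
  move=> [[x t] s] [[/= Ax It] Is]; split; [split=> //=|] => /=.
  + by apply: (Ic _ _ _ _ _ Is); [exact: Ia|exact: Ib].
  + by apply: (Ic _ _ _ _ _ Is); [exact: Ib|exact: Ia].
- move=> x t Ax It /=; rewrite subr0 !mul1r !mul0r !addr0 /pcat /=; case: ifP => h.
    by rewrite a1 // b1 // Tk //; move: It; rewrite !unit_intervalE; lra.
  have h' : 2^-1 < t by rewrite ltNge h.
  by rewrite a2 // b2 // Tq //; move: It; rewrite !unit_intervalE; lra.
- move=> x t Ax It /=; rewrite subrr !mul1r !mul0r !add0r /pcat /=; case: ifP => h.
    by rewrite a1 // b1 // Tp //; move: It; rewrite !unit_intervalE; lra.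
  have h' : 2^-1 < t by rewrite ltNge h.
  by rewrite a2 // b2 // Tk1 //; move: It; rewrite !unit_intervalE; lra.
- have h0 : (0 : RR) <= 2^-1 by lra.
  have h1 : (2^-1 : RR) < 1 by lra.
  move=> x s Ax Is /=; rewrite pcat0 pcat1 a1 // b1 // a2 // b2 //.
  rewrite !mulr0 addr0 Tk //; last exact: unit_interval0.
  split=> //; rewrite -Tq //; last exact: unit_interval1.
  by congr (T (_, _, _)); lra.
- move=> x t s Ax Bx It Is /=; rewrite pcat0 TB //.
  + by apply: (Ic _ _ _ _ _ Is); [exact: Ia|exact: Ib].
  + by apply: (Ic _ _ _ _ _ Is); [exact: Ib|exact: Ia].
Qed.
End Square.

Section SimplexGroupoid.
Variables (X : topologicalType) (p : nat).
Local Notation D := (std_simplex p).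
Implicit Types (o : sing X p) (c e b : 'rV[RR]_p.+1 * RR -> X).

Definition sarr o o' c : Prop :=
  spath p c /\ forall x, D x -> c (x, 0) = sval o x /\ c (x, 1) = sval o' x.

Lemma sarr_ends o o' o'' c e x : sarr o o' c -> sarr o' o'' e -> D x -> c (x, 1) = e (x, 0).
Proof. by move=> [_ hc] [_ he] Dx; rewrite (hc x Dx).2 (he x Dx).1. Qed.

Lemma sarr_cat o o' o'' c e : sarr o o' c -> sarr o' o'' e -> sarr o o'' (pcat c e).
Proof.
move=> hc he; split.
  by apply: pcat_path; [exact: hc.1|exact: he.1|move=> x; exact: sarr_ends hc he].
by move=> x Dx; rewrite pcat0 pcat1 (hc.2 x Dx).1 (he.2 x Dx).2.
Qed.

Lemma sarr_inv o o' c : sarr o o' c -> sarr o' o (pathinv c).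
Proof.
move=> hc; split; first exact: pathinv_path hc.1.
by move=> x Dx; rewrite pathinv0 pathinv1 (hc.2 x Dx).1 (hc.2 x Dx).2.
Qed.

Lemma sarr_one o : sarr o o (pcst (sval o)).
Proof. by split=> //; apply: pcst_path; exact: sing_cton. Qed.

Lemma sarr_refl o o' c : sarr o o' c -> seqv p c c.
Proof. by move=> hc; exact: path_eqv_refl hc.1. Qed.

Lemma sarr_eqv_cat o o' o'' c c' e e' : sarr o o' c -> sarr o' o'' e ->
  seqv p c c' -> seqv p e e' -> seqv p (pcat c e) (pcat c' e').
Proof. by move=> hc he cc ee; apply: path_eqv_cat => // x; exact: sarr_ends hc he. Qed.

Lemma sarr_assoc o o' o'' o''' c e b : sarr o o' c -> sarr o' o'' e -> sarr o'' o''' b ->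
  seqv p (pcat (pcat c e) b) (pcat c (pcat e b)).
Proof.
move=> hc he hb; apply: path_eqv_assoc; [exact: hc.1|exact: he.1|exact: hb.1| |].
- by move=> x; exact: sarr_ends hc he.
- by move=> x; exact: sarr_ends he hb.
Qed.

Lemma sarr_one_l o o' c : sarr o o' c -> seqv p (pcat (pcst (sval o)) c) c.
Proof. by move=> hc; apply: path_eqv_cst_l; [exact: hc.1|move=> x Dx; rewrite (hc.2 x Dx).1]. Qed.

Lemma sarr_one_r o o' c : sarr o o' c -> seqv p (pcat c (pcst (sval o'))) c.
Proof. by move=> hc; apply: path_eqv_cst_r; [exact: hc.1|move=> x Dx; rewrite (hc.2 x Dx).2]. Qed.

Lemma sarr_inv_r o o' c : sarr o o' c -> seqv p (pcat c (pathinv c)) (pcst (sval o)).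
Proof. by move=> hc; apply: path_eqv_inv_r; [exact: hc.1|move=> x Dx; rewrite (hc.2 x Dx).1]. Qed.
End SimplexGroupoid.

(** * Commuting loops of simplices *)

Section EckmannHilton.
Variables (X : topologicalType) (p : nat).
Variable tau : 'rV[RR]_p.+1 -> X.
Hypothesis ctau : cton (std_simplex p) tau.
Local Notation D := (std_simplex p).

Definition is_loop (k : 'rV[RR]_p.+1 * RR -> X) : Prop :=
  spath p k /\ forall x, D x -> k (x, 0) = tau x /\ k (x, 1) = tau x.

Lemma mix_simplex (x y : 'rV[RR]_p.+1) (s : RR) : unit_interval s -> D x -> D y ->
  D (x + s *: (y - x)).
Proof.
rewrite unit_intervalE => Is [x0 x1] [y0 y1]; split=> [i|].
  rewrite !mxE; have := x0 i; have := y0 i; move: (x ord0 i : RR) (y ord0 i : RR) => a b; nra.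
under eq_bigr do rewrite !mxE.
by rewrite big_split /= x1 -mulr_sumr sumrB x1 y1 subrr mulr0 addr0.
Qed.

Lemma line_eqv (f g : 'rV[RR]_p.+1 * RR -> 'rV[RR]_p.+1) : cts f -> cts g ->
  (forall x t, D x -> unit_interval t -> D (f (x, t))) ->
  (forall x t, D x -> unit_interval t -> D (g (x, t))) ->
  (forall x, f (x, 0) = g (x, 0)) -> (forall x, f (x, 1) = g (x, 1)) ->
  (forall x t, D x -> bdy p x -> f (x, t) = x) -> (forall x t, D x -> bdy p x -> g (x, t) = x) ->
  seqv p (fun q => tau (f q)) (fun q => tau (g q)).
Proof.
move=> cf cg fD gD fg0 fg1 fb gb.
exists (fun z => tau (f z.1 + z.2 *: (g z.1 - f z.1))); split.
- apply: (cton_comp (g := fun z : 'rV[RR]_p.+1 * RR * RR => f z.1 + z.2 *: (g z.1 - f z.1)) ctau) => //.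
    by continuity; apply: cts_comp => //; continuity.
  by move=> [[x t] s] [[Dx It] Is]; apply: mix_simplex => //; [exact: fD|exact: gD].
- by move=> x t Dx It /=; rewrite scale0r addr0.
- by move=> x t Dx It /=; rewrite scale1r addrC subrK.
- by move=> x s Dx Is /=; rewrite fg0 fg1 !subrr !scaler0 !addr0.
- by move=> x t s Dx bx It Is /=; rewrite !fb // gb // subrr scaler0 addr0.
Qed.

Section Bubble.
(* [phi] blows the ball [ga <= r] up to the whole simplex, sending its complement to
   the boundary; [chi] agrees with [phi] on the ball. *)
Variables (phi chi : 'rV[RR]_p.+1 -> 'rV[RR]_p.+1) (ga : 'rV[RR]_p.+1 -> RR) (r : RR).
Hypotheses (cphi : cts phi) (cchi : cts chi) (cga : cts ga).
Hypothesis phiD : forall x, D x -> D (phi x).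
Hypothesis chiD : forall x, D x -> D (chi x).
Hypothesis phib : forall x, D x -> bdy p x -> phi x = x.
Hypothesis chib : forall x, D x -> bdy p x -> chi x = x.
Hypothesis ga_out : forall x, D x -> r <= ga x -> bdy p (phi x).
Hypothesis ga_in : forall x, D x -> ga x <= r -> chi x = phi x.

Definition line1 (q : 'rV[RR]_p.+1 * RR) : X := tau (q.1 + q.2 *: (phi q.1 - q.1)).
Definition line2 (q : 'rV[RR]_p.+1 * RR) : X := tau (phi q.1 + q.2 *: (chi q.1 - phi q.1)).
(** The loop [k] performed inside the ball, with base [tau \o chi] in place of [tau]. *)
Definition bubble (k : 'rV[RR]_p.+1 * RR -> X) (q : 'rV[RR]_p.+1 * RR) : X :=
  if ga q.1 <= r then k (phi q.1, q.2) else tau (chi q.1).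

Lemma cts_phi (S : topologicalType) (f : S -> 'rV[RR]_p.+1) : cts f -> cts (fun q => phi (f q)).
Proof. exact: cts_comp. Qed.

Lemma cts_chi (S : topologicalType) (f : S -> 'rV[RR]_p.+1) : cts f -> cts (fun q => chi (f q)).
Proof. exact: cts_comp. Qed.

Lemma loop_bdy k x u : is_loop k -> D x -> bdy p x -> unit_interval u -> k (x, u) = tau x.
Proof. by move=> [[_ kB] ke] Dx bx Iu; rewrite kB // (ke x Dx).1. Qed.

Lemma line1_path : spath p line1.
Proof.
split.
  apply: (cton_comp (g := fun q : 'rV[RR]_p.+1 * RR => q.1 + q.2 *: (phi q.1 - q.1)) ctau) => //.
    by continuity; apply: cts_phi; continuity.
  by move=> [x s] [Dx Is] /=; apply: mix_simplex => //; exact: phiD.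
by move=> x s Dx bx Is; rewrite /line1 /= phib // subrr !scaler0.
Qed.

Lemma line2_path : spath p line2.
Proof.
split.
  apply: (cton_comp (g := fun q : 'rV[RR]_p.+1 * RR => phi q.1 + q.2 *: (chi q.1 - phi q.1)) ctau) => //.
    by continuity; (apply: cts_phi || apply: cts_chi); continuity.
  by move=> [x s] [Dx Is] /=; apply: mix_simplex => //; [exact: phiD|exact: chiD].
by move=> x s Dx bx Is; rewrite /line2 /= phib // chib // subrr !scaler0.
Qed.

Lemma line12 x : line1 (x, 1) = line2 (x, 0).
Proof. by rewrite /line1 /line2 /= scale1r scale0r addr0 addrC subrK. Qed.

Lemma bubble_loop k : is_loop k ->
  [/\ spath p (bubble k), forall x, D x -> bubble k (x, 0) = tau (chi x) &
      forall x, D x -> bubble k (x, 1) = tau (chi x)].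
Proof.
move=> hk; have [[ck kB] ke] := hk; split.
- split.
    pose C (b : bool) : set ('rV[RR]_p.+1 * RR) := if b then [set q | ga q.1 <= r] else [set q | r <= ga q.1].
    apply: (@cton_paste _ _ _ _ C).
    + by case; [apply: closed_le_fun|apply: closed_ge_fun]; apply: cts_comp => //; continuity.
    + move=> [x t] _; have [h|/ltW h] := leP (ga x) r; [by exists true|by exists false].
    case=> /=.
      apply: (cton_comp (g := fun q : 'rV[RR]_p.+1 * RR => (phi q.1, q.2)) ck).
      * by continuity; apply: cts_phi; continuity.
      * by move=> [x t] [[Dx It] _]; split=> //; exact: phiD.
      * by move=> [x t] [_ /= h]; rewrite /bubble /= h.
    apply: (cton_comp (g := fun q : 'rV[RR]_p.+1 * RR => chi q.1) ctau).
    * by apply: cts_chi; continuity.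
    * by move=> [x t] [[Dx It] _]; exact: chiD.
    * move=> [x t] [[/= Dx It] /= h]; rewrite /bubble /=; case: ifP => // h'.
      by rewrite ga_in // loop_bdy //; [exact: phiD|exact: ga_out].
  move=> x t Dx bx It; rewrite /bubble /=; case: ifP => // h.
  by rewrite phib // !loop_bdy //; exact: unit_interval0.
- by move=> x Dx; rewrite /bubble /=; case: ifP => // h; rewrite ga_in // (ke _ (phiD Dx)).1.
- by move=> x Dx; rewrite /bubble /=; case: ifP => // h; rewrite ga_in // (ke _ (phiD Dx)).2.
Qed.

Lemma bubble_square1 k : is_loop k ->
  seqv p (pcat k line1) (pcat line1 (fun q => k (phi q.1, q.2))).
Proof.
move=> hk; have [[ck kB] ke] := hk.
pose T (z : 'rV[RR]_p.+1 * RR * RR) := k (z.1.1 + z.2 *: (phi z.1.1 - z.1.1), z.1.2).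
apply: (@path_eqv_square _ _ _ _ T); rewrite /T.
- apply: (cton_comp (g := fun z : 'rV[RR]_p.+1 * RR * RR =>
    (z.1.1 + z.2 *: (phi z.1.1 - z.1.1), z.1.2)) ck) => //.
    by continuity; apply: cts_phi; continuity.
  by move=> [[x u] s] [[Dx Iu] Is] /=; split=> //=; apply: mix_simplex => //; exact: phiD.
- by move=> x u Dx Iu /=; rewrite scale0r addr0.
- by move=> x s Dx Is /=; rewrite (ke _ (mix_simplex Is Dx (phiD Dx))).2.
- by move=> x s Dx Is /=; rewrite (ke _ (mix_simplex Is Dx (phiD Dx))).1.
- by move=> x u Dx Iu /=; rewrite scale1r addrC subrK.
- move=> x u s Dx bx Iu Is /=; rewrite phib // subrr scaler0 addr0 loop_bdy //.
  by rewrite (ke x Dx).1.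
Qed.

(** Outside the ball [phi] takes boundary values, where [k] does not move; there the loop is
    constantly [tau \o phi] and can be dragged along segments to [tau \o chi]. *)
Lemma bubble_square2 k : is_loop k ->
  seqv p (pcat (fun q => k (phi q.1, q.2)) line2) (pcat line2 (bubble k)).
Proof.
move=> hk; have [[ck kB] ke] := hk.
pose T (z : 'rV[RR]_p.+1 * RR * RR) := if ga z.1.1 <= r then k (phi z.1.1, z.1.2)
  else tau (phi z.1.1 + z.2 *: (chi z.1.1 - phi z.1.1)).
have T_side x u s : D x -> unit_interval s -> (forall y, D y -> k (y, u) = tau y) ->
    T (x, u, s) = line2 (x, s).
  move=> Dx Is ku; rewrite /T /line2 /=; case: ifP => // h.
  by rewrite (ga_in Dx h) subrr scaler0 addr0 ku //; exact: phiD.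
apply: (@path_eqv_square _ _ _ _ T).
- pose C (b : bool) : set ('rV[RR]_p.+1 * RR * RR) :=
    if b then [set q | ga q.1.1 <= r] else [set q | r <= ga q.1.1].
  apply: (@cton_paste _ _ _ _ C).
  + by case; [apply: closed_le_fun|apply: closed_ge_fun]; apply: cts_comp => //; continuity.
  + move=> [[x t] s] _; have [h|/ltW h] := leP (ga x) r; [by exists true|by exists false].
  case=> /=.
    apply: (cton_comp (g := fun q : 'rV[RR]_p.+1 * RR * RR => (phi q.1.1, q.1.2)) ck).
    * by continuity; apply: cts_phi; continuity.
    * by move=> [[x t] s] [[[Dx It] Is] _]; split=> //; exact: phiD.
    * by move=> [[x t] s] [_ /= h]; rewrite /T /= h.
  apply: (cton_comp (g := fun q : 'rV[RR]_p.+1 * RR * RR =>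
    phi q.1.1 + q.2 *: (chi q.1.1 - phi q.1.1)) ctau).
  * by continuity; (apply: cts_phi || apply: cts_chi); continuity.
  * by move=> [[x t] s] [[[Dx It] Is] _]; apply: mix_simplex => //; [exact: phiD|exact: chiD].
  * move=> [[x t] s] [[[/= Dx It] Is] /= h]; rewrite /T /=; case: ifP => // h'.
    by rewrite ga_in // subrr scaler0 addr0 loop_bdy //; [exact: phiD|exact: ga_out].
- move=> x u Dx Iu; rewrite /T /= scale0r addr0; case: ifP => // h.
  by rewrite loop_bdy //; [exact: phiD|apply: ga_out => //; apply: ltW; rewrite ltNge h].
- by move=> x s Dx Is; apply: T_side => // y Dy; rewrite (ke y Dy).2.
- by move=> x s Dx Is; apply: T_side => // y Dy; rewrite (ke y Dy).1.
- by move=> x u Dx Iu; rewrite /T /bubble /= scale1r; case: ifP => // h; rewrite addrC subrK.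
- move=> x u s Dx bx Iu Is; rewrite /T /= phib // chib // subrr scaler0 addr0.
  by rewrite (loop_bdy hk Dx bx unit_interval0); case: ifP => // _; rewrite (loop_bdy hk Dx bx Iu).
Qed.

Definition lines (q : 'rV[RR]_p.+1 * RR) : X := pcat line1 line2 q.

Definition lines_map (q : 'rV[RR]_p.+1 * RR) : 'rV[RR]_p.+1 :=
  q.1 + Num.min (2 * q.2) 1 *: (phi q.1 - q.1) + Num.max (2 * q.2 - 1) 0 *: (chi q.1 - phi q.1).

Lemma linesE x t : lines (x, t) = tau (lines_map (x, t)).
Proof.
rewrite /lines /pcat /lines_map /line1 /line2 /=; case: ifP => h.
  by rewrite minl ?maxr ?scale0r ?addr0 //; lra.
have h' : 2^-1 < t by rewrite ltNge h.
by rewrite minr ?maxl ?scale1r; [rewrite (addrC x) subrK|lra|lra].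
Qed.

Lemma lines_map_simplex x t : D x -> unit_interval t -> D (lines_map (x, t)).
Proof.
rewrite unit_intervalE => Dx It; rewrite /lines_map /=; have [h|h] := leP t 2^-1.
  rewrite minl ?maxr ?scale0r ?addr0; [|lra|lra].
  by apply: mix_simplex => //; [rewrite unit_intervalE; lra|exact: phiD].
rewrite minr ?maxl ?scale1r; [|lra|lra].
rewrite (addrC x) subrK.
by apply: mix_simplex; [rewrite unit_intervalE; lra|exact: phiD|exact: chiD].
Qed.

Lemma lines_map_bdy x t : D x -> bdy p x -> lines_map (x, t) = x.
Proof. by move=> Dx bx; rewrite /lines_map /= phib // chib // subrr !scaler0 !addr0. Qed.

Lemma cts_lines_map : cts lines_map.
Proof.
by rewrite /lines_map; continuity; (apply: cts_phi || apply: cts_chi); continuity.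
Qed.

Lemma lines_map0 x : lines_map (x, 0) = x.
Proof.
by rewrite /lines_map /= minl ?maxr ?mulr0 ?scale0r ?addr0 //; lra.
Qed.

Lemma lines_map1 x : lines_map (x, 1) = chi x.
Proof.
rewrite /lines_map /= minr ?maxl; [|lra|lra].
have -> : 2 * 1 - 1 = 1 :> RR by lra.
by rewrite !scale1r (addrC x) subrK addrC subrK.
Qed.

Lemma lines_path : spath p lines.
Proof.
by apply: pcat_path; [exact: line1_path|exact: line2_path|move=> x _; exact: line12].
Qed.

Lemma bubble_conj k : is_loop k -> seqv p (pcat k lines) (pcat lines (bubble k)).
Proof.
move=> hk; have [hk1 ke] := hk; have [hb hb0 hb1] := bubble_loop hk.
have hkp : spath p (fun q => k (phi q.1, q.2)).
  split.
    apply: (cton_comp (g := fun q : 'rV[RR]_p.+1 * RR => (phi q.1, q.2)) hk1.1) => //.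
      by continuity; apply: cts_phi; continuity.
    by move=> [x t] [Dx It]; split=> //; exact: phiD.
  by move=> x t Dx bx It /=; rewrite phib // !loop_bdy //; exact: unit_interval0.
have h1 := line1_path; have h2 := line2_path.
have e1 x : D x -> k (x, 1) = line1 (x, 0).
  by move=> Dx; rewrite (ke x Dx).2 /line1 /= scale0r addr0.
have e2 x : D x -> line1 (x, 1) = line2 (x, 0) by move=> _; exact: line12.
have e3 x : D x -> line1 (x, 1) = k (phi x, 0).
  by move=> Dx; rewrite (ke _ (phiD Dx)).1 line12 /line2 /= scale0r addr0.
have e4 x : D x -> k (phi x, 1) = line2 (x, 0).
  by move=> Dx; rewrite (ke _ (phiD Dx)).2 /line2 /= scale0r addr0.
have e5 x : D x -> line2 (x, 1) = bubble k (x, 0).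
  by move=> Dx; rewrite hb0 // /line2 /= scale1r addrC subrK.
apply: path_eqv_trans (path_eqv_sym (path_eqv_assoc hk1 h1 h2 e1 e2)) _.
apply: path_eqv_trans (path_eqv_cat (bubble_square1 hk) (path_eqv_refl h2) _) _.
  by move=> x Dx; rewrite pcat1 e2.
apply: path_eqv_trans (path_eqv_assoc h1 hkp h2 e3 e4) _.
apply: path_eqv_trans (path_eqv_cat (path_eqv_refl h1) (bubble_square2 hk) _) _.
  by move=> x Dx; rewrite pcat0 /= e3.
exact: path_eqv_sym (path_eqv_assoc h1 h2 hb e2 e5).
Qed.
End Bubble.

Hypothesis p_gt0 : (0 < p)%N.

Implicit Types c : RR.

(** A point on the segment from vertex 0 to the barycentre of the opposite facet. *)
Definition ctr c : 'rV[RR]_p.+1 := \row_i (if i == ord0 then c else (1 - c) / p%:R).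

Lemma ctr_gt0 c i : 0 < c < 1 -> 0 < ctr c ord0 i.
Proof.
move=> c01; rewrite mxE; case: ifP => _; first by lra.
by rewrite divr_gt0 ?ltr0n //; lra.
Qed.

Lemma ctr_simplex c : 0 < c < 1 -> D (ctr c).
Proof.
move=> c01; split=> [i|]; first exact: ltW (ctr_gt0 i c01).
rewrite big_ord_recl mxE eqxx.
under eq_bigr do rewrite mxE eq_sym (negbTE (neq_lift _ _)).
rewrite sumr_const card_ord -[X in _ + X]mulr_natr divfK; first by lra.
by rewrite pnatr_eq0 -lt0n.
Qed.

Lemma ctr_gauge c x : 0 < c < 1 -> D x ->
  (1 - gauge (ctr c) x) * c <= x ord0 ord0 /\ (1 - gauge (ctr c) x) * (1 - c) <= 1 - x ord0 ord0.
Proof.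
move=> c01 [x0 x1].
have h i : (1 - gauge (ctr c) x) * ctr c ord0 i <= x ord0 i.
  have ci := ctr_gt0 i c01; rewrite -ler_pdivlMr //.
  by have := gauge_ge (ctr c) x i; lra.
split; first by have := h ord0; rewrite mxE eqxx.
have -> : 1 - x ord0 ord0 = \sum_(i < p) x ord0 (lift ord0 i).
  by rewrite -x1 big_ord_recl addrC addKr.
have -> : (1 - gauge (ctr c) x) * (1 - c) = \sum_(i < p) (1 - gauge (ctr c) x) * ctr c ord0 (lift ord0 i).
  rewrite -mulr_sumr; congr (_ * _).
  under eq_bigr do rewrite mxE eq_sym (negbTE (neq_lift _ _)).
  rewrite sumr_const card_ord -[RHS]mulr_natr divfK //.
  by rewrite pnatr_eq0 -lt0n.
by apply: ler_sum => i _; exact: h.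
Qed.

(** In positive dimension there is room for two disjoint balls. Both loops are conjugated, along one
    common path, to loops at [tau \o chi] that each move in one ball only, and these can be run
    independently. *)
Lemma loops_commute k l : is_loop k -> is_loop l -> seqv p (pcat k l) (pcat l k).
Proof.
move=> hk hl.
(* With first coordinates 2/3 and 1/3, [ctr_gauge] makes the two gauges add up to at least 1/2
   everywhere. Balls of radius 1/8 are thus disjoint, with excesses adding up to at least 1/4, the
   lower bound used in [al]. *)
pose a := ctr (2 / 3 : RR); pose b := ctr (3^-1 : RR); pose r : RR := 8^-1.
have a01 : 0 < (2 / 3 : RR) < 1 by apply/andP; split; lra.
have b01 : 0 < (3^-1 : RR) < 1 by apply/andP; split; lra.
have r0 : 0 < r by rewrite /r; lra.
have ap i := ctr_gt0 i a01; have bp i := ctr_gt0 i b01.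
have gab x : D x -> 2^-1 <= gauge a x + gauge b x.
  move=> Dx; have [h1 _] := ctr_gauge a01 Dx; have [_ h2] := ctr_gauge b01 Dx.
  by rewrite -/a -/b in h1 h2; lra.
pose ma x : RR := Num.max r (gauge a x); pose mb x : RR := Num.max r (gauge b x).
have ma0 x : 0 < ma x by rewrite lt_max r0.
have mb0 x : 0 < mb x by rewrite lt_max r0.
have cga : cts (gauge a) by apply: (@cts_gauge _ _ _ (fun x => x)); exact: cts_id.
have cgb : cts (gauge b) by apply: (@cts_gauge _ _ _ (fun x => x)); exact: cts_id.
have cma : cts ma by rewrite /ma; continuity.
have cmb : cts mb by rewrite /mb; continuity.
pose phi x := expand a (ma x) x; pose psi x := expand b (mb x) x.
have cphi : cts phi by apply: cts_expand => //; [move=> q; rewrite gt_eqF|exact: cts_id].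
have cpsi : cts psi by apply: cts_expand => //; [move=> q; rewrite gt_eqF|exact: cts_id].
pose A x : RR := Num.max (gauge a x - r) 0; pose B x : RR := Num.max (gauge b x - r) 0.
(* An Urysohn function, 1 on the first ball and 0 on the second; it makes [chi] agree with [phi] on
   the one and with [psi] on the other. *)
pose al x : RR := B x / Num.max (A x + B x) (4^-1).
have AB x : D x -> Num.max (A x + B x) (4^-1) = A x + B x.
  move=> Dx; rewrite maxl //; have := gab x Dx.
  have : gauge a x - r <= A x by rewrite le_max lexx.
  have : gauge b x - r <= B x by rewrite le_max lexx.
  by rewrite /r; lra.
have A0 x : 0 <= A x by rewrite le_max lexx orbT.
have B0 x : 0 <= B x by rewrite le_max lexx orbT.
have den0 x : 0 < Num.max (A x + B x) (4^-1) by rewrite lt_max; apply/orP; right; lra.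
have Ial x : D x -> unit_interval (al x).
  move=> Dx; rewrite unit_intervalE /al divr_ge0 ?(ltW (den0 x)) //=.
  rewrite ler_pdivrMr ?den0 // mul1r AB //.
  by have := A0 x; lra.
have cal : cts al.
  have cA : cts A by rewrite /A; continuity.
  have cB : cts B by rewrite /B; continuity.
  apply: cts_mul => //; apply: cts_inv; first by continuity.
  by move=> x; rewrite gt_eqF ?den0.
pose chi x := psi x + al x *: (phi x - psi x).
have cchi : cts chi by rewrite /chi; continuity.
have phiD x : D x -> D (phi x).
  by move=> Dx; apply: expand_simplex => //; [exact: ctr_simplex|rewrite le_max lexx orbT].
have psiD x : D x -> D (psi x).
  by move=> Dx; apply: expand_simplex => //; [exact: ctr_simplex|rewrite le_max lexx orbT].
have chiD x : D x -> D (chi x).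
  by move=> Dx; apply: mix_simplex; [exact: Ial|exact: psiD|exact: phiD].
have phib x : D x -> bdy p x -> phi x = x.
  move=> Dx [i xi]; rewrite /phi /ma (gauge_boundary ap Dx xi) maxr ?expand1 //.
  by rewrite /r; lra.
have psib x : D x -> bdy p x -> psi x = x.
  move=> Dx [i xi]; rewrite /psi /mb (gauge_boundary bp Dx xi) maxr ?expand1 //.
  by rewrite /r; lra.
have chib x : D x -> bdy p x -> chi x = x.
  by move=> Dx bx; rewrite /chi phib // psib // subrr scaler0 addr0.
have phi_out x : D x -> r <= gauge a x -> bdy p (phi x).
  by move=> Dx h; apply: expand_boundary => //; rewrite /ma maxr.
have psi_out x : D x -> r <= gauge b x -> bdy p (psi x).
  by move=> Dx h; apply: expand_boundary => //; rewrite /mb maxr.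
have chi_phi x : D x -> gauge a x <= r -> chi x = phi x.
  move=> Dx h; rewrite /chi /al AB //.
  have Ax : A x = 0 by rewrite /A maxr //; lra.
  have Bx : B x != 0.
    rewrite gt_eqF // /B lt_max; apply/orP; left; have := gab x Dx; rewrite /r in h *; lra.
  by rewrite Ax add0r divff // scale1r addrC subrK.
have chi_psi x : D x -> gauge b x <= r -> chi x = psi x.
  move=> Dx h; rewrite /chi /al.
  have -> : B x = 0 by rewrite /B maxr //; lra.
  by rewrite mul0r scale0r addr0.
have ek := bubble_conj cphi cchi cga phiD chiD phib chib phi_out chi_phi hk.
have el := bubble_conj cpsi cchi cgb psiD chiD psib chib psi_out chi_psi hl.
have [hk2 hk20 hk21] := bubble_loop cphi cchi cga phiD chiD phib phi_out chi_phi hk.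
have [hl2 hl20 hl21] := bubble_loop cpsi cchi cgb psiD chiD psib psi_out chi_psi hl.
have hq := lines_path cphi cchi phiD chiD phib chib.
have hq' := lines_path cpsi cchi psiD chiD psib chib.
(* Both conjugating paths are images under [tau] of paths in the convex simplex with the same ends,
   so [l] can be conjugated along the path used for [k]. *)
have eqq : seqv p (lines psi chi) (lines phi chi).
  apply: path_eqv_trans (path_eqv_trans (@line_eqv (lines_map psi chi) (lines_map phi chi) _ _ _ _ _ _ _ _) _).
  - by apply: path_eqv_ext => // x t Dx It; rewrite linesE.
  - exact: cts_lines_map.
  - exact: cts_lines_map.
  - by move=> x t Dx It; exact: lines_map_simplex.
  - by move=> x t Dx It; exact: lines_map_simplex.
  - by move=> x; rewrite !lines_map0.
  - by move=> x; rewrite !lines_map1.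
  - by move=> x t Dx bx; rewrite lines_map_bdy.
  - by move=> x t Dx bx; rewrite lines_map_bdy.
  - by apply: path_eqv_sym; apply: path_eqv_ext => // x t Dx It; rewrite linesE.
have el' : seqv p (pcat l (lines phi chi)) (pcat (lines phi chi) (bubble psi chi (gauge b) r l)).
  have le x : D x -> l (x, 1) = lines psi chi (x, 0).
    by move=> Dx; rewrite (hl.2 x Dx).2 linesE lines_map0.
  have le' x : D x -> lines psi chi (x, 1) = bubble psi chi (gauge b) r l (x, 0).
    by move=> Dx; rewrite hl20 // linesE lines_map1.
  have h1 := path_eqv_cat (path_eqv_refl hl.1) eqq le.
  have h2 := path_eqv_cat eqq (path_eqv_refl hl2) le'.
  exact: path_eqv_trans (path_eqv_sym h1) (path_eqv_trans el h2).
have ekl : seqv p (pcat (bubble phi chi (gauge a) r k) (bubble psi chi (gauge b) r l))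
                  (pcat (bubble psi chi (gauge b) r l) (bubble phi chi (gauge a) r k)).
  (* Since the supports are disjoint, the two loops can be given separate times, which yields a
     square. *)
  pose W (z : 'rV[RR]_p.+1 * RR * RR) := if gauge a z.1.1 <= r then k (phi z.1.1, z.1.2)
    else bubble psi chi (gauge b) r l (z.1.1, z.2).
  have Wl x u v : D x -> (forall y, D y -> k (y, u) = tau y) ->
      (forall y, D y -> l (y, 0) = tau y) -> W (x, u, v) = bubble psi chi (gauge b) r l (x, v).
    move=> Dx hu _; rewrite /W /=; case: ifP => // h; rewrite hu; last exact: phiD.
    rewrite /bubble /= ifN ?chi_phi // -ltNge.
    by have := gab x Dx; rewrite /r in h *; lra.
  have Wk x u v : D x -> unit_interval v -> (forall y, D y -> l (y, v) = tau y) ->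
      W (x, u, v) = bubble phi chi (gauge a) r k (x, u).
    move=> Dx Iv hv; rewrite /W /bubble /=; case: ifP => // h; case: ifP => // h'.
    by rewrite hv ?chi_psi //; exact: psiD.
  apply: (@path_eqv_square _ _ _ _ W).
  - pose C (c : bool) : set ('rV[RR]_p.+1 * RR * RR) :=
      if c then [set q | gauge a q.1.1 <= r] else [set q | r <= gauge a q.1.1].
    apply: (@cton_paste _ _ _ _ C).
    + by case; [apply: closed_le_fun|apply: closed_ge_fun]; apply: cts_comp => //; continuity.
    + move=> [[x t] s] _; have [h|/ltW h] := leP (gauge a x) r; [by exists true|by exists false].
    case=> /=.
      apply: (cton_comp (g := fun q : 'rV[RR]_p.+1 * RR * RR => (phi q.1.1, q.1.2)) hk.1.1).
      * by continuity; apply: (cts_comp cphi); continuity.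
      * by move=> [[x t] s] [[[Dx It] Is] _]; split=> //; exact: phiD.
      * by move=> [[x t] s] [_ /= h]; rewrite /W /= h.
    apply: (cton_comp (g := fun q : 'rV[RR]_p.+1 * RR * RR => (q.1.1, q.2)) hl2.1).
    * by continuity.
    * by move=> [[x t] s] [[[Dx It] Is] _].
    * move=> [[x t] s] [[[/= Dx It] Is] /= h]; rewrite /W /=; case: ifP => // h'.
      rewrite (loop_bdy hk); [|exact: phiD|exact: phi_out|exact: It].
      rewrite /bubble /= ifN ?chi_phi // -ltNge.
      by have := gab x Dx; rewrite /r in h' *; lra.
  - move=> x u Dx Iu; apply: Wk => //; first exact: unit_interval0.
    by move=> y Dy; rewrite (hl.2 y Dy).1.
  - by move=> x s Dx Is; apply: Wl => // y Dy; [rewrite (hk.2 y Dy).2|rewrite (hl.2 y Dy).1].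
  - by move=> x s Dx Is; apply: Wl => // y Dy; [rewrite (hk.2 y Dy).1|rewrite (hl.2 y Dy).1].
  - move=> x u Dx Iu; apply: Wk => //; first exact: unit_interval1.
    by move=> y Dy; rewrite (hl.2 y Dy).2.
  - move=> x u s Dx bx Iu Is; rewrite hk20 // chib // /W /=; case: ifP => h.
      by rewrite phib // loop_bdy.
    by rewrite (hl2.2 x s Dx bx Is) hl20 // chib.
have chic : cton D (fun x => tau (chi x)).
  by apply: (cton_comp (g := chi) ctau) => // x Dx; exact: chiD.
pose o := to_sing tau; pose o1 := to_sing (fun x => tau (chi x)).
have oE x : D x -> sval o x = tau x by move=> Dx; rewrite to_singE.
have o1E x : D x -> sval o1 x = tau (chi x) by move=> Dx; rewrite to_singE.
apply: (@conj_commute _ _ (@sarr X p) (seqv p) (@pcat _ X) (@pathinv _ X) (fun o => pcst (sval o))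
  (@sarr_cat X p) (@sarr_inv X p) (@sarr_refl X p) (@path_eqv_sym _ _ _ _) (@path_eqv_trans _ _ _ _)
  (@sarr_eqv_cat X p) (@sarr_assoc X p) (@sarr_inv_r X p) o o1 _ _ (lines phi chi)
  (bubble phi chi (gauge a) r k) (bubble psi chi (gauge b) r l) (@sarr_one_r X p)) => //.
- by split; [exact: hk.1|move=> x Dx; rewrite oE //; exact: hk.2].
- by split; [exact: hl.1|move=> x Dx; rewrite oE //; exact: hl.2].
- by split=> // x Dx; rewrite oE // o1E // !linesE lines_map0 lines_map1.
- by split=> // x Dx; rewrite !o1E // hk20 // hk21.
- by split=> // x Dx; rewrite !o1E // hl20 // hl21.
Qed.
End EckmannHilton.

(** * Invariant means *)

Lemma inf_le_bounded (A : set RR) b x : (forall y, A y -> b <= y) -> A x -> inf A <= x.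
Proof. by move=> hb; apply: ge_inf; exists b. Qed.

Section HahnBanach.
Variables (V : lmodType RR) (E : V -> Prop).
Hypothesis E0 : E 0.
Hypothesis ED : forall x y, E x -> E y -> E (x + y).
Hypothesis EZ : forall a x, E x -> E (a *: x).

Definition sublinear (q : V -> RR) : Prop :=
  (forall x y, E x -> E y -> q (x + y) <= q x + q y) /\
  (forall a x, 0 <= a -> E x -> q (a *: x) = a * q x).

Lemma sublinear0 q : sublinear q -> q 0 = 0.
Proof. by move=> [_ qZ]; have := qZ 0 0 (lexx _) E0; rewrite scale0r mul0r. Qed.

Lemma EN x : E x -> E (- x).
Proof. by rewrite -scaleN1r; exact: EZ. Qed.

Lemma sublinear_opp q x : sublinear q -> E x -> - q (- x) <= q x.
Proof.
move=> hq Ex; have := hq.1 _ _ Ex (EN Ex).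
by rewrite subrr sublinear0 //; lra.
Qed.

(** Covers the three infima used below: the lower bound of a chain in Zorn's lemma, the modification
    showing that minimal functionals are additive, and the separating functional. *)
Lemma inf_sublinear (C : V -> set RR) :
  (forall x, E x -> C x !=set0) -> (forall x, E x -> exists b, forall y, C x y -> b <= y) ->
  (forall x y a b, E x -> E y -> C x a -> C y b -> exists2 c, C (x + y) c & c <= a + b) ->
  (forall a x b, 0 < a -> E x -> C x b -> exists2 c, C (a *: x) c & c <= a * b) ->
  C 0 0 -> (forall y, C 0 y -> 0 <= y) ->
  sublinear (fun x => inf (C x)).
Proof.
move=> C_ne C_lb C_add C_scale C00 C0.
have hZ a x : 0 < a -> E x -> inf (C (a *: x)) <= a * inf (C x).
  move=> a0 Ex; have [b hb] := C_lb _ (EZ a Ex).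
  rewrite mulrC -ler_pdivrMr //; apply: lb_le_inf; first exact: C_ne.
  move=> y Cy; have [c Cc cy] := C_scale a x y a0 Ex Cy.
  by rewrite ler_pdivrMr // mulrC; apply: le_trans cy; exact: inf_le_bounded hb Cc.
split=> [x y Ex Ey|a x].
  have [l hl] := C_lb _ (ED Ex Ey).
  rewrite -lerBlDr; apply: lb_le_inf; first exact: C_ne.
  move=> a Ca; rewrite lerBlDr -lerBlDl; apply: lb_le_inf; first exact: C_ne.
  move=> b Cb; have [c Cc cab] := C_add _ _ _ _ Ex Ey Ca Cb.
  by rewrite lerBlDl; apply: le_trans cab; exact: inf_le_bounded hl Cc.
rewrite le_eqVlt => /orP[/eqP <- _|a0 Ex].
  rewrite scale0r mul0r; apply/eqP; rewrite eq_le; apply/andP; split.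
    exact: inf_le_bounded C0 C00.
  by apply: lb_le_inf => //; exists 0.
apply/eqP; rewrite eq_le hZ //=.
have ai : 0 < a^-1 by rewrite invr_gt0.
have := hZ _ _ ai (EZ a Ex); rewrite scalerA mulVf ?gt_eqF // scale1r.
by rewrite -(ler_pM2l a0) mulrA mulfV ?gt_eqF // mul1r.
Qed.

(** A minimal sublinear functional is linear, and minimal ones exist by Zorn's lemma, the pointwise
    infimum being a lower bound of a nonempty chain. *)
Theorem hahn_banach q0 : sublinear q0 -> exists q : V -> RR,
  [/\ forall x, E x -> q x <= q0 x, forall x y, E x -> E y -> q (x + y) = q x + q y &
      forall a x, E x -> q (a *: x) = a * q x].
Proof.
move=> q0S.
pose T := {q : V -> RR | sublinear q /\ forall x, E x -> q x <= q0 x}.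
(* The order is reversed, so that maximal elements are minimal functionals. *)
pose R (s t : T) := `[< forall x, E x -> sval t x <= sval s x >].
have t0 : T by exists q0; split.
have sT (t : T) : sublinear (sval t) by case: (svalP t).
have leT (t : T) x : E x -> sval t x <= q0 x by case: (svalP t) => _; apply.
have lbT (t : T) x : E x -> - q0 (- x) <= sval t x.
  move=> Ex; apply: le_trans (sublinear_opp (sT t) Ex); rewrite lerN2; apply: leT; exact: EN.
have [t tmax] : exists t, premaximal R t.
  apply: (ZL_preorder t0).
  - by move=> t; apply/asboolP.
  - by move=> r s t /asboolP rs /asboolP st; apply/asboolP => x Ex; apply: le_trans (st _ Ex) (rs _ Ex).
  move=> A Atot; have [[a0 Aa0]|A0] := pselect (A !=set0); last first.
    by exists t0 => s As; case: A0; exists s.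
  pose C x : set RR := [set y | exists2 t, A t & y = sval t x].
  have qS : sublinear (fun x => inf (C x)).
    apply: inf_sublinear.
    - by move=> x _; exists (sval a0 x); exists a0.
    - by move=> x Ex; exists (- q0 (- x)) => y [s _ ->]; exact: lbT.
    - move=> x y a b Ex Ey [s As ->] [t At ->].
      have [/asboolP st|/asboolP ts] := Atot _ _ As At.
        exists (sval t (x + y)); first by exists t.
        by apply: le_trans ((sT t).1 _ _ Ex Ey) _; rewrite lerD2r; exact: st.
      exists (sval s (x + y)); first by exists s.
      by apply: le_trans ((sT s).1 _ _ Ex Ey) _; rewrite lerD2l; exact: ts.
    - move=> a x b a_gt0 Ex [s As ->]; exists (sval s (a *: x)); first by exists s.
      by rewrite (sT s).2 // ltW.
    - by exists a0; rewrite ?sublinear0.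
    - by move=> y [s _ ->]; rewrite sublinear0.
  have leC x s : E x -> A s -> inf (C x) <= sval s x.
    move=> Ex As; apply: (@inf_le_bounded _ (- q0 (- x))); last by exists s.
    by move=> y [s' _ ->]; exact: lbT.
  have qT : sublinear (fun x => inf (C x)) /\ forall x, E x -> inf (C x) <= q0 x.
    by split=> // x Ex; apply: le_trans (leC _ _ Ex Aa0) _; exact: leT.
  exists (exist _ (fun x => inf (C x)) qT : T) => s As; apply/asboolP => x Ex /=; exact: leC.
have tS := sT t; set q := sval t in tS *.
have add x y : E x -> E y -> q (x + y) = q x + q y.
  move=> Ex Ey; apply/eqP; rewrite eq_le tS.1 //=.
  (* The infimum of [C] is sublinear and, by [s = 0], below [q]; hence it equals [q] by minimality,
     and [s = 1] gives superadditivity. *)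
  pose C x : set RR := [set b | exists2 s, 0 <= s & b = q (x + s *: y) - s * q y].
  have lbC z b : E z -> C z b -> - q (- z) <= b.
    move=> Ez [s s0 ->]; have := tS.1 _ _ (ED Ez (EZ s Ey)) (EN Ez).
    by rewrite addrAC subrr add0r tS.2 //; lra.
  have qS : sublinear (fun x => inf (C x)).
    apply: inf_sublinear.
    - by move=> z _; exists (q (z + 0 *: y) - 0 * q y); exists 0.
    - by move=> z Ez; exists (- q (- z)) => b; exact: lbC.
    - move=> z w a b Ez Ew [s s0 ->] [s' s'0 ->].
      exists (q (z + w + (s + s') *: y) - (s + s') * q y); first by exists (s + s') => //; exact: addr_ge0.
      have := tS.1 _ _ (ED Ez (EZ s Ey)) (ED Ew (EZ s' Ey)).
      by rewrite scalerDl addrACA; lra.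
    - move=> a z b a0 Ez [s s0 ->].
      exists (q (a *: z + (a * s) *: y) - (a * s) * q y).
        by exists (a * s) => //; apply: mulr_ge0 => //; exact: ltW.
      rewrite -scalerA -scalerDr tS.2; [by rewrite mulrBr mulrA|exact: ltW|exact: ED Ez (EZ _ Ey)].
    - by exists 0; rewrite // scale0r mul0r addr0 sublinear0 // subr0.
    - by move=> b [s s0 ->]; rewrite add0r tS.2 // subrr.
  have qle z : E z -> inf (C z) <= q z.
    move=> Ez; apply: (@inf_le_bounded _ (- q (- z))); first by move=> b; exact: lbC.
    by exists 0; rewrite // scale0r mul0r addr0 subr0.
  have qT : sublinear (fun x => inf (C x)) /\ forall x, E x -> inf (C x) <= q0 x.
    by split=> // z Ez; apply: le_trans (qle _ Ez) _; exact: leT.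
  have /asboolP/(_ x Ex) /= : R (exist _ _ qT) t.
    by apply: tmax; apply/asboolP => z Ez /=; exact: qle.
  rewrite -/q => h; rewrite -lerBrDr; apply: le_trans h _.
  apply: (@inf_le_bounded _ (- q (- x))); first by move=> b; exact: lbC.
  by exists 1; rewrite // scale1r mul1r.
exists q; split=> // [x Ex|a x Ex]; first exact: leT.
have [a0|a0] := leP 0 a; first by rewrite tS.2.
have an : 0 <= - a by rewrite oppr_ge0 ltW.
have := add _ _ (EZ a Ex) (EZ (- a) Ex); rewrite -scalerDl subrr scale0r sublinear0 //.
by rewrite (tS.2 _ _ an Ex); lra.
Qed.
End HahnBanach.

(** * From an invariant mean to almost invariant probabilities *)

Section Day.
Variables (P : Type) (L : P -> Prop) (eqv : P -> P -> Prop) (cat : P -> P -> P).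
Variable m : (P -> RR) -> RR.

Definition linf (f : P -> RR) : Prop :=
  (exists M : RR, forall g, L g -> `|f g| <= M) /\
  (forall g h, L g -> L h -> eqv g h -> f g = f h).

Hypothesis m_lin : forall a f g, linf f -> linf g -> m (fun x => a * f x + g x) = a * m f + m g.
Hypothesis m_pos : forall f, linf f -> (forall x, L x -> 0 <= f x) -> 0 <= m f.
Hypothesis m_one : m (fun _ => 1) = 1.
Hypothesis m_inv : forall f h, linf f -> L h -> m (fun x => f (cat h x)) = m f.
Hypothesis L_cat : forall g h, L g -> L h -> L (cat g h).
Hypothesis eqv_cat_l : forall h g g', L h -> L g -> L g' -> eqv g g' -> eqv (cat h g) (cat h g').

Lemma linf_cst a : linf (fun _ => a).
Proof. by split=> //; exists `|a|. Qed.

Lemma linf_comb a f g : linf f -> linf g -> linf (fun x => a * f x + g x).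
Proof.
move=> [[M hM] fe] [[N hN] ge]; split; last by move=> x y hx hy xy; rewrite (fe x y) // (ge x y).
exists (`|a| * M + N) => x hx; apply: le_trans (ler_normD _ _) _; apply: lerD; last exact: hN.
by rewrite normrM ler_wpM2l // hM.
Qed.

Lemma linf_cat f h : linf f -> L h -> linf (fun x => f (cat h x)).
Proof.
move=> [[M hM] fe] hh; split; first by exists M => x hx; apply: hM; exact: L_cat.
by move=> x y hx hy xy; apply: fe; [exact: L_cat|exact: L_cat|exact: eqv_cat_l].
Qed.

Lemma mean0 : m (fun _ => 0) = 0.
Proof.
have := m_lin (-1) (linf_cst 1) (linf_cst 1); rewrite m_one mulr1 addNr => e.
by rewrite -[RHS]e; congr m; apply/funext => x; rewrite mulr1 addNr.
Qed.

Lemma mean_sum (I : Type) (s : seq I) (G : I -> P -> RR) : (forall i, linf (G i)) ->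
  linf (fun x => \sum_(i <- s) G i x) /\ m (fun x => \sum_(i <- s) G i x) = \sum_(i <- s) m (G i).
Proof.
move=> hG; elim: s => [|i s [IH1 IH2]].
  rewrite big_nil.
  have -> : (fun x : P => \sum_(i <- [::]) G i x) = (fun _ => 0) by apply/funext => x; rewrite big_nil.
  by split; [exact: linf_cst|exact: mean0].
have -> : (fun x : P => \sum_(j <- i :: s) G j x) = (fun x => 1 * G i x + \sum_(j <- s) G j x).
  by apply/funext => x; rewrite big_cons mul1r.
split; first exact: linf_comb.
by rewrite m_lin // IH2 big_cons mul1r.
Qed.

(* If no almost invariant probability exists, Hahn-Banach separates: it yields bounded
   functions [f k] with [\sum_k f k (h k * g) - f k g >= eps] for all [g], and an
   invariant mean integrates the left-hand side to zero. *)
Theorem reiter_of_mean r (h : 'I_r -> P) (eps : RR) :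
  (forall k, L (h k)) -> 0 < eps ->
  exists D : fchain P, [/\ is_prob D, supported L D &
    forall k f, test eqv L f -> `|pairing (fun g => f (cat (h k) g)) D - pairing f D| <= eps].
Proof.
move=> hh e0; apply: contrapT => no.
pose TK (F : 'I_r -> P -> RR) := forall k, test eqv L (F k).
pose v g (F : 'I_r -> P -> RR) : RR := \sum_k (F k (cat (h k) g) - F k g).
have test0 : test eqv L (fun _ => 0) by split=> // g _; rewrite normr0.
have sep1 D : is_prob D -> supported L D ->
    exists F, TK F /\ eps <= pairing (fun g => v g F) D.
  move=> Dp Ds; have : ~ (forall k f, test eqv L f ->
      `|pairing (fun g => f (cat (h k) g)) D - pairing f D| <= eps).
    by move=> H; apply: no; exists D.
  move=> /existsNP[k /existsNP[f /not_implyP[tf /negP]]]; rewrite -ltNge => hk.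
  set w := _ - _ in hk.
  (* A single translation [k] already violates the bound; the sign makes its contribution
     positive. *)
  pose s : RR := if 0 <= w then 1 else -1.
  pose F (j : 'I_r) (g : P) : RR := if j == k then s * f g else 0.
  exists F; split.
    move=> j; rewrite /F; case: eqP => _ //; case: tf => f1 fe; split=> [g hg|g g' hg hg' e].
      rewrite normrM; have -> : `|s| = 1 by rewrite /s; case: ifP; rewrite ?normrN normr1.
      by rewrite mul1r f1.
    by rewrite (fe g g').
  have -> : pairing (fun g => v g F) D = s * w.
    rewrite /w -pairingB -pairingZ; apply: eq_pairingT => g.
    rewrite /v (bigD1 k) //= big1 ?addr0; first by rewrite /F eqxx mulrBr.
    by move=> j jk; rewrite /F (negbTE jk) subrr.
  by move: hk; rewrite /s; case: ifP => w0 hk; [move: hk; rewrite ger0_norm|move: hk; rewrite ltr0_norm ?ltNge ?w0]; lra.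
pose pos (D : fchain P) := all (fun x => 0 <= x.1) D.
have sep D : pos D -> supported L D ->
    exists F, TK F /\ eps * pairing (fun _ => 1) D <= pairing (fun g => v g F) D.
  move=> Dp Ds; set s := pairing (fun _ => 1) D.
  have s0 : 0 <= s.
    rewrite /s /pairing; elim: D Dp {Ds s} => [|x D IH] /=; first by rewrite big_nil.
    by move=> /andP[x0 /IH]; rewrite big_cons mulr1; exact: addr_ge0.
  have [sz|snz] := eqVneq s 0.
    exists (fun _ _ => 0); split=> //; rewrite sz mulr0.
    rewrite (eq_pairingT _ (_ : _ =1 fun _ => 0 * 0)) ?pairingZ ?mul0r // => g.
    by rewrite /v big1 ?mul0r // => k _; rewrite subrr.
  have sp : 0 < s by rewrite lt_neqAle eq_sym snz.
  have [F [tF hF]] : exists F, TK F /\ eps <= pairing (fun g => v g F) (scale_chain s^-1 D).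
    apply: sep1; last exact: supported_scale.
    split; last by rewrite pairing_scale mulVf.
    rewrite /scale_chain all_map; apply: sub_all Dp => x x0 /=.
    by rewrite mulr_ge0 // invr_ge0.
  exists F; split=> //; move: hF; rewrite pairing_scale mulrC.
  by rewrite ler_pdivlMr.
pose W : lmodType RR := (('I_r -> P -> RR) -> RR^o)%type.
pose E (x : W) := exists M : RR, forall F, TK F -> `|x F : RR| <= M.
have E0 : E 0 by exists 0 => F _; rewrite normr0.
have ED x y : E x -> E y -> E (x + y).
  move=> [M hM] [N hN]; exists (M + N) => F tF.
  by apply: le_trans (ler_normD _ _) _; apply: lerD; [exact: hM|exact: hN].
have EZ a x : E x -> E (a *: x).
  move=> [M hM]; exists (`|a| * M) => F tF.
  by rewrite [`|_|]normrM ler_wpM2l // hM.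
(* The infimum of [C x] minimises, over positive [D], the supremum of [x] plus the pairing of [v]
   with [D], minus [eps] times the total weight of [D]. It is finite by [sep]. A linear [q] below it
   is bounded by the supremum ([D] empty) and is at least [eps] on each [v g] ([D] the point mass at
   [g]). *)
pose C (x : W) : set RR := [set b | exists D c, [/\ pos D, supported L D,
  forall F, TK F -> (x F : RR) + pairing (fun g => v g F) D <= c &
  b = c - eps * pairing (fun _ => 1) D]].
have lbC x (M b : RR) : (forall F, TK F -> `|x F : RR| <= M) -> C x b -> - M <= b.
  move=> hM [D [c [Dp Ds hc ->]]]; have [F [tF hF]] := sep D Dp Ds.
  have := hc F tF; have := hM F tF; rewrite ler_norml => /andP[h1 _]; lra.
have ubC x (M : RR) : (forall F, TK F -> (x F : RR) <= M) -> C x M.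
  move=> hM; exists [::], M; split=> //.
    by move=> F tF; rewrite pairing_nil addr0; exact: hM.
  by rewrite pairing_nil mulr0 subr0.
have qS : sublinear E (fun x => inf (C x)).
  apply: inf_sublinear => //.
  - move=> x [M hM]; exists M; apply: ubC => F tF; exact: le_trans (ler_norm _) (hM _ tF).
  - by move=> x [M hM]; exists (- M) => b; exact: lbC.
  - move=> x y a b _ _ [D [c [Dp Ds hc ->]]] [D' [c' [Dp' Ds' hc' ->]]].
    exists (c + c' - eps * pairing (fun _ => 1) (D ++ D')); last by rewrite pairing_cat; lra.
    exists (D ++ D'), (c + c'); split=> //; first by rewrite /pos all_cat; apply/andP.
      exact: supported_cat.
    move=> F tF; have := hc F tF; have := hc' F tF.
    rewrite pairing_cat (_ : (x + y) F = x F + y F) //.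
    by move: (x F : RR) (y F : RR) => xF yF; lra.
  - move=> a x b a0 _ [D [c [Dp Ds hc ->]]].
    exists (a * c - eps * pairing (fun _ => 1) (scale_chain a D)).
      exists (scale_chain a D), (a * c); split=> //.
      + rewrite /pos /scale_chain all_map; apply: sub_all Dp => y y0 /=.
        by rewrite mulr_ge0 // ltW.
      + exact: supported_scale.
      + move=> F tF; rewrite pairing_scale [(a *: x) F](_ : _ = a * (x F : RR)) // -mulrDr.
        by rewrite ler_pM2l //; exact: hc.
    by rewrite pairing_scale mulrBr mulrCA.
  - by apply: ubC.
  - by move=> b Cb; rewrite -[0 : RR]oppr0; apply: lbC Cb => F _; rewrite normr0.
have [q [q_le qD qZ]] := hahn_banach E0 ED EZ qS.
have q_ub x M : E x -> (forall F, TK F -> (x F : RR) <= M) -> q x <= M.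
  move=> Ex hM; apply: le_trans (q_le _ Ex) _; have [N hN] := Ex.
  by apply: (@inf_le_bounded _ (- N)); [move=> b; exact: lbC|exact: ubC].
pose de k g : W := fun F => F k g.
have Ede k g : L g -> E (de k g) by move=> hg; exists 1 => F tF; case: (tF k) => h1 _; exact: h1.
have qN x : E x -> q (- x) = - q x by move=> Ex; rewrite -scaleN1r qZ // mulN1r.
have EN' x : E x -> E (- x) by move=> Ex; rewrite -scaleN1r; exact: EZ.
pose f k g : RR := q (de k g).
have f_linf k : linf (f k).
  split=> [|g g' hg hg' e].
    exists 1 => g hg; rewrite ler_norml; apply/andP; split.
      rewrite lerNl -qN; last exact: Ede.
      apply: q_ub => [|F tF]; first exact/EN'/Ede.
      by have := (tF k).1 g hg; rewrite ler_norml [(- de k g) F](_ : _ = - F k g) //; lra.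
    apply: q_ub => [|F tF]; first exact: Ede.
    by have := (tF k).1 g hg; rewrite ler_norml /de; lra.
  have le2 a b : L a -> L b -> (forall F, TK F -> F k a = F k b) -> f k a <= f k b.
    move=> La Lb ab; rewrite -subr_le0 /f -qN; last exact: Ede.
    rewrite -qD; [|exact: Ede|exact/EN'/Ede].
    apply: q_ub => [|F tF]; first by apply: ED; [exact: Ede|exact/EN'/Ede].
    by rewrite [(_ - _) F](_ : _ = F k a - F k b) // ab // subrr.
  apply/eqP; rewrite eq_le; apply/andP; split; apply: le2 => // F tF.
    exact: (tF k).2.
  by apply/esym; exact: (tF k).2.
have qsum (s : seq 'I_r) g : L g ->
    let x : W := fun F => \sum_(k <- s) (F k (cat (h k) g) - F k g) in
    E x /\ q x = \sum_(k <- s) (f k (cat (h k) g) - f k g).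
  move=> hg; elim: s => [|k s [IH1 IH2]] x.
    have -> : x = 0 by apply/funext => F; rewrite /x big_nil.
    split=> //; rewrite big_nil -(scale0r (0 : W)) qZ // mul0r //.
  have hcg : L (cat (h k) g) by exact: L_cat.
  have -> : x = de k (cat (h k) g) - de k g + (fun F => \sum_(k <- s) (F k (cat (h k) g) - F k g)).
    by apply/funext => F; rewrite /x big_cons.
  have Ek : E (de k (cat (h k) g) - de k g) by apply: ED; [|apply: EN']; apply: Ede.
  split; first exact: ED.
  by rewrite qD // IH2 big_cons qD ?qN //; [exact: Ede|exact: Ede|apply: EN'; exact: Ede].
have fge g : L g -> eps <= \sum_k (f k (cat (h k) g) - f k g).
  move=> hg; have [Ev <-] := qsum (index_enum 'I_r) g hg.
  rewrite -[eps]opprK lerNl -qN //; apply: le_trans (q_le _ (EN' _ Ev)) _.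
  have [N hN] := EN' _ Ev.
  apply: (@inf_le_bounded _ (- N)); first by move=> b; exact: lbC.
  exists [:: (1, g)], 0; split=> //=; first by rewrite /pos /= ler01.
    move=> F tF; rewrite pairing_cons pairing_nil mul1r addr0 /=.
    by rewrite [X in X + _](_ : _ = - v g F) // addNr.
  by rewrite pairing_cons pairing_nil mul1r addr0 mulr1 sub0r.
pose G k g := -1 * f k g + f k (cat (h k) g).
have G_linf k : linf (G k) by apply: linf_comb => //; exact: linf_cat.
have mG k : m (G k) = 0 by rewrite m_lin // ?m_inv //; [rewrite mulN1r addNr|exact: linf_cat].
have [u1 u2] := mean_sum (index_enum 'I_r) G_linf.
have := m_pos (linf_comb (- eps) (linf_cst 1) u1).
rewrite m_lin ?m_one ?u2; [|exact: linf_cst|exact: u1].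
rewrite big1 ?addr0 ?mulr1 => [H|k _]; last exact: mG.
suff /H : forall x, L x -> 0 <= - eps + \sum_k G k x by lra.
move=> g hg; rewrite addrC subr_ge0; apply: le_trans (fge g hg) _.
by rewrite le_eqVlt; apply/orP; left; apply/eqP; apply: eq_bigr => k _; rewrite /G mulN1r addrC.
Qed.
End Day.

(** * Amenability of the groupoid of motions *)

Lemma std_simplex0E x : std_simplex 0 x -> x = vertex0 0.
Proof.
move=> [_]; rewrite big_ord1 => x1; apply/rowP => i.
by rewrite mxE (ord1 i) x1 eqxx.
Qed.

Lemma bdy0 x : std_simplex 0 x -> ~ bdy 0 x.
Proof.
move=> [_]; rewrite big_ord1 => x1 [i]; rewrite (ord1 i) x1; move/eqP; by rewrite oner_eq0.
Qed.

(** A loop as a path of 0-simplices; under this translation [loop_cat] becomes [pcat] by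
    computation. *)
Definition loop_path (X : Type) (g : RR -> X) (q : 'rV[RR]_1 * RR) : X := g q.2.

Section Loops.
Variables (X : topologicalType) (U : set X) (x0 : X).

Lemma loop_path_spath g : loop_in U x0 g -> spath 0 (loop_path g).
Proof.
move=> [cg _]; split; last by move=> x t sx /(bdy0 sx).
apply: (cton_comp (g := snd) (Cton cg)) => //; first by continuity.
by move=> q [].
Qed.

Lemma loop_homotopic_seqv g h : loop_in U x0 g -> loop_homotopic x0 g h ->
  seqv 0 (loop_path g) (loop_path h).
Proof.
move=> [_ [_ [g0 g1]]] [H [cH [H0 [H1 He]]]]; exists (fun q => H (q.1.2, q.2)); split.
- apply: (cton_comp (g := fun q : 'rV[RR]_1 * RR * RR => (q.1.2, q.2)) (Cton cH)) => //.
    by continuity.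
  by move=> q [[_ h1] h2].
- by move=> x t _ It; exact: H0.
- by move=> x t _ It; exact: H1.
- by move=> x s _ Is; rewrite /loop_path /= g0 g1; exact: He.
- by move=> x t s sx /(bdy0 sx).
Qed.

Lemma loop_in_cat g h : loop_in U x0 g -> loop_in U x0 h -> loop_in U x0 (loop_cat g h).
Proof.
move=> hg hh; have sg := loop_path_spath hg; have sh := loop_path_spath hh.
have [_ [Ug [g0 g1]]] := hg; have [_ [Uh [h0 h1]]] := hh.
have [cc _] : spath 0 (pcat (loop_path g) (loop_path h)).
  by apply: pcat_path => // x _; rewrite /loop_path /= g1 h0.
split.
  have [//] : cton unit_interval (loop_cat g h).
  apply: (cton_comp (g := fun t : RR => (vertex0 0, t)) cc) => //; first by continuity.
  by move=> t It; split=> //; exact: vertex0_simplex.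
split; last by split; [rewrite -g0; exact: (pcat0 (loop_path g) (loop_path h) (vertex0 0))|
  rewrite -h1; exact: (pcat1 (loop_path g) (loop_path h) (vertex0 0))].
move=> t; rewrite unit_intervalE => It; rewrite /loop_cat; case: ifP => ht.
  by apply: Ug; rewrite unit_intervalE; lra.
have h2 : 2^-1 < t by rewrite ltNge ht.
by apply: Uh; rewrite unit_intervalE; lra.
Qed.

(** On loops [loop_homotopic] implies [seqv], so functions invariant under [seqv] lie in the domain
    of the given mean. *)
Lemma amenable_reiter : amenable_image U x0 ->
  forall r (h : 'I_r -> RR -> X) (eps : RR), (forall k, loop_in U x0 (h k)) -> 0 < eps ->
  exists D : fchain (RR -> X), [/\ is_prob D, supported (loop_in U x0) D &
    forall k f, test (fun g g' => seqv 0 (loop_path g) (loop_path g')) (loop_in U x0) f ->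
     `|pairing (fun g => f (loop_cat (h k) g)) D - pairing f D| <= eps].
Proof.
move=> [m [m_lin [m_pos [m_one m_inv]]]] r h eps hh e0.
have li f : linf (loop_in U x0) (fun g g' => seqv 0 (loop_path g) (loop_path g')) f ->
    linfty_image U x0 f.
  by move=> [fb fe]; split=> // g g' hg hg' e; apply: fe => //; exact: loop_homotopic_seqv.
apply: (@reiter_of_mean _ _ _ _ m) => //.
- by move=> a f g /li hf /li hg; exact: m_lin.
- by move=> f /li hf; exact: m_pos.
- by move=> f g /li hf hg; exact: m_inv.
- exact: loop_in_cat.
- move=> k g g' hk hg hg' e.
  suff: seqv 0 (pcat (loop_path k) (loop_path g)) (pcat (loop_path k) (loop_path g')) by [].
  apply: path_eqv_cat => //.
    by apply: path_eqv_refl; exact: loop_path_spath.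
  by move=> x _; rewrite /loop_path /= hk.2.2.2 hg.2.2.1.
Qed.
End Loops.

Section StageGroupoid.
Variables (X : topologicalType) (Col : Type) (U : Col -> set X) (p : nat).
Implicit Types (t : csing X Col p) (c e b : ppath X p).

Definition carr t t' c : Prop := [/\ t.2 = t'.2, sarr t.1 t'.1 c & allowed U t.2 c].

Lemma carr_cat t t' t'' c e : carr t t' c -> carr t' t'' e -> carr t t'' (pcat c e).
Proof.
move=> [e1 a1 h1] [e2 a2 h2]; split; [by rewrite e1|exact: sarr_cat a1 a2|].
apply: allowed_cat => //; [exact: a1.1|exact: a2.1| |by rewrite e1].
by move=> x; exact: sarr_ends a1 a2.
Qed.

Lemma carr_inv t t' c : carr t t' c -> carr t' t (pathinv c).
Proof. by move=> [e1 a1 h1]; split=> //; [exact: sarr_inv|rewrite -e1; exact: allowed_inv]. Qed.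

Lemma carr_one t : carr t t (pcst (sval t.1)).
Proof. by split=> //; [exact: sarr_one|apply: allowed_cst; exact: sing_cton]. Qed.

Hypothesis U_amenable : forall i, amenable_in (U i).

Lemma carr_reiter t : reiter carr (seqv p) (@pcat _ _) t.
Proof.
case: (posnP p) => [p0|p_gt0]; last first.
  apply: (@reiter_abelian _ _ carr (seqv p) (@pcat _ _) (fun t => pcst (sval t.1))).
  - exact: carr_cat.
  - exact: carr_one.
  - by move=> o o' c [_ h _]; exact: sarr_refl h.
  - exact: path_eqv_sym.
  - exact: path_eqv_trans.
  - by move=> o o' o'' c c' e e' [_ h _] [_ h' _]; exact: sarr_eqv_cat h h'.
  - by move=> o1 o2 o3 o4 c e b [_ h1 _] [_ h2 _] [_ h3 _]; exact: sarr_assoc h1 h2 h3.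
  move=> c e [_ h1 _] [_ h2 _].
  exact: (loops_commute (sing_cton t.1)).
move: t; rewrite /carr p0 => t r h eps hh e0.
set v := sval t.1 (vertex0 0); set i := t.2 ord0.
have D0 := vertex0_simplex 0.
have tE x : std_simplex 0 x -> sval t.1 x = v by move=> /std_simplex0E ->.
(* A vertex outside the set of its colour cannot move: all allowed loops there are null-homotopic
   and a point mass is invariant. *)
have [Uv|nUv] := pselect (U i v); last first.
  exists [:: (1, pcst (sval t.1))]; split; first exact: is_prob1.
    by split=> //; split=> //; [exact: sarr_one|apply: allowed_cst; exact: sing_cton].
  move=> k f [_ fe]; rewrite !pairing_cons !pairing_nil !mul1r !addr0 /=.
  have [_ sk ak] := hh k; have s1 := sarr_one t.1.
  have a1 := @allowed_cst _ _ U _ t.2 _ (sing_cton t.1).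
  rewrite (fe _ (pcst (sval t.1))) ?subrr ?normr0 ?ltW //.
    split=> //; first exact: sarr_cat sk s1.
    apply: allowed_cat => //; [exact: sk.1|exact: s1.1|].
    by move=> x; exact: sarr_ends sk s1.
  apply: path_eqv_trans (sarr_one_r sk) _.
  have [e he [hc|hU]] := ak erefl.
    apply: (path_eqv_trans he); apply: path_eqv_ext; first exact: path_eqv_is_path he.
    move=> x s sx Is; rewrite hc //.
    by have [<- _] := path_eqv_ends he sx; rewrite (sk.2 x sx).1.
  case: nUv; rewrite /v -(sk.2 _ D0).1.
  have [-> _] := path_eqv_ends he D0.
  by apply: hU => //; exact: unit_interval0.
(* Now the vertex lies in its set, so that constant loops are also loops in the set. *)
have /choice[l hl] k : exists g, loop_in (U i) v g /\ seqv 0 (h k) (loop_path g).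
  have [_ sk ak] := hh k; have [e he hcU] := ak erefl.
  have [ce _] := path_eqv_is_path he.
  have [e0E e1E] := path_eqv_ends he D0.
  have [s0 s1] := sk.2 _ D0.
  exists (fun s => e (vertex0 0, s)); split.
    split.
      have [//] : cton unit_interval (fun s => e (vertex0 0, s)).
      by apply: (cton_comp (g := fun s : RR => (vertex0 0, s)) ce) => //; continuity.
    split; last by rewrite -e0E -e1E s0 s1.
    by move=> s Is; case: hcU => H; [rewrite H // -e0E s0|apply: H].
  apply: (path_eqv_trans he); apply: path_eqv_ext; first exact: path_eqv_is_path he.
  by move=> x s /std_simplex0E ->.
have phiA g : loop_in (U i) v g -> [/\ t.2 = t.2, sarr t.1 t.1 (loop_path g) & allowed U t.2 (loop_path g)].
  move=> hg; have sg := loop_path_spath hg; have [_ [Ug [g0 g1]]] := hg; split=> //.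
    by split=> // x sx; rewrite /loop_path /= g0 g1 tE.
  move=> _; exists (loop_path g); first exact: path_eqv_refl.
  by right=> x s sx Is; exact: Ug.
have [D [D1 D2 D3]] := amenable_reiter (U_amenable Uv) (fun k => (hl k).1) e0.
exists (map_chain (@loop_path X) D); split.
- exact: is_prob_map.
- by apply/supported_map; apply: eq_supported D2 => g; exact: phiA.
move=> k f [f1 fe].
have := D3 k (f \o @loop_path X); rewrite !pairing_map => D3k.
apply: le_trans (D3k _); last first.
  split=> [g /phiA|g g' /phiA hg /phiA hg' e]; first exact: f1.
  exact: fe.
rewrite le_eqVlt; apply/orP; left; apply/eqP; congr (`|_ - _|).
apply: (eq_pairing D2) => g hg /=.
have [_ sg ag] := phiA g hg; have [_ sl al] := phiA _ (hl k).1; have [_ sk ak] := hh k.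
apply: fe.
- split=> //; first exact: sarr_cat sk sg.
  by apply: allowed_cat => //; [exact: sk.1|exact: sg.1|move=> x; exact: sarr_ends sk sg].
- by apply: phiA; apply: loop_in_cat => //; exact: (hl k).1.
- exact: (sarr_eqv_cat sk sg (hl k).2 (path_eqv_refl sg.1)).
Qed.

Lemma stage_amenable r (c : 'I_r -> ppath X p) (src tgt : 'I_r -> csing X Col p) (eps : RR) :
  (forall k, carr (src k) (tgt k) (c k)) -> 0 < eps ->
  exists (N : nat) (w : csing X Col p -> 'I_N.+1 -> RR) (x : csing X Col p -> 'I_N.+1 -> ppath X p),
  [/\ forall o i, 0 <= w o i, forall o, \sum_i w o i = 1, forall o i, from carr o (x o i) &
    forall k f, test (seqv p) (from carr (src k)) f ->
     `|\sum_i w (tgt k) i * f (pcat (c k) (x (tgt k) i)) - \sum_i w (src k) i * f (x (src k) i)| <= eps].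
Proof.
move=> hc e0.
apply: (@amenable_groupoid _ _ carr (seqv p) (@pcat _ _) (@pathinv _ _) (fun t => pcst (sval t.1))) => //.
- exact: carr_cat.
- exact: carr_inv.
- exact: carr_one.
- by move=> o o' e [_ h _]; exact: sarr_refl h.
- exact: path_eqv_sym.
- exact: path_eqv_trans.
- by move=> o o' o'' e e' b b' [_ h _] [_ h' _]; exact: sarr_eqv_cat h h'.
- by move=> o1 o2 o3 o4 e e' b [_ h1 _] [_ h2 _] [_ h3 _]; exact: sarr_assoc h1 h2 h3.
- by move=> o o' e [_ h _]; exact: sarr_one_l h.
- by move=> o o' e [_ h _]; exact: sarr_inv_r h.
- exact: carr_reiter.
Qed.
End StageGroupoid.

(** * Prisms *)

Lemma face_incl_face_incl n (i j : 'I_n.+3) (k l : 'I_n.+2) :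
  (forall m, lift i (lift k m) = lift j (lift l m)) ->
  forall x : 'rV[RR]_n.+1, face_incl i (face_incl k x) = face_incl j (face_incl l x).
Proof.
move=> e x; rewrite !face_inclE !act_map_comp; congr (act_map _ x).
by apply/funext => m /=; rewrite e.
Qed.

Definition pt n := ('rV[RR]_n.+1 * RR)%type.
Definition ppush n (i : 'I_n.+2) (x : pt n) : pt n.+1 := (face_incl i x.1, x.2).

Lemma ppush_ppush n (i j : 'I_n.+3) (k l : 'I_n.+2) :
  (forall m, lift i (lift k m) = lift j (lift l m)) ->
  forall x : pt n, ppush i (ppush k x) = ppush j (ppush l x).
Proof. by move=> e [x s]; rewrite /ppush /= (face_incl_face_incl e). Qed.

Lemma ppush_cyl n (i : 'I_n.+2) x : cyl1 n x -> cyl1 n.+1 (ppush i x).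
Proof. by move=> [h1 h2]; split=> //; exact: face_incl_simplex. Qed.

Definition aff2 k n (q : 'I_k.+1 -> pt n) (y : 'rV[RR]_k.+1) : pt n :=
  (aff (fun i => (q i).1) y, \sum_i y ord0 i * (q i).2).

Lemma aff2_act l k n (q : 'I_k.+1 -> pt n) (th : 'I_l.+1 -> 'I_k.+1) y :
  aff2 q (act_map th y) = aff2 (q \o th) y.
Proof.
congr (_, _); first exact: aff_act.
exact: (@aff_act RR^o _ _ (fun i => (q i).2) th y).
Qed.

Lemma aff2_cyl k n (q : 'I_k.+1 -> pt n) y : (forall a, cyl1 n (q a)) -> std_simplex k y ->
  cyl1 n (aff2 q y).
Proof.
move=> hq [y0 y1]; split=> /=; first by apply: aff_simplex => // i; exact: (hq i).1.
have hs i : 0 <= (q i).2 <= 1 by rewrite -unit_intervalE; exact: (hq i).2.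
rewrite unit_intervalE; apply/andP; split.
  by apply: sumr_ge0 => i _; apply: mulr_ge0 => //; case/andP: (hs i).
rewrite -y1; apply: ler_sum => i _; rewrite -[leRHS]mulr1; apply: ler_wpM2l => //.
by case/andP: (hs i).
Qed.

Lemma aff2_push k n (q : 'I_k.+1 -> pt n) i y :
  aff2 (tpush ppush i q) y = ppush i (aff2 q y).
Proof.
rewrite /ppush /aff2 /=; congr (_, _); rewrite face_inclE /act_map aff_comp.
by congr (aff _ y); apply/funext => a; rewrite face_inclE.
Qed.

Lemma cts_aff2 k n (q : 'I_k.+1 -> pt n) : cts (aff2 q).
Proof.
apply: cts_pair; first exact: cts_aff.
exact: (@cts_aff RR^o).
Qed.

Section Geo.
Variable X : topologicalType.

Definition geo k n (H : pt n -> X) (q : 'I_k.+1 -> pt n) : sing X k :=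
  to_sing (fun y => H (aff2 q y)).

Lemma geoE k n (H : pt n -> X) (q : 'I_k.+1 -> pt n) y : cton (cyl1 n) H ->
  (forall a, cyl1 n (q a)) -> std_simplex k y -> sval (geo H q) y = H (aff2 q y).
Proof.
move=> cH hq sy; rewrite to_singE //.
apply: (cton_comp (g := aff2 q) cH) => //; first exact: cts_aff2.
by move=> x; exact: aff2_cyl.
Qed.

Lemma act_geo l k n (H : pt n -> X) (q : 'I_k.+1 -> pt n) (th : 'I_l.+1 -> 'I_k.+1) :
  cton (cyl1 n) H -> (forall a, cyl1 n (q a)) -> act th (geo H q) = geo H (q \o th).
Proof.
move=> cH hq; apply: sing_ext => y sy; rewrite actE // geoE ?geoE ?aff2_act //.
- by move=> a; exact: hq.
- exact: act_map_simplex.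
Qed.

Variables (T : nat -> Type) (d : forall n, 'I_n.+2 -> T n.+1 -> T n).
Variable Hm : forall n, T n -> pt n -> X.
Hypothesis cH : forall n (t : T n), cton (cyl1 n) (Hm t).
Hypothesis Hface : forall n i (t : T n.+1) x, cyl1 n x -> Hm (d i t) x = Hm t (ppush i x).

Lemma geo_push k n i (t : T n.+1) (q : 'I_k.+1 -> pt n) : (forall a, cyl1 n (q a)) ->
  geo (Hm t) (tpush ppush i q) = geo (Hm (d i t)) q.
Proof.
move=> hq; apply: sing_ext => y sy; rewrite !geoE ?aff2_push ?Hface //.
- exact: aff2_cyl.
- by move=> a; exact: ppush_cyl.
Qed.

Variable v : forall n, pt n.
Hypothesis v_cyl : forall n, cyl1 n (v n).
Variable Phi : forall n, fchain ('I_n.+1 -> pt n).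
Hypothesis Phi_chain : forall n f, pairing (cob (@tface _ n) f) (Phi n.+1) =
  \sum_(i < n.+2) (-1) ^+ i * pairing (f \o tpush ppush i) (Phi n).
Hypothesis Phi_aug : pairing (fun _ => 1) (Phi 0) = 0.
Hypothesis Phi_cyl : forall n, supported (fun p => forall a, cyl1 n (p a)) (Phi n).

Let hmtp_cyl := hmtp_good v_cyl ppush_cyl Phi_cyl.

Definition hgeo n (t : T n) : fchain (sing X n.+1) :=
  map_chain (geo (Hm t)) (hmtp ppush v Phi n).

Lemma mass_hgeo n (t : T n) : mass (hgeo t) = mass (hmtp ppush v Phi n).
Proof. exact: mass_map. Qed.

Lemma hgeo_cob n (t : T n.+1) f : pairing (cob (@dS X n.+1) f) (hgeo t) =
  pairing (f \o geo (Hm t)) (Phi n.+1) - \sum_(i < n.+2) (-1) ^+ i * pairing f (hgeo (d i t)).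
Proof.
rewrite pairing_map.
rewrite (@eq_pairing _ _ _ (cob (@tface _ n.+1) (f \o geo (Hm t))) _ (hmtp_cyl n.+1)); last first.
  by move=> q hq /=; apply: eq_bigr => i _; rewrite /dS act_geo.
rewrite (hmtpS ppush_ppush v Phi_chain Phi_aug); congr (_ - _); apply: eq_bigr => i _.
rewrite pairing_map; congr (_ * _); apply: (eq_pairing (hmtp_cyl n)) => q hq /=.
by rewrite geo_push.
Qed.
End Geo.

Section Prism.
Variables (X : topologicalType) (Col : Type) (U : Col -> set X) (p : nat).

Definition prism_ends n : fchain ('I_n.+1 -> pt n) :=
  [:: (1, fun i => (basis i, 1)); (-1, fun i => (basis i, 0))].

(** The prism operator, built by coning and not by an explicit triangulation: what is used is its
    boundary formula and a bound on its mass depending on the dimension only. *)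
Definition prism n (m : mtn U p n) : fchain (sing X n.+1) :=
  hgeo (@hom _ _ U p) (fun n => (vertex0 n, 0)) prism_ends m.

Lemma prism_cob n (m : mtn U p n.+1) f : pairing (cob (@dS X n.+1) f) (prism m) =
  f (hend m).1 - f (sval m).1.1 - \sum_(i < n.+2) (-1) ^+ i * pairing f (prism (dM i m)).
Proof.
have cylb k (i : 'I_k.+1) (s : RR) : unit_interval s -> cyl1 k (basis i, s).
  by move=> Is; split=> //; exact: basis_simplex.
have I0 := unit_interval0; have I1 := unit_interval1.
have geo_basis (s : RR) y : unit_interval s -> std_simplex n.+1 y ->
    sval (geo (hom m) (fun i : 'I_n.+2 => (basis i, s))) y = hom m (y, s).
  move=> Is sy; rewrite geoE //; first by rewrite /aff2 /= aff_id -mulr_suml sy.2 mul1r.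
    exact: hom_cton.
  by move=> a; exact: cylb.
rewrite /prism (hgeo_cob (d := @dM _ _ U p)).
- congr (_ - _); rewrite /prism_ends !pairing_cons pairing_nil addr0 mul1r mulN1r /=.
  congr (f _ - f _); apply: sing_ext => y sy; rewrite geo_basis ?hom0 //.
  by rewrite hendE.
- by move=> k t; exact: hom_cton.
- by move=> k i t [x s] [sx Is]; rewrite hom_face.
- by move=> k; split=> //; exact: vertex0_simplex.
- move=> k g; rewrite /prism_ends !pairing_cons pairing_nil addr0.
  under [RHS]eq_bigr do rewrite !pairing_cons pairing_nil addr0 !mul1r.
  rewrite /cob mul1r mulN1r /= -sumrN -big_split /=; apply: eq_bigr => i _.
  have E (s : RR) : tface i (fun j => (basis j, s)) = tpush ppush i (fun j : 'I_k.+1 => (basis j, s)).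
    by apply/funext => j; rewrite /tface /tpush /ppush /= face_inclE act_map_basis.
  by rewrite !E mulN1r mulrBr.
- by rewrite /prism_ends !pairing_cons pairing_nil /= mulN1r addr0 mulr1 subrr.
- by move=> k; split=> //=; [move=> a; exact: cylb|split=> // a; exact: cylb].
Qed.

Definition prism_mass n := mass (hmtp ppush (fun n => (vertex0 n, 0)) prism_ends n).
Lemma mass_prism n (m : mtn U p n) : mass (prism m) = prism_mass n.
Proof. exact: mass_hgeo. Qed.
End Prism.

(** * Independent random choices *)

Section Expectation.
Variables (J : finType) (i0 : J).

Section OneType.
Variable A : finType.

Definition upd (s : {ffun A -> J}) a i : {ffun A -> J} := [ffun b => if b == a then i else s b].

(** Fubini for one coordinate: assignments with the value [i0] at [a] stand for assignments of the
    other coordinates. *)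
Lemma sum_split a (F : {ffun A -> J} -> RR) :
  \sum_s F s = \sum_(s : {ffun A -> J} | s a == i0) \sum_i F (upd s a i).
Proof.
rewrite exchange_big /= (partition_big (fun s : {ffun A -> J} => s a) xpredT) //=.
apply: eq_bigr => i _.
rewrite (reindex_onto (fun s => upd s a i) (fun s => upd s a i0)) /=; last first.
  move=> s /eqP si; apply/ffunP => b; rewrite !ffunE; case: eqP => [->|//]; by rewrite si.
apply: eq_bigl => s; rewrite ffunE !eqxx /=; apply/eqP/eqP => [/ffunP/(_ a)|sa].
  by rewrite !ffunE eqxx.
by apply/ffunP => b; rewrite !ffunE; case: eqP => [->|].
Qed.

Variable Q : Type.

Definition weight (w : A -> J -> RR) (s : {ffun A -> J}) : RR := \prod_a w a (s a).

Definition expect (w : A -> J -> RR) (x : A -> J -> Q) (G : (A -> Q) -> RR) : RR :=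
  \sum_s weight w s * G (fun a => x a (s a)).

Definition updf (b : A -> Q) a q : A -> Q := fun a' => if a' == a then q else b a'.

Lemma weight_total w : (forall a, \sum_i w a i = 1) -> \sum_s weight w s = 1.
Proof.
move=> w1; rewrite /weight -(bigA_distr_bigA (fun a i => w a i)) big1 // => a _; exact: w1.
Qed.

Lemma weight_ge0 w s : (forall a i, 0 <= w a i) -> 0 <= weight w s.
Proof. by move=> w0; apply: prodr_ge0. Qed.

(* Replacing the law of one coordinate at a time. *)
Lemma expect_hybrid (Good : A -> Q -> Prop) w w' x x' G (eps : RR) : 0 <= eps ->
  (forall a i, 0 <= w a i) -> (forall a i, 0 <= w' a i) ->
  (forall a, \sum_i w a i = 1) -> (forall a, \sum_i w' a i = 1) ->
  (forall a i, Good a (x a i)) -> (forall a i, Good a (x' a i)) ->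
  (forall a b, (forall a', Good a' (b a')) ->
    `|\sum_i w' a i * G (updf b a (x' a i)) - \sum_i w a i * G (updf b a (x a i))| <= eps) ->
  `|expect w' x' G - expect w x G| <= #|A|%:R * eps.
Proof.
move=> e0 w0 w0' w1 w1' gx gx' hG.
(* Hybrid laws: the coordinates in [l] already follow the primed data. *)
pose W (l : seq A) a := if a \in l then w' a else w a.
pose Y (l : seq A) a := if a \in l then x' a else x a.
suff H l : uniq l -> `|expect (W l) (Y l) G - expect w x G| <= (size l)%:R * eps.
  have := H (enum A) (enum_uniq A); rewrite -cardE.
  have -> : W (enum A) = w' by apply/funext => a; rewrite /W mem_enum.
  by have -> : Y (enum A) = x' by apply/funext => a; rewrite /Y mem_enum.
elim: l => [_|a l IH /= /andP[al /IH h]].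
  by rewrite (_ : W [::] = w) // (_ : Y [::] = x) // subrr normr0 mul0r.
rewrite -add1n natrD mulrDl mul1r.
rewrite -[X in `|X|](subrKA (expect (W l) (Y l) G)).
apply: le_trans (ler_normD _ _) _; apply: lerD => //.
have W0 m b i : 0 <= W m b i by rewrite /W; case: ifP.
have W1 m b : \sum_i W m b i = 1 by rewrite /W; case: ifP.
pose R (s : {ffun A -> J}) := \prod_(b | b != a) W l b (s b).
have wE m s i : (forall b, b != a -> W m b = W l b) -> weight (W m) (upd s a i) = W m a i * R s.
  move=> hm; rewrite /weight (bigD1 a) //= ffunE eqxx; congr (_ * _); apply: eq_bigr => b ba.
  by rewrite ffunE (negbTE ba) hm.
have yE m (s : {ffun A -> J}) i : (forall b, b != a -> Y m b = Y l b) ->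
    (fun b => Y m b (upd s a i b)) = updf (fun b => Y l b (s b)) a (Y m a i).
  move=> hm; apply/funext => b; rewrite /updf ffunE; case: eqP => [->//|/eqP ba].
  by rewrite hm.
have eE m : (forall b, b != a -> W m b = W l b) -> (forall b, b != a -> Y m b = Y l b) ->
    expect (W m) (Y m) G = \sum_(s : {ffun A -> J} | s a == i0) R s *
      \sum_i W m a i * G (updf (fun b => Y l b (s b)) a (Y m a i)).
  move=> hW hY; rewrite /expect (sum_split a); apply: eq_bigr => s _; rewrite mulr_sumr.
  by apply: eq_bigr => i _; rewrite wE // yE // mulrA [_ * R s]mulrC.
rewrite !eE //; first last.
- by move=> b ba; rewrite /Y inE (negbTE ba).
- by move=> b ba; rewrite /W inE (negbTE ba).
rewrite -sumrB.
have R0 s : 0 <= R s by apply: prodr_ge0.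
have -> : eps = \sum_(s : {ffun A -> J} | s a == i0) R s * eps.
  rewrite -mulr_suml.
  have := weight_total (W1 l); rewrite (sum_split a).
  under eq_bigr do under eq_bigr do rewrite wE //.
  under eq_bigr do rewrite -mulr_suml W1 mul1r.
  by move=> ->; rewrite mul1r.
apply: le_trans (ler_norm_sum _ _ _) _; apply: ler_sum => s _.
rewrite -mulrBr normrM ger0_norm //; apply: ler_wpM2l => //.
have := hG a (fun b => Y l b (s b)).
have -> : W (a :: l) a = w' a by rewrite /W inE eqxx.
have -> : Y (a :: l) a = x' a by rewrite /Y inE eqxx.
have -> : W l a = w a by rewrite /W (negbTE al).
have -> : Y l a = x a by rewrite /Y (negbTE al).
by apply=> b; rewrite /Y; case: ifP.
Qed.
End OneType.

(** Coordinates outside the image of [j] sum to one; each fibre of the restriction map is a product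
    of conditions on single coordinates, so distributivity applies. *)
Lemma marginal (A B : finType) (j : B -> A) (w : A -> J -> RR) (g : {ffun B -> J} -> RR) :
  injective j -> (forall a, \sum_i w a i = 1) ->
  \sum_s weight w s * g [ffun b => s (j b)] = \sum_s weight (w \o j) s * g s.
Proof.
move=> jI w1.
rewrite (partition_big (fun s : {ffun A -> J} => [ffun b => s (j b)]) xpredT) //=.
apply: eq_bigr => s' _.
under eq_bigr => s /eqP -> do over.
rewrite -mulr_suml; congr (_ * _).
pose F a (i : J) := [forall b, (j b == a) ==> (i == s' b)].
rewrite (eq_bigl (fun s => s \in family F)); last first.
  move=> s; apply/eqP/familyP => [e a|h].
    by apply/forallP => b; apply/implyP => /eqP <-; rewrite -e ffunE.
  apply/ffunP => b; rewrite ffunE; have /forallP/(_ b) := h (j b).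
  by rewrite eqxx => /eqP.
rewrite /weight -(bigA_distr_big_dep (fun a i => F a i) (fun a i => w a i)).
rewrite (bigID (fun a => a \in codom j)) /= [X in _ * X]big1 ?mulr1; last first.
  move=> a na; rewrite -[RHS](w1 a); apply: eq_bigl => i; apply/forallP => b.
  by apply/implyP => /eqP e; move: na; rewrite -e codom_f.
have uj : uniq (codom j) by rewrite codomE map_inj_uniq // enum_uniq.
rewrite -(big_uniq _ uj) codomE big_map big_enum /=; apply: eq_bigr => b _.
rewrite (big_pred1 (s' b)) // => i; apply/forallP/eqP => [/(_ b)|-> b'].
  by rewrite eqxx => /eqP.
by apply/implyP => /eqP/jI ->.
Qed.
End Expectation.

(** * Random motions *)

Lemma supported_nth (T : Type) x0 (z : fchain T) (P : T -> Prop) :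
  (forall k, (k < size z)%N -> P (nth x0 z k).2) -> supported P z.
Proof.
elim: z => [//|x z IH] h /=; split; first exact: (h 0%N).
by apply: IH => k kz; exact: (h k.+1).
Qed.

Lemma supported_tnth (T : Type) (z : fchain T) :
  supported (fun t => exists k, (tnth (in_tuple z) k).2 = t) z.
Proof.
case: z => [//|x z]; apply: (@supported_nth _ x) => k kz.
by exists (Ordinal kz); rewrite (tnth_nth x).
Qed.

Section Stage.
Variables (X : topologicalType) (Col : Type) (U : Col -> set X) (p : nat).
Local Notation T := (csing X Col).
Local Notation P := (ppath X p).
Local Notation C := (@carr X Col U p).

Lemma actT_comp l k n (th : 'I_k.+1 -> 'I_n.+1) (et : 'I_l.+1 -> 'I_k.+1) (t : T n) :
  actT et (actT th t) = actT (th \o et) t.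
Proof. by rewrite /actT /= act_comp. Qed.

Lemma from_carr k (t : T k) th b : from C (actT th t) b ->
  [/\ spath p b, forall x, std_simplex p x -> b (x, 0) = sval t.1 (act_map th x)
    & allowed U (t.2 \o th) b].
Proof.
move=> [t1 [_ [hb he] ha]]; split=> // x sx.
by rewrite (he x sx).1 /= actE.
Qed.

(** All maps of vertices, a finite type whose elements can serve as the coordinates of a seed. *)
Definition Th k := {ffun 'I_p.+1 -> 'I_k.+1}.

Definition fam k (b : Th k -> P) (th : 'I_p.+1 -> 'I_k.+1) : P := b (finfun th).

Lemma ffunK k (th : 'I_p.+1 -> 'I_k.+1) : finfun th = th :> (_ -> _).
Proof. by apply/funext => i; rewrite ffunE. Qed.

Lemma fam_valid k (t : T k) (b : Th k -> P) :
  (forall th : Th k, from C (actT th t) (b th)) -> valid U t (fam b).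
Proof. by move=> hb th _; have := from_carr (hb (finfun th)); rewrite ffunK. Qed.

Lemma carr_trace k (t t' : T k) H (th : 'I_p.+1 -> 'I_k.+1) : t.2 = t'.2 ->
  is_path (std_simplex k) (skel p k) H ->
  (forall x, std_simplex k x -> H (x, 0) = sval t.1 x) ->
  (forall x, std_simplex k x -> H (x, 1) = sval t'.1 x) ->
  (forall th : 'I_p.+1 -> 'I_k.+1, injective th -> allowed U (t.2 \o th) (trace th H)) ->
  carr U (actT th t) (actT th t') (trace th H).
Proof.
move=> e hH H0 H1 Ha; split=> /=; first by rewrite e.
  split; first exact: trace_path.
  by move=> x sx; rewrite !actE // /trace /= H0 ?H1 //; exact: act_map_simplex.
move=> p0; apply: (Ha) (p0) => a b _; apply/val_inj.
by move: (ltn_ord a) (ltn_ord b) p0 => /=; lia.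
Qed.

Section Motion.
Variables (N : nat) (w : T p -> 'I_N.+1 -> RR) (x : T p -> 'I_N.+1 -> P).
Hypothesis w0 : forall o i, 0 <= w o i.
Hypothesis w1 : forall o, \sum_i w o i = 1.
Hypothesis hx : forall o i, from C o (x o i).

Definition seed k := {ffun Th k -> 'I_N.+1}.
Definition mkb k (t : T k) (s : seed k) (th : Th k) : P := x (actT th t) (s th).
Definition mk k (t : T k) (s : seed k) : mtn U p k :=
  exist (fun tb => valid U tb.1 tb.2) (t, fam (mkb t s)) (fam_valid (fun th => hx _ _)).
Definition wt k (t : T k) (th : Th k) := w (actT th t).
Definition psi k (t : T k) : fchain (mtn U p k) :=
  [seq (weight (wt t) s, mk t s) | s <- enum (seed k)].

Lemma pairing_psi k (t : T k) f : pairing f (psi t) = \sum_s weight (wt t) s * f (mk t s).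
Proof. by rewrite /pairing big_map big_enum. Qed.

Lemma wt_ge0 k (t : T k) s : 0 <= weight (wt t) s.
Proof. by apply: weight_ge0 => a i; exact: w0. Qed.

Lemma wt_total k (t : T k) : \sum_s weight (wt t) s = 1.
Proof. by apply: weight_total => a; exact: w1. Qed.

Lemma mass_psi k (t : T k) : mass (psi t) = 1.
Proof.
rewrite /mass big_map big_enum /= -[RHS](wt_total t); apply: eq_bigr => s _.
by rewrite ger0_norm // wt_ge0.
Qed.

(* Faces have independent seeds, so that the seed of a face is a marginal. *)
Lemma psi_face k i (t : T k.+1) f :
  pairing (f \o dM i) (psi t) = pairing f (psi (dT i t)).
Proof.
pose j (th : Th k) : Th k.+1 := finfun (lift i \o th).
have jI : injective j.
  move=> a b /ffunP e; apply/ffunP => c; have := e c; rewrite !ffunE /=; exact: lift_inj.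
have aE (th : Th k) : actT (j th) t = actT th (dT i t) by rewrite /j ffunK actT_comp.
rewrite !pairing_psi.
have -> : wt (dT i t) = wt t \o j by apply/funext => th /=; rewrite /wt aE.
rewrite -(marginal (fun s => f (mk (dT i t) s)) jI); last by move=> a; exact: w1.
apply: eq_bigr => s _; congr (_ * f _); apply: eq_exist => /=; congr (_, _).
apply/funext => th; rewrite /fam /mkb -aE ffunE.
have -> // : j (finfun th) = finfun (lift i \o th).
by apply/ffunP => c; rewrite !ffunE /= ffunE.
Qed.

Definition avg k (phi : T k -> RR) (t : T k) : RR := pairing (phi \o @hend _ _ U p k) (psi t).

Lemma avg_bound k phi (t : T k) : (forall t, `|phi t| <= 1) -> `|avg phi t| <= 1.
Proof.
move=> phi1; rewrite -(mass_psi t) -[mass _]mul1r.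
by apply: (pairing_bound (supportedT _)) => m _; exact: phi1.
Qed.

(** Dually, random pushing is a chain map: the end of a face is the face of the end, and its law is
    the marginal. *)
Lemma avg_cob k phi (t : T k.+1) : avg (cob (@dT _ _ k) phi) t = cob (@dT _ _ k) (avg phi) t.
Proof.
rewrite /avg /comp /cob pairing_sum; apply: eq_bigr => i _.
rewrite pairingZ -psi_face; congr (_ * _); apply: eq_pairingT => m /=.
by rewrite hend_face.
Qed.

Lemma avg_hrel0 k phi (t : T k) : (forall t t', hrel U 0 t t' -> phi t = phi t') ->
  avg phi t = phi t.
Proof.
move=> hphi; rewrite /avg pairing_psi -[RHS]mul1r -(wt_total t) mulr_suml.
apply: eq_bigr => s _ /=; congr (_ * _); apply/esym; apply: hphi.
exact: (hend_hrel0 (mk t s)).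
Qed.

(* Transporting the random motions of [t'] along [H] compares the two averages: the
   law of every coordinate changes by at most [eps]. *)
Lemma avg_close k (t t' : T k) H (eps : RR) phi : 0 <= eps -> t.2 = t'.2 ->
  is_path (std_simplex k) (skel p k) H ->
  (forall y, std_simplex k y -> H (y, 0) = sval t.1 y) ->
  (forall y, std_simplex k y -> H (y, 1) = sval t'.1 y) ->
  (forall th : 'I_p.+1 -> 'I_k.+1, injective th -> allowed U (t.2 \o th) (trace th H)) ->
  (forall (th : Th k) f, test (seqv p) (from C (actT th t)) f ->
     `|\sum_i w (actT th t') i * f (pcat (trace th H) (x (actT th t') i)) -
       \sum_i w (actT th t) i * f (x (actT th t) i)| <= eps) ->
  (forall t, `|phi t| <= 1) -> (forall t t', hrel U p.+1 t t' -> phi t = phi t') ->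
  `|avg phi t' - avg phi t| <= #|{: Th k}|%:R * eps.
Proof.
move=> e0 ec hH H0 H1 Ha amen phi1 phi_inv.
(* The test function in terms of the motions of the faces alone, with value 0 on families that are
   not valid. *)
pose G (b : Th k -> P) : RR := match pselect (valid U t (fam b)) with
  | left v => phi (hend (exist (fun tb => valid U tb.1 tb.2) (t, fam b) v))
  | right _ => 0 end.
have GE b (v : valid U t (fam b)) :
    G b = phi (hend (exist (fun tb => valid U tb.1 tb.2) (t, fam b) v)).
  rewrite /G; case: pselect => // v'; congr (phi (hend _)); exact: eq_exist.
have G1 b : `|G b| <= 1 by rewrite /G; case: pselect => // _; rewrite normr0.
have hc (th : 'I_p.+1 -> 'I_k.+1) : carr U (actT th t) (actT th t') (trace th H) by exact: carr_trace.
have E1 : avg phi t = expect (wt t) (fun th i => x (actT th t) i) G.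
  rewrite /avg pairing_psi; apply: eq_bigr => s _ /=; congr (_ * _).
  by rewrite (GE (mkb t s) (fam_valid (fun th => hx _ _))).
have hpc (th : Th k) i : from C (actT th t) (pcat (trace th H) (x (actT th t') i)).
  have [t1 ho] := hx (actT th t') i; exists t1; exact: carr_cat (hc th) ho.
have E2 : avg phi t' =
    expect (wt t') (fun th i => pcat (trace th H) (x (actT th t') i)) G.
  rewrite /avg pairing_psi; apply: eq_bigr => s _ /=; congr (_ * _).
  have v : valid U t (fam (fun th => pcat (trace th H) (x (actT th t') (s th)))).
    by apply: fam_valid => th; exact: hpc.
  rewrite (GE _ v); apply/esym; apply: phi_inv.
  (* Preceding the motions of [t'] by [H] changes the end only within its R_(p+1)-class. *)
  apply: (@hend_hrel _ _ _ _ _ _ (mk t' s) H) => //; split=> //= th thI.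
  rewrite /fam /mkb !ffunK; apply: path_eqv_refl.
  by have := from_carr (hpc (finfun th) (s (finfun th))); rewrite ffunK => -[].
rewrite E1 E2; apply: (@expect_hybrid 'I_N.+1 ord0 (Th k) P (fun th => from C (actT th t)) (wt t) (wt t')
  (fun th i => x (actT th t) i) (fun th i => pcat (trace th H) (x (actT th t') i)) G eps) => //.
- by move=> th i; exact: w0.
- by move=> th i; exact: w0.
- by move=> th; exact: w1.
- by move=> th; exact: w1.
move=> th b hb; apply: (amen th (fun c => G (updf b th c))); split=> // c e hcc he ce.
have v d : from C (actT th t) d -> valid U t (fam (updf b th d)).
  move=> hd; apply: fam_valid => th'; rewrite /updf; case: eqP => [->//|_]; exact: hb.
rewrite (GE _ (v c hcc)) (GE _ (v e he)); apply: phi_inv.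
(* Two families that differ by a homotopy on one face are linked by the constant path. *)
apply: (@hend_hrel _ _ _ _ _ _ _ (pcst (sval t.1))) => //; split=> //=.
  by apply: pcst_path; exact: sing_cton.
move=> th' th'I.
have hd d : from C (actT th' t) d -> seqv p (pcat (trace th' (pcst (sval t.1))) d) d.
  move=> /from_carr[hd hd0 _].
  apply: (@path_eqv_cst_l _ _ _ _ d (fun y => sval t.1 (act_map th' y)) hd) => y sy.
  exact: hd0.
rewrite /fam /updf; case: eqP => [E|_]; last by apply: hd; have := hb (finfun th'); rewrite ffunK.
have eth : (th : _ -> _) = th' by rewrite -E ffunK.
apply: path_eqv_trans (path_eqv_sym ce); apply: hd; by rewrite -eth.
Qed.
End Motion.

Definition hrep k (t : T k) : T k := match pselect (exists t', hrel U p t t') with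
  | left h => projT1 (cid h) | right _ => t end.

Lemma hrep_rel k (t : T k) : hrel U p t (hrep t).
Proof.
rewrite /hrep; case: pselect => [h|[]]; first exact: projT2 (cid h).
by exists t; exact: hrel_refl.
Qed.

(** The representative is chosen from the class as a predicate, and R_p-related simplices have the
    same class. *)
Lemma hrep_eq k (t t' : T k) : hrel U p t t' -> hrep t = hrep t'.
Proof.
move=> h; have E : hrel U p t = hrel U p t'.
  apply/predeqP => a; split=> ha; last exact: hrel_trans h ha.
  exact: hrel_trans (hrel_sym h) ha.
rewrite /hrep E; case: pselect => // -[]; exists t'; exact: hrel_refl.
Qed.

Hypothesis U_amenable : forall i, amenable_in (U i).

(** The step from R_p to R_(p+1). The laws are chosen after [z], which allows any error [eps];
    values on R_0-invariant functions are preserved so that a further round can begin. *)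
Theorem stage n (z : fchain (T n.+1)) (eta eps : RR) : 0 < eps ->
  (forall phi, pairing (cob (@dT _ _ n) phi) z = 0) ->
  (forall phi, (forall t, `|phi t| <= 1) ->
     (forall t t', hrel U p t t' -> phi t = phi t') -> `|pairing phi z| <= eta) ->
  exists (z' : fchain (T n.+1)) (b : fchain (sing X n.+2)),
  [/\ forall phi, pairing (cob (@dT _ _ n) phi) z' = 0,
      forall phi, (forall t, `|phi t| <= 1) ->
        (forall t t', hrel U p.+1 t t' -> phi t = phi t') -> `|pairing phi z'| <= eta + eps,
      forall phi, (forall t t', hrel U 0 t t' -> phi t = phi t') -> pairing phi z' = pairing phi z,
      mass z' <= mass z /\ mass b <= prism_mass n.+1 * mass z &
      forall phi, pairing (cob (@dS X n.+1) phi) b =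
        pairing (phi \o fst) z' - pairing (phi \o fst) z].
Proof.
move=> e0 z_cycle z_small.
have /choice[H hH] (t : T n.+1) : exists H, [/\ is_path (std_simplex n.+1) (skel p n.+1) H,
    forall y, std_simplex n.+1 y -> H (y, 0) = sval (hrep t).1 y,
    forall y, std_simplex n.+1 y -> H (y, 1) = sval t.1 y &
    forall th : 'I_p.+1 -> 'I_n.+2, injective th -> allowed U ((hrep t).2 \o th) (trace th H)].
  by have [_] := hrel_sym (hrep_rel t).
have ec (t : T n.+1) : (hrep t).2 = t.2 by have [] := hrel_sym (hrep_rel t).
(* One arrow for each term of [z] and each face, from the face of the representative to that of the
   simplex. *)
pose K := ('I_(size z) * Th n.+1)%type.
pose tk (k : 'I_#|{: K}|) := (tnth (in_tuple z) (enum_val k).1).2.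
pose thk (k : 'I_#|{: K}|) : Th n.+1 := (enum_val k).2.
(* The number of faces and the mass of [z] multiply the error; adding one keeps the divisor
   positive. *)
pose M : RR := #|{: Th n.+1}|%:R * mass z + 1.
have M0 : 0 < M by apply: ltr_wpDl => //; apply: mulr_ge0 => //; exact: mass_ge0.
pose eps0 := eps / M.
have e00 : 0 < eps0 by exact: divr_gt0.
have hcarr k : carr U (actT (thk k) (hrep (tk k))) (actT (thk k) (tk k)) (trace (thk k) (H (tk k))).
  by have [h1 h2 h3 h4] := hH (tk k); exact: carr_trace.
have [N [w [x [w0 w1 hx amen]]]] := stage_amenable U_amenable hcarr e00.
pose A := avg w hx; pose Psi := psi w hx.
pose z' := bind z (fun t => map_chain (@hend _ _ U p n.+1) (Psi n.+1 t)).
have pz' phi : pairing phi z' = pairing (A n.+1 phi) z.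
  by rewrite /z' pairing_bind; apply: eq_pairingT => t; rewrite pairing_map.
exists z', (bind z (fun t => bind (Psi n.+1 t) (@prism _ _ U p n.+1))); split.
- move=> phi; rewrite pz' -[RHS](z_cycle (A n phi)).
  by apply: eq_pairingT => t; exact: avg_cob.
- move=> phi phi1 phi_inv; rewrite pz'.
  (* Composed with [hrep] the average is R_p-invariant and bounded by one, so the hypothesis on [z]
     applies; the remainder compares each simplex of [z] with its representative. *)
  have -> : pairing (A n.+1 phi) z = pairing (fun t => A n.+1 phi (hrep t)) z +
      pairing (fun t => A n.+1 phi t - A n.+1 phi (hrep t)) z.
    by rewrite pairingB addrC subrK.
  apply: le_trans (ler_normD _ _) _; apply: lerD.
    apply: z_small => [t|t t' tt']; first by apply: avg_bound => //.
    by rewrite (hrep_eq tt').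
  have close t : (exists k, (tnth (in_tuple z) k).2 = t) ->
      `|A n.+1 phi t - A n.+1 phi (hrep t)| <= #|{: Th n.+1}|%:R * eps0.
    move=> [k kt]; have [h1 h2 h3 h4] := hH t.
    apply: (avg_close w0 w1 hx (ltW e00) (ec t) h1 h2 h3 h4) => // th f tf.
    pose q : 'I_#|{: K}| := enum_rank (k, th).
    have := amen q f; rewrite /tk /thk enum_rankK /= kt; exact.
  apply: le_trans (pairing_bound (supported_tnth z) close) _.
  rewrite mulrAC /eps0 mulrA ler_pdivrMr // [X in _ <= X]mulrC ler_wpM2r ?(ltW e0) //.
  by rewrite /M lerDl.
- by move=> phi phi_inv; rewrite pz'; apply: eq_pairingT => t; exact: avg_hrel0.
- split.
    rewrite -[X in _ <= X]mul1r; apply: mass_bind => t; by rewrite mass_map mass_psi.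
  apply: mass_bind => t; rewrite -[X in _ <= X]mulr1 -(mass_psi w0 w1 hx t).
  by apply: mass_bind => m; rewrite mass_prism.
move=> phi; rewrite pz' pairing_bind.
(* The prisms over the faces contribute the coboundary of [Q], which vanishes on the cycle. *)
pose Q (t : T n) := pairing (fun m => pairing phi (@prism _ _ U p n m)) (Psi n t).
have QE (t : T n.+1) : pairing (cob (@dS X n.+1) phi) (bind (Psi n.+1 t) (@prism _ _ U p n.+1)) =
    A n.+1 (phi \o fst) t - (phi \o fst) t - cob (@dT _ _ n) Q t.
  rewrite pairing_bind.
  rewrite (eq_pairingT _ (fun m => prism_cob m phi)) !pairingB; congr (_ - _ - _).
    rewrite /Psi pairing_psi /= -[RHS]mul1r -(wt_total w1 t) mulr_suml.
    by apply: eq_bigr.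
  rewrite pairing_sum; apply: eq_bigr => i _; rewrite pairingZ; congr (_ * _).
  by rewrite /Q /Psi -psi_face.
by rewrite (eq_pairingT _ QE) !pairingB z_cycle subr0.
Qed.
End Stage.

(** * Coloured subdivision *)

Section AltSubdivision.
Variables (X : topologicalType) (Col : Type) (col : forall n, sing X n -> Col).

(** Subdivision takes place at height 0 of the prism models, so that the same homotopy construction
    serves both. *)
Definition bpt n : pt n := (bary n, 0).

Lemma bpt_cyl n : cyl1 n (bpt n).
Proof. by split; [exact: bary_simplex|exact: unit_interval0]. Qed.

Definition csd n (s : sing X n) : fchain ('I_n.+1 -> pt n * Col) :=
  sdiv ppush bpt (@dS X) col s.

(** Colours depend on the singular simplex, not on the model alone; the homotopy is therefore built
    from this universal subdivision with a single colour. *)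
Definition sd0 n : fchain ('I_n.+1 -> pt n * unit) :=
  @sdiv pt ppush bpt (fun _ => unit) (fun _ _ _ => tt) unit (fun _ _ => tt) n tt.

Definition forget n k (C : Type) (p : 'I_k.+1 -> pt n * C) : 'I_k.+1 -> pt n := fun a => (p a).1.

Lemma csd_forget n (s : sing X n) f :
  pairing (fun p => f (forget p)) (csd s) = pairing (fun p => f (forget p)) (sd0 n).
Proof.
rewrite /csd /sd0; elim: n s f => [|n IH] s f /=; first by rewrite !pairing_cons !pairing_nil.
rewrite !pairing_map !pairing_signed_sum; apply: eq_bigr => i _; congr (_ * _).
rewrite !pairing_map.
have E (C : Type) (c : C) (p : 'I_n.+1 -> pt n * C) :
    forget (tcons (bpt n.+1, c) (cpush ppush i p)) =
    tcons (bpt n.+1) (tpush ppush i (forget p)).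
  by apply/funext => a; rewrite /forget /tcons; case: unliftP.
rewrite -[LHS](_ : pairing (fun p => f (tcons (bpt n.+1) (tpush ppush i (forget p)))) (csd (dS i s)) = _);
  last by apply: eq_pairingT => p /=; rewrite E.
rewrite -[RHS](_ : pairing (fun p => f (tcons (bpt n.+1) (tpush ppush i (forget p)))) (sd0 n) = _);
  last by apply: eq_pairingT => p /=; rewrite E.
exact: (IH _ (fun q => f (tcons (bpt n.+1) (tpush ppush i q)))).
Qed.

(** Alternated subdivision minus the identity, the natural chain map to be contracted. *)
Definition sd_hom n : fchain ('I_n.+1 -> pt n) :=
  map_chain (@forget n n unit) (bind (sd0 n) (@alt _ n)) ++ [:: (-1, fun i => (basis i, 0))].

Definition pmap n (s : sing X n) (x : pt n) : X := sval s x.1.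

Definition cgeo k n (s : sing X n) (p : 'I_k.+1 -> pt n * Col) : csing X Col k :=
  (geo (pmap s) (forget p), fun a => (p a).2).

Definition asd n (s : sing X n) : fchain (csing X Col n) :=
  map_chain (cgeo s) (bind (csd s) (@alt _ n)).

Lemma pmap_cton n (s : sing X n) : cton (cyl1 n) (pmap s).
Proof.
apply: (cton_comp (g := fst) (sing_cton s)) => //; first by continuity.
by move=> x [].
Qed.

Lemma pmap_face n i (s : sing X n.+1) x : cyl1 n x -> pmap (dS i s) x = pmap s (ppush i x).
Proof. by move=> [sx _]; rewrite /pmap dSE. Qed.

Lemma pairing_alt_map (E E' : Type) k (g : E -> E') (p : 'I_k.+1 -> E) f :
  pairing f (alt (fun a => g (p a))) = pairing (fun q => f (fun a => g (q a))) (alt p).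
Proof. by rewrite !pairing_alt. Qed.

Lemma dS_dS n (t : sing X n.+2) (i j : 'I_n.+3) (k l : 'I_n.+2) :
  (forall m, lift i (lift k m) = lift j (lift l m)) -> dS k (dS i t) = dS l (dS j t).
Proof.
move=> e; rewrite /dS !act_comp; congr (act _ t).
by apply/funext => a /=; rewrite e.
Qed.

Definition ctuple_cyl k n (C : Type) (p : 'I_k.+1 -> pt n * C) := forall a, cyl1 n (p a).1.

Lemma csd_cyl n (s : sing X n) : supported (@ctuple_cyl n n Col) (csd s).
Proof. exact: (sdiv_good (good := fun n => cyl1 n) bpt_cyl ppush_cyl). Qed.

Lemma sd0_cyl n : supported (@ctuple_cyl n n unit) (sd0 n).
Proof. exact: (sdiv_good (good := fun n => cyl1 n) bpt_cyl ppush_cyl). Qed.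

Lemma alt_cyl k n (C : Type) (p : 'I_k.+1 -> pt n * C) : ctuple_cyl p ->
  supported (@ctuple_cyl k n C) (alt p).
Proof. by move=> hp; rewrite /alt; elim: (enum _) => [//|s r IH] /=; split=> // a; exact: hp. Qed.

Lemma sd_hom_cyl n : supported (fun p => forall a, cyl1 n (p a)) (sd_hom n).
Proof.
apply: supported_cat.
  apply/supported_map; apply: (supported_bind (sd0_cyl n)) => p hp; exact: alt_cyl.
split=> // a; split; [exact: basis_simplex|exact: unit_interval0].
Qed.

Lemma sd_hom_aug : pairing (fun _ => 1) (sd_hom 0) = 0.
Proof.
rewrite /sd_hom pairing_cat pairing_map pairing_bind /= !pairing_cons !pairing_nil !addr0.
rewrite mul1r mulr1 pairing_alt.
under eq_bigr do rewrite /= mulr1.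
rewrite (eq_bigr (fun _ => 1)) ?sumr_const ?card_Sn ?fact_gt0; last first.
  move=> s _; have -> : s = 1%g by apply/permP => a; rewrite ord1 [RHS]ord1.
  by rewrite odd_perm1.
by rewrite (_ : 1`! = 1%N) // invr1 mul1r /= subrr.
Qed.

Lemma sd_hom_chain n f : pairing (cob (@tface _ n) f) (sd_hom n.+1) =
  \sum_(i < n.+2) (-1) ^+ i * pairing (f \o tpush ppush i) (sd_hom n).
Proof.
rewrite /sd_hom pairing_cat.
under [RHS]eq_bigr do rewrite pairing_cat mulrDr.
rewrite big_split /=; congr (_ + _).
  rewrite pairing_map pairing_bind.
  rewrite (eq_pairingT _ (_ : _ =1 cob (@tface _ n) (fun p => pairing (fun q => f (forget q)) (alt p)))).
    rewrite /sd0 (sdiv_cob ppush_ppush) //; apply: eq_bigr => i _; congr (_ * _).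
    rewrite pairing_map pairing_bind; apply: eq_pairingT => p /=.
    exact: (@pairing_alt_map _ _ _ (fun x : pt n * unit => (ppush i x.1, x.2)) p).
  by move=> p; rewrite -alt_cob; apply: eq_pairingT.
rewrite pairing_cons pairing_nil addr0 mulr_sumr; apply: eq_bigr => i _.
rewrite pairing_cons pairing_nil addr0 /= mulrCA; congr (_ * (_ * f _)).
by apply/funext => j; rewrite /tface /tpush /ppush /= face_inclE act_map_basis.
Qed.

Lemma act_cgeo n i (s : sing X n.+1) (p : 'I_n.+2 -> pt n.+1 * Col) : ctuple_cyl p ->
  dT i (cgeo s p) = cgeo s (tface i p).
Proof.
move=> hp; rewrite /dT /actT /cgeo /=; congr (_, _).
rewrite act_geo //; exact: pmap_cton.
Qed.

Lemma cgeo_push k n i (s : sing X n.+1) (p : 'I_k.+1 -> pt n * Col) : ctuple_cyl p ->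
  cgeo s (cpush ppush i p) = cgeo (dS i s) p.
Proof.
move=> hp; rewrite /cgeo; congr (_, _).
by rewrite -(geo_push pmap_cton pmap_face).
Qed.

Lemma asd_cob n (s : sing X n.+1) f : pairing (cob (@dT X Col n) f) (asd s) =
  \sum_(i < n.+2) (-1) ^+ i * pairing f (asd (dS i s)).
Proof.
rewrite pairing_map pairing_bind.
rewrite (@eq_pairing _ _ _ (cob (@tface _ n) (fun p => pairing (f \o cgeo s) (alt p))) _ (csd_cyl s)).
  rewrite /csd (sdiv_cob ppush_ppush bpt dS_dS); apply: eq_bigr => i _; congr (_ * _).
  rewrite pairing_map pairing_bind; apply: (eq_pairing (csd_cyl _)) => p hp /=.
  rewrite [LHS](@pairing_alt_map _ _ _ (fun x : pt n * Col => (ppush i x.1, x.2)) p).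
  apply: (eq_pairing (alt_cyl hp)) => q hq /=; by rewrite -cgeo_push.
move=> p hp; rewrite -alt_cob; apply: (eq_pairing (alt_cyl hp)) => q hq /=.
by apply: eq_bigr => i _; rewrite act_cgeo.
Qed.

Lemma asd_cycle n (z : fchain (sing X n.+1)) :
  (forall phi, pairing (cob (@dS X n) phi) z = 0) ->
  forall phi, pairing (cob (@dT X Col n) phi) (bind z (@asd n.+1)) = 0.
Proof.
move=> hz phi; rewrite pairing_bind -[RHS](hz (fun s => pairing phi (asd s))).
by apply: eq_pairingT => s; rewrite asd_cob.
Qed.

Lemma asd_homologous n (z : fchain (sing X n.+1)) :
  (forall phi, pairing (cob (@dS X n) phi) z = 0) ->
  exists b : fchain (sing X n.+2), forall phi, pairing (cob (@dS X n.+1) phi) b =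
    pairing (phi \o fst) (bind z (@asd n.+1)) - pairing phi z.
Proof.
move=> hz; pose h n := @hgeo X (sing X) pmap (fun n => (vertex0 n, 0)) sd_hom n.
exists (bind z (@h n.+1)) => phi; rewrite !pairing_bind.
have E (s : sing X n.+1) : pairing (cob (@dS X n.+1) phi) (h n.+1 s) =
    pairing (phi \o fst) (asd s) - phi s - cob (@dS X n) (fun s => pairing phi (h n s)) s.
  rewrite /h (hgeo_cob pmap_cton pmap_face _ sd_hom_chain sd_hom_aug sd_hom_cyl); last first.
    by move=> k; split; [exact: vertex0_simplex|exact: unit_interval0].
  congr (_ - _); rewrite /sd_hom pairing_cat; congr (_ + _).
    rewrite !pairing_map !pairing_bind.
    rewrite [RHS](eq_pairingT _ (_ : _ =1 fun p => pairing (phi \o geo (pmap s)) (alt (forget p)))).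
      rewrite (csd_forget s (fun q => pairing (phi \o geo (pmap s)) (alt q))).
      by apply: eq_pairingT => p; rewrite [RHS]pairing_alt_map.
    by move=> p; rewrite [RHS]pairing_alt_map.
  rewrite pairing_cons pairing_nil addr0 mulN1r /=; congr (- phi _); apply: sing_ext => y sy.
  rewrite geoE //; first by rewrite /pmap /aff2 /= aff_id.
    exact: pmap_cton.
  by move=> a; split; [exact: basis_simplex|exact: unit_interval0].
by rewrite (eq_pairingT _ E) !pairingB hz subr0.
Qed.
End AltSubdivision.

Lemma supported_and (T : Type) (P Q : T -> Prop) (z : fchain T) :
  supported P z -> supported Q z -> supported (fun x => P x /\ Q x) z.
Proof. by elim: z => [//|x z IH] /= [Px Pz] [Qx Qz]; split=> //; exact: IH. Qed.

Lemma supported_eventually (T : Type) (P : nat -> T -> Prop) (z : fchain T) :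
  (forall x, exists m, forall m', (m <= m')%N -> P m' x) -> exists m, supported (P m) z.
Proof.
move=> h; suff [m hm] : exists m, forall m', (m <= m')%N -> supported (P m') z.
  by exists m; exact: hm.
elim: z => [|x z [m hm]]; first by exists 0%N.
have [m2 hm2] := h x.2; exists (maxn m m2) => m'; rewrite geq_max => /andP[m1' m2'] /=.
by split; [exact: hm2|exact: hm].
Qed.

(** * Lebesgue numbers and the mesh of subdivisions *)

Lemma std_simplex_closed n : closed (std_simplex n).
Proof.
have -> : std_simplex n = (\bigcap_(i in [set: 'I_n.+1]) [set t : 'rV[RR]_n.+1 | 0 <= t ord0 i]) `&`
    [set t | \sum_(i < n.+1) t ord0 i = 1].
  apply/seteqP; split=> t [h1 h2]; split=> // i; first by move=> _; exact: h1.
  exact: (h1 i I).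
apply: closedI.
  by apply: closed_bigI => i _; apply: closed_ge_fun; continuity.
apply: closed_eq_fun.
apply: (@cts_sum _ RR^o) => i.
exact: (cts_coord i (@cts_id _)).
Qed.

Lemma std_simplex_compact n : compact (std_simplex n).
Proof.
apply: (@subclosed_compact _ _ [set v : 'rV[RR]_n.+1 | forall i, `[(0 : RR), 1]%classic (v ord0 i)]).
- exact: std_simplex_closed.
- exact: (@rV_compact RR n.+1 (fun _ => `[(0 : RR), 1]%classic) (fun _ => @segment_compact RR 0 1)).
move=> t st i /=; rewrite in_itv /= st.1 /=; exact: simplex_coord_le1.
Qed.

Section Lebesgue.
Variables (X : topologicalType) (Col : Type) (U : Col -> set X).
Hypothesis U_open : forall i, open (U i).
Hypothesis U_cover : forall x, exists i, U i x.

Lemma lebesgue_number n (s : sing X n) : exists2 delta : RR, 0 < delta &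
  forall x, std_simplex n x -> exists i, forall y, std_simplex n y ->
    (forall j, `|y ord0 j - x ord0 j| <= delta) -> U i (sval s y).
Proof.
have [cs] := sing_cton s.
pose P (d : RR) (x : 'rV[RR]_n.+1) := exists i, forall y, std_simplex n y ->
    (forall j, `|y ord0 j - x ord0 j| <= d) -> U i (sval s y).
have covered (x : 'rV[RR]_n.+1) : std_simplex n x -> \forall x' \near x & d \near (0 : RR)^'+, P d x'.
  move=> sx; have [i Ui] := U_cover (sval s x).
  have : \forall y \near nbhs x, std_simplex n y -> U i (sval s y).
    have /subspace_continuousP/(_ x sx (U i)) := cs; apply.
    exact: open_nbhs_nbhs.
  move=> /nbhs_ballP[e /= e0 he].
  (* Half the radius is for moving the centre and half for the distance [d]; compactness then gives
     one [d] for all centres. *)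
  have e2 : 0 < e / 2 by lra.
  exists (ball x (e / 2), [set d | d < e / 2]).
    by split=> /=; [exact: nbhsx_ballx|exact: nbhs_right_lt].
  move=> [x' d] [/= bx' de]; exists i => y sy hy; apply: he => //; split=> // a j.
  rewrite (ord1 a); have := bx'.2 ord0 j; rewrite /ball /= => h1; have h2 := hy j.
  have := ler_distD (x' ord0 j) (x ord0 j) (y ord0 j); rewrite [`|x' _ _ - y _ _|]distrC.
  lra.
have h := (compact_near_coveringP (std_simplex n)).1 (@std_simplex_compact n) RR (0 : RR)^'+ P
  (at_right_proper_filter 0) covered.
have [d [hd d0]] := @filter_ex _ _ (at_right_proper_filter 0) _ (filterI h (nbhs_right_gt 0)).
by exists d.
Qed.
End Lebesgue.

Lemma sum_face_incl n (i : 'I_n.+2) (y : 'rV[RR]_n.+1) (r : 'I_n.+2 -> RR) :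
  \sum_j face_incl i y ord0 j * r j = \sum_j y ord0 j * r (lift i j).
Proof.
rewrite (bigD1_ord i) //= face_incl_coord mul0r add0r; apply: eq_bigr => j _.
by rewrite face_inclE act_map_inj //; exact: lift_inj.
Qed.

(** The barycentre minus vertex [i] is an average of [n.+1] differences, one of which is zero; hence
    the factor. *)
Lemma bary_close n (r : 'I_n.+1 -> RR) (del : RR) (y : 'rV[RR]_n.+1) :
  (forall i j, `|r i - r j| <= del) -> std_simplex n y ->
  `|\sum_i bary n ord0 i * r i - \sum_i y ord0 i * r i| <= n%:R / n.+1%:R * del.
Proof.
move=> hr [y0 y1].
have n0 : n.+1%:R != 0 :> RR by rewrite pnatr_eq0.
have hi i : `|\sum_j bary n ord0 j * r j - r i| <= n%:R / n.+1%:R * del.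
  have -> : \sum_j bary n ord0 j * r j - r i = n.+1%:R^-1 * \sum_j (r j - r i).
    rewrite sumrB sumr_const card_ord mulrBr -[r i *+ _]mulr_natl mulKf // mulr_sumr.
    by congr (_ - _); apply: eq_bigr => j _; rewrite mxE.
  rewrite normrM ger0_norm ?invr_ge0 // mulrAC [leRHS]mulrC; apply: ler_wpM2l => //.
  rewrite (bigD1_ord i) //= subrr add0r; apply: le_trans (ler_norm_sum _ _ _) _.
  apply: le_trans (ler_sum _ (fun j _ => hr _ _)) _.
  by rewrite sumr_const card_ord mulr_natl.
have -> : \sum_i bary n ord0 i * r i - \sum_i y ord0 i * r i =
    \sum_i y ord0 i * (\sum_j bary n ord0 j * r j - r i).
  under [RHS]eq_bigr do rewrite mulrBr.
  by rewrite sumrB -mulr_suml y1 mul1r.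
apply: le_trans (ler_norm_sum _ _ _) _.
have -> : n%:R / n.+1%:R * del = \sum_i y ord0 i * (n%:R / n.+1%:R * del).
  by rewrite -mulr_suml y1 mul1r.
apply: ler_sum => i _.
by rewrite normrM ger0_norm //; apply: ler_wpM2l.
Qed.

Section CsdProperties.
Variables (X : topologicalType) (Col : Type) (col : forall n, sing X n -> Col).

(** The diameter bound, expressed through linear functionals with vertex values [r]. In this form it
    applies to each coordinate of an affine simplex, and so can be iterated. *)
Definition contracting n (p : 'I_n.+1 -> pt n * Col) : Prop :=
  forall (r : 'I_n.+1 -> RR) (del : RR), (forall i j, `|r i - r j| <= del) -> forall a b,
  `|\sum_i (p a).1.1 ord0 i * r i - \sum_i (p b).1.1 ord0 i * r i| <= n%:R / n.+1%:R * del.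

Lemma csd_ind (Q : forall n, sing X n -> ('I_n.+1 -> pt n * Col) -> Prop) :
  (forall s, Q 0%N s (fun _ => (bpt 0, col s))) ->
  (forall n (s : sing X n.+1) i p, ctuple_cyl p -> Q n (dS i s) p ->
     Q n.+1 s (tcons (bpt n.+1, col s) (cpush ppush i p))) ->
  forall n (s : sing X n), supported (Q n s) (csd col s).
Proof.
move=> h0 hS; elim=> [|n IH] s; first by split.
apply/supported_map; apply: supported_signed_sum => i; apply/supported_map.
by apply: eq_supported (supported_and (csd_cyl col (dS i s)) (IH (dS i s))) => p []; exact: hS.
Qed.

Lemma csd_contracting n (s : sing X n) : supported (@contracting n) (csd col s).
Proof.
apply: (csd_ind (Q := fun n _ => @contracting n)) => {n s} [s r del hr a b|n s i p hp IH r del hr].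
  by rewrite subrr normr0 mul0r mul0r.
have del0 : 0 <= del by apply: le_trans (hr ord0 ord0).
have n1 : (0 : RR) < n.+1%:R by rewrite ltr0n.
have n2 : (0 : RR) < n.+2%:R by rewrite ltr0n.
have sp a : std_simplex n.+1 (tcons (bpt n.+1, col s) (cpush ppush i p) a).1.1.
  rewrite /tcons; case: unliftP => [j _|_]; last exact: bary_simplex.
  by apply: face_incl_simplex; exact: (hp j).1.
have h0 a : `|\sum_j bary n.+1 ord0 j * r j -
    \sum_j (tcons (bpt n.+1, col s) (cpush ppush i p) a).1.1 ord0 j * r j| <= n.+1%:R / n.+2%:R * del.
  exact: bary_close.
move=> a b; case: (unliftP ord0 a) => [a' ea|ea]; last first.
  by have := h0 b; rewrite ea {2}/tcons unlift_none.
case: (unliftP ord0 b) => [b' eb|eb]; last first.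
  by have := h0 a; rewrite eb distrC {3}/tcons unlift_none.
rewrite ea eb /tcons !liftK /= !sum_face_incl.
apply: le_trans (IH (r \o lift i) del _ a' b') _; first by move=> *; exact: hr.
(* The factor n/(n+1) increases with [n]. *)
apply: ler_wpM2r => //; rewrite ler_pdivrMr // mulrAC ler_pdivlMr // -!natrM ler_nat; lia.
Qed.

Variable U : Col -> set X.
Definition small n (s : sing X n) : Prop := exists i, forall x, std_simplex n x -> U i (sval s x).
Hypothesis col_ok : forall n (s : sing X n), small s -> forall x, std_simplex n x -> U (col s) (sval s x).

(* The condition on [y] confines it to the simplex spanned by the entries from [a] on. *)
Definition coloured n (s : sing X n) (p : 'I_n.+1 -> pt n * Col) : Prop :=
  small s -> forall (a : 'I_n.+1) y, std_simplex n y -> (forall b : 'I_n.+1, (b < a)%N -> y ord0 b = 0) ->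
    U (p a).2 (sval s (aff (fun b => (p b).1.1) y)).

Lemma small_face n i (s : sing X n.+1) : small s -> small (dS i s).
Proof.
move=> [c hc]; exists c => x sx; rewrite dSE //; apply: hc; exact: face_incl_simplex.
Qed.

(** Entry [a] carries the colour of the face whose barycentre it is, the entries from [a] on lie in
    that face, and faces of small simplices are small. *)
Lemma csd_coloured n (s : sing X n) : supported (coloured s) (csd col s).
Proof.
apply: (csd_ind (Q := coloured)) => {n s} [s ss a y sy _|n s i p hp IH ss a y sy hy].
  by apply: col_ok => //; apply: aff_simplex => // b; exact: bary_simplex.
have sp b : std_simplex n.+1 (tcons (bpt n.+1, col s) (cpush ppush i p) b).1.1.
  rewrite /tcons; case: unliftP => [j _|_]; last exact: bary_simplex.
  by apply: face_incl_simplex; exact: (hp j).1.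
case: (unliftP ord0 a) => [a' ea|ea]; last first.
  rewrite ea {1}/tcons unlift_none; apply: col_ok => //; exact: aff_simplex.
have y0 : y ord0 ord0 = 0 by apply: hy; rewrite ea.
have sy' := del_coord_simplex sy y0.
rewrite {1}ea {1}/tcons liftK /=.
have -> : aff (fun b => (tcons (bpt n.+1, col s) (cpush ppush i p) b).1.1) y =
    face_incl i (aff (fun b => (p b).1.1) (del_coord ord0 y)).
  rewrite -{1}(del_coordK y0) face_inclE aff_act face_inclE /act_map aff_comp.
  congr (aff _ _); apply/funext => b /=; rewrite /tcons liftK /= face_inclE //.
rewrite -dSE; last by apply: aff_simplex => // b; exact: (hp b).1.
apply: IH => //; first exact: small_face.
by move=> b ba; rewrite mxE; apply: hy; rewrite ea /= /bump /=; lia.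
Qed.
End CsdProperties.

Lemma pairing0 (T : Type) (z : fchain T) : pairing (fun _ => 0) z = 0.
Proof. by rewrite /pairing big1 // => x _; rewrite mulr0. Qed.

Lemma aff2_comp l k n (q : 'I_k.+1 -> pt n) (r : 'I_l.+1 -> 'rV[RR]_k.+1) y :
  aff2 q (aff r y) = aff2 (fun a => aff2 q (r a)) y.
Proof.
congr (_, _); first exact: aff_comp.
exact: (@aff_comp RR^o _ _ (fun i => (q i).2) r y).
Qed.

(** * The initial coloured cycle *)

Section Initial.
Variables (X : topologicalType) (Col : Type) (U : Col -> set X) (i0 : Col).
Hypothesis U_open : forall i, open (U i).
Hypothesis U_cover : forall x, exists i, U i x.

Definition some_colour n (s : sing X n) : Col := match pselect (small U s) with
  | left h => projT1 (cid h) | right _ => i0 end.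

Lemma some_colour_ok n (s : sing X n) : small U s -> forall x, std_simplex n x ->
  U (some_colour s) (sval s x).
Proof. by move=> ss; rewrite /some_colour; case: pselect => // h; exact: projT2 (cid h). Qed.

(** The affine homotopy between the two simplices moves the two exchanged vertices along the segment
    between them, which lies in their common set, and leaves the others in place. *)
Lemma swap_hrel n (s : sing X n) (p : 'I_n.+1 -> pt n * Col) (a b : 'I_n.+1) (g : 'S_n.+1) :
  small U s -> ctuple_cyl p -> coloured U s p -> (a < b)%N -> (p a).2 = (p b).2 ->
  hrel U 0 (cgeo s (p \o g)) (cgeo s (p \o (tperm a b \o g))).
Proof.
move=> ss hp hc ab eab.
have cE c : (p (tperm a b c)).2 = (p c).2 by case: tpermP => [->|->|//]; rewrite eab.
split; first by apply/funext => c /=; rewrite cE.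
pose m (q : 'rV[RR]_n.+1 * RR) : 'rV[RR]_n.+1 :=
  act_map g q.1 + q.2 *: (act_map (tperm a b \o g) q.1 - act_map g q.1).
have cm : cts m.
  rewrite /m; continuity; try (by apply: cts_comp; [exact: cts_act_map|continuity]).
have sm x u : std_simplex n x -> unit_interval u -> std_simplex n (m (x, u)).
  by move=> sx Iu; apply: mix_simplex => //; exact: act_map_simplex.
pose K (q : 'rV[RR]_n.+1 * RR) : X := pmap s (aff2 (forget p) (m q)).
have Kpath : is_path (std_simplex n) (skel 0 n) K.
  split; last first.
    by move=> x u sx; rewrite /skel /= leqn0 => /eqP x0; have := nzc_gt0 sx; rewrite x0.
  apply: (cton_comp (g := fun q => aff2 (forget p) (m q)) (pmap_cton s)) => //.
    by apply: cts_comp; [exact: cts_aff2|exact: cm].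
  by move=> [x u] [sx Iu]; apply: aff2_cyl; [exact: hp|exact: sm].
have geoK (h : 'I_n.+1 -> 'I_n.+1) x : std_simplex n x ->
    sval (cgeo s (p \o h)).1 x = pmap s (aff2 (forget p) (act_map h x)).
  move=> sx; rewrite /= geoE //; first by rewrite aff2_act.
    exact: pmap_cton.
  by move=> c; exact: hp.
exists K; split=> //.
- by move=> x sx; rewrite geoK // /K /m /= scale0r addr0.
- by move=> x sx; rewrite (geoK (tperm a b \o g)) // /K /m /= scale1r addrC subrK.
move=> th thI _; exists (trace th K); first by apply: path_eqv_refl; exact: trace_path.
have mE x u : std_simplex 0 x -> m (act_map th x, u) =
    basis (g (th ord0)) + u *: (basis (tperm a b (g (th ord0))) - basis (g (th ord0))).
  by move=> /std_simplex0E ->; rewrite vertex0E /m /= !act_map_basis.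
set c := g (th ord0) in mE.
(* As [a] precedes [b], coordinates before [a] vanish along the segment, and [coloured] applies at
   [a]. *)
have inU u : unit_interval u -> (c == a) || (c == b) ->
    U (p a).2 (pmap s (aff2 (forget p) (basis c + u *: (basis (tperm a b c) - basis c)))).
  move=> Iu cab; apply: (hc ss).
    by apply: mix_simplex => //; exact: basis_simplex.
  have neq (d e : 'I_n.+1) : (e < d)%N -> basis d ord0 e = 0.
    by move=> ed; rewrite basisE; case: eqP => // E; move: ed; rewrite E ltnn.
  move=> d da; have db := ltn_trans da ab.
  have coordE (x y : 'rV[RR]_n.+1) : (x + u *: (y - x)) ord0 d = x ord0 d + u * (y ord0 d - x ord0 d).
    by rewrite !mxE.
  by case/orP: cab => /eqP ->; rewrite ?tpermL ?tpermR coordE !neq // subrr mulr0 addr0.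
have [cab|] := boolP ((c == a) || (c == b)).
  right=> x u sx Iu; rewrite /trace /K /= mE //.
  have -> : (p (g (th ord0))).2 = (p a).2 by rewrite -/c; case/orP: cab => /eqP ->.
  exact: inU.
rewrite negb_or => /andP[ca cb]; left=> x u sx Iu; rewrite /trace /K /= !mE //.
by rewrite tpermD 1?eq_sym // subrr !scaler0.
Qed.

Lemma asd_vanish n (s : sing X n) phi : small U s ->
  (forall (c : 'I_n.+1 -> Col) x, (forall a, U (c a) x) -> ~ injective c) ->
  (forall t t', hrel U 0 t t' -> phi t = phi t') ->
  pairing phi (asd some_colour s) = 0.
Proof.
move=> ss mult phi_inv; rewrite pairing_map pairing_bind.
rewrite -[RHS](pairing0 (csd some_colour s)).
apply: (eq_pairing (supported_and (csd_cyl some_colour s) (csd_coloured some_colour_ok s))).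
move=> p [hp hc].
have /existsNP[a /existsNP[b /not_implyP[eab nab]]] : ~ injective (fun a => (p a).2).
  (* The last entry of the tuple is a point common to the sets of all colours. *)
  apply: (mult _ (sval s (aff (fun b => (p b).1.1) (basis ord_max)))) => a.
  apply: hc => //; first exact: basis_simplex.
  move=> b ba; rewrite basisE; case: eqP => // E; move: ba; rewrite E ltnNge => /negP[].
  exact: leq_ord.
wlog ab : a b eab nab / (a < b)%N.
  move=> H; have [ab|ba|/val_inj//] := ltngtP a b; first exact: H ab.
  by apply: (H b a) => // E; apply: nab.
apply: (@pairing_alt_swap _ _ _ _ a b); first by apply/eqP.
by move=> g; apply: phi_inv; exact: swap_hrel.
Qed.

Definition usd n (s : sing X n) : fchain (sing X n) :=
  map_chain fst (asd (fun _ _ => tt) s).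

Lemma pairing_usd n (z : fchain (sing X n)) phi :
  pairing phi (bind z (@usd n)) = pairing (phi \o fst) (bind z (asd (fun _ _ => tt) (n := n))).
Proof. by rewrite !pairing_bind; apply: eq_pairingT => s; rewrite pairing_map. Qed.

(** Iterated subdivisions are recorded as affine simplices inside the original one, so that
    diameters are measured in the model and not in [X]. *)
Definition mesh n (S : sing X n -> Prop) (d : RR) (t : sing X n) : Prop :=
  exists s (q : 'I_n.+1 -> pt n), [/\ S s, forall a, cyl1 n (q a), t = geo (pmap s) q &
    forall a b j, `|(q a).1 ord0 j - (q b).1 ord0 j| <= d].

Lemma mesh_usd n (S : sing X n -> Prop) d t : mesh S d t ->
  supported (mesh S (n%:R / n.+1%:R * d)) (usd t).
Proof.
move=> [s [q [Ss hq -> hd]]]; apply/supported_map; apply/supported_map.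
apply: (supported_bind (supported_and (csd_cyl _ _) (csd_contracting _ _))) => p [hp hc].
rewrite /alt; elim: (enum _) => [//|g r IH] /=; split=> //.
exists s, (fun a => aff2 q (p (g a)).1.1); split=> //.
- by move=> a; apply: aff2_cyl => //; exact: (hp _).1.
- apply: sing_ext => y sy; rewrite !geoE //.
  + rewrite {1}/pmap /= geoE //; first by rewrite aff2_comp.
      exact: pmap_cton.
    by apply: aff_simplex => // a; exact: (hp _).1.
  + exact: pmap_cton.
  + by move=> a; apply: aff2_cyl => //; exact: (hp _).1.
  + exact: pmap_cton.
  + by move=> a; exact: hp.
- move=> a b j; rewrite /= !affE; apply: (hc (fun i => (q i).1 ord0 j) d) => i i'; exact: hd.
Qed.

Lemma mesh_small n (s : sing X n) : exists m0, forall m, (m0 <= m)%N -> forall t,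
  mesh (fun s' => s' = s) ((n%:R / n.+1%:R) ^+ m) t -> small U t.
Proof.
have [d d0 hd] := lebesgue_number U_open U_cover s.
have c0 : 0 <= n%:R / n.+1%:R :> RR by apply: divr_ge0.
have c1 : n%:R / n.+1%:R < 1 :> RR by rewrite ltr_pdivrMr ?ltr0n // mul1r ltr_nat.
have [m0 hm0] : exists m0, (n%:R / n.+1%:R) ^+ m0 <= d.
  have cn : `|n%:R / n.+1%:R : RR| < 1 by rewrite ger0_norm.
  have [|m _ hm] := cvg_expr cn (t := ball 0 d); first exact: nbhsx_ballx.
  exists m; have := hm m (leqnn m); rewrite /= /ball /= sub0r normrN ger0_norm ?exprn_ge0 //.
  exact: ltW.
exists m0 => m hm t [s' [q [-> hq -> hqd]]].
have [i hi] := hd _ (hq ord0).1; exists i => y sy; rewrite geoE //; last exact: pmap_cton.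
have sq := aff2_cyl hq sy; apply: hi; first exact: sq.1.
move=> j; rewrite /= affE.
have -> : \sum_i y ord0 i * (q i).1 ord0 j - (q ord0).1 ord0 j =
    \sum_i y ord0 i * ((q i).1 ord0 j - (q ord0).1 ord0 j).
  under [RHS]eq_bigr do rewrite mulrBr.
  by rewrite sumrB -mulr_suml sy.2 mul1r.
apply: le_trans (ler_norm_sum _ _ _) _.
have -> : d = \sum_i y ord0 i * d by rewrite -mulr_suml sy.2 mul1r.
apply: ler_sum => a _; rewrite normrM ger0_norm; last exact: sy.1.
apply: ler_wpM2l; first exact: sy.1.
apply: le_trans (hqd _ _ _) _; apply: le_trans hm0; apply: ler_wiXn2l => //; exact: ltW.
Qed.

Lemma subdivide n (z : fchain (sing X n.+1)) m (S : sing X n.+1 -> Prop) :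
  supported S z -> (forall phi, pairing (cob (@dS X n) phi) z = 0) ->
  exists (z1 : fchain (sing X n.+1)) (b : fchain (sing X n.+2)),
  [/\ supported (mesh S ((n.+1%:R / n.+2%:R) ^+ m)) z1,
      forall phi, pairing (cob (@dS X n) phi) z1 = 0 &
      forall phi, pairing (cob (@dS X n.+1) phi) b = pairing phi z1 - pairing phi z].
Proof.
move=> zS zc; elim: m => [|m [z1 [b [h1 h2 h3]]]].
  exists z, [::]; split=> // [|phi]; last by rewrite pairing_nil subrr.
  apply: eq_supported zS => s Ss; exists s, (fun i => (basis i, 0)); split=> //.
  - by move=> a; split; [exact: basis_simplex|exact: unit_interval0].
  - apply: sing_ext => y sy; rewrite geoE //; first by rewrite /pmap /= aff_id.
      exact: pmap_cton.
    by move=> a; split; [exact: basis_simplex|exact: unit_interval0].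
  - move=> a c j /=; rewrite !basisE expr0.
    by case: (j == a); case: (j == c); rewrite ?subrr ?subr0 ?sub0r ?normrN ?normr0 ?normr1.
have [b' hb'] := asd_homologous (fun _ _ => tt) h2.
exists (bind z1 (@usd n.+1)), (b ++ b'); split.
- by apply: (supported_bind h1) => t; rewrite exprS; exact: mesh_usd.
- move=> phi; rewrite pairing_usd.
  exact: (asd_cycle (fun _ _ => tt) h2 (phi \o fst)).
- by move=> phi; rewrite pairing_cat h3 hb' pairing_usd; lra.
Qed.

(** Simplices are made small by subdivisions with a single colour; a last subdivision then
    distributes the colours, which can be chosen correctly on small simplices only. *)
Theorem initial n (z : fchain (sing X n.+1)) :
  (forall (c : 'I_n.+2 -> Col) x, (forall a, U (c a) x) -> ~ injective c) ->
  (forall phi, pairing (cob (@dS X n) phi) z = 0) ->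
  exists (y : fchain (csing X Col n.+1)) (b : fchain (sing X n.+2)),
  [/\ forall phi, pairing (cob (@dT X Col n) phi) y = 0,
      forall phi, (forall t t', hrel U 0 t t' -> phi t = phi t') -> pairing phi y = 0 &
      forall phi, pairing (cob (@dS X n.+1) phi) b = pairing (phi \o fst) y - pairing phi z].
Proof.
move=> mult zc.
pose P m (s : sing X n.+1) := forall t,
  mesh (fun s' => s' = s) ((n.+1%:R / n.+2%:R) ^+ m) t -> small U t.
(* Each simplex has its own Lebesgue number; finitely many occur, so one [m] serves all. *)
have [m hm] : exists m, supported (P m) z.
  apply: supported_eventually => s; have [m0 h] := mesh_small s.
  by exists m0 => m' /h.
have [z1 [b [h1 h2 h3]]] := subdivide m hm zc.
have [b' hb'] := asd_homologous some_colour h2.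
exists (bind z1 (asd some_colour (n := n.+1))), (b ++ b'); split.
- exact: asd_cycle.
- move=> phi phi_inv; rewrite pairing_bind -[RHS](pairing0 z1).
  apply: (eq_pairing h1) => t [s [q [Ps hq et hd]]]; apply: asd_vanish => //.
  by apply: Ps; exists s, q.
- by move=> phi; rewrite pairing_cat h3 hb'; lra.
Qed.
End Initial.

(** * Iteration and passage to the limit *)

(** A list may repeat a simplex with opposite weights. After collecting terms, the mass is the
    l^1-norm, attained at the sign function. *)
Lemma pairing_reduce (T : Type) (z : fchain T) : exists (z' : fchain T) (phi : T -> RR),
  [/\ forall f, pairing f z' = pairing f z, forall x, `|phi x| <= 1 & pairing phi z' = mass z'].
Proof.
elim/Pchoice: T => T in z *.
pose c t : RR := \sum_(x <- z | x.2 == t) x.1.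
exists [seq (c t, t) | t <- undup [seq x.2 | x <- z]], (fun t => Num.sg (c t)); split.
- move=> f; rewrite /pairing big_map /=.
  under eq_bigr do rewrite /c mulr_suml big_mkcond /=.
  rewrite exchange_big /=; apply: eq_big_seq => x xz.
  rewrite -big_mkcond /= (big_rem x.2) /=; last by rewrite mem_undup map_f.
  rewrite eqxx big_seq_cond big1 ?addr0 // => t /andP[].
  by rewrite mem_rem_uniq ?undup_uniq // inE => /andP[/negbTE tx _]; rewrite eq_sym tx.
- by move=> x; rewrite normr_sg; case: (_ != _).
- by rewrite /pairing /mass !big_map; apply: eq_bigr => t _ /=; rewrite mulrC -normrEsg.
Qed.

Section Rounds.
Variables (X : topologicalType) (Col : Type) (U : Col -> set X).
Hypothesis U_amenable : forall i, amenable_in (U i).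
Variable n : nat.
Local Notation T := (csing X Col n.+1).

(** The invariant of the rounds. Since the vanishing is exact, the error after all stages can be
    made as small as desired. *)
Definition admissible (z : fchain T) : Prop :=
  (forall phi, pairing (cob (@dT X Col n) phi) z = 0) /\
  (forall phi, (forall t t', hrel U 0 t t' -> phi t = phi t') -> pairing phi z = 0).

Lemma stages p (z : fchain T) (eps : RR) : 0 < eps -> admissible z ->
  exists (z' : fchain T) (b : fchain (sing X n.+2)),
  [/\ admissible z',
      forall phi, (forall t, `|phi t| <= 1) ->
        (forall t t', hrel U p t t' -> phi t = phi t') -> `|pairing phi z'| <= p%:R * eps,
      mass z' <= mass z, mass b <= p%:R * prism_mass n.+1 * mass z &
      forall phi, pairing (cob (@dS X n.+1) phi) b =
        pairing (phi \o fst) z' - pairing (phi \o fst) z].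
Proof.
move=> e0 hz; elim: p => [|p [z1 [b1 [[h1 h1'] h2 h3 h4 h5]]]].
  exists z, [::]; split=> //.
  - by move=> phi _ hp; rewrite hz.2 // normr0 mul0r.
  - by rewrite mass_nil !mul0r.
  - by move=> phi; rewrite pairing_nil subrr.
have [z2 [b2 [g1 g2 g3 [g4 g4'] g5]]] := stage U_amenable e0 h1 h2.
have pm0 : 0 <= prism_mass n.+1 by exact: mass_ge0.
exists z2, (b1 ++ b2); split=> //.
- by split=> // phi hp; rewrite g3 // h1'.
- by move=> phi phi1 hp; rewrite -natr1 mulrDl mul1r; exact: g2.
- exact: le_trans g4 h3.
- rewrite mass_cat -natr1 !mulrDl mul1r; apply: lerD => //; apply: le_trans g4' _.
  exact: ler_wpM2l.
- by move=> phi; rewrite pairing_cat h5 g5; lra.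
Qed.

Definition round_cst : RR := n.+2%:R * prism_mass n.+1.

(** The simplices have dimension [n.+1], so R_p is equality for [p = n.+2]; this many stages share
    the error. *)
Lemma round (z : fchain T) (eps : RR) : 0 < eps -> admissible z ->
  exists (z' : fchain T) (b : fchain (sing X n.+2)),
  [/\ admissible z', mass z' <= eps, mass b <= round_cst * mass z &
      forall phi, pairing (cob (@dS X n.+1) phi) b =
        pairing (phi \o fst) z' - pairing (phi \o fst) z].
Proof.
move=> e0 hz; have e1 : 0 < eps / n.+2%:R by apply: divr_gt0.
have [z1 [b [[h1 h1'] h2 h3 h4 h5]]] := stages n.+2 e1 hz.
have [z' [phi [g1 g2 g3]]] := pairing_reduce z1.
exists z', b; split=> //.
- by split=> [f|f hf]; rewrite g1; [exact: h1|exact: h1'].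
- rewrite -g3 g1; apply: le_trans (ler_norm _) _; apply: le_trans (h2 phi g2 _) _.
    by move=> t t' /hrel_top ->.
  by rewrite mulrC divfK ?pnatr_eq0.
- by move=> f; rewrite g1.
Qed.

Lemma rounds (z : fchain T) : admissible z ->
  exists (zs : nat -> fchain T) (bs : nat -> fchain (sing X n.+2)),
  [/\ zs 0%N = z, forall j, mass (zs j.+1) <= 2^-1 ^+ j.+1,
      forall j, mass (bs j) <= round_cst * mass (zs j) &
      forall j phi, pairing (cob (@dS X n.+1) phi) (bs j) =
        pairing (phi \o fst) (zs j.+1) - pairing (phi \o fst) (zs j)].
Proof.
move=> hz; pose W := {z : fchain T | admissible z}.
have step (x : W * nat) : exists y : W * fchain (sing X n.+2),
    [/\ mass (sval y.1) <= 2^-1 ^+ x.2.+1, mass y.2 <= round_cst * mass (sval x.1) &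
      forall phi, pairing (cob (@dS X n.+1) phi) y.2 =
        pairing (phi \o fst) (sval y.1) - pairing (phi \o fst) (sval x.1)].
  have e0 : 0 < 2^-1 ^+ x.2.+1 :> RR by apply: exprn_gt0; lra.
  have [z' [b [h1 h2 h3 h4]]] := round e0 (svalP x.1).
  by exists (exist _ z' h1, b).
have [g hg] := choice step.
pose ws := fix ws j : W := if j is j'.+1 then (g (ws j', j')).1 else exist _ z hz.
exists (fun j => sval (ws j)), (fun j => (g (ws j, j)).2); split=> // j.
- by have [] := hg (ws j, j).
- by have [] := hg (ws j, j).
- by have [] := hg (ws j, j).
Qed.
End Rounds.

(** * Comparison with chains as functions *)

Section ToChain.
Variable X : topologicalType.

Definition to_chain n (z : fchain (sing X n)) : chain X n :=
  fun f => pairing (fun s => (asbool (sval s = f))%:R) z.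

Lemma to_chain_support n (z : fchain (sing X n)) f : Defs.support (to_chain z) f ->
  f \in [seq sval x.2 | x <- z].
Proof.
rewrite /Defs.support /= /to_chain; elim: z => [|x z IH]; first by rewrite pairing_nil eqxx.
rewrite pairing_cons inE; case: asboolP => [->|_]; first by rewrite eqxx.
by rewrite mulr0 add0r => /IH ->; rewrite orbT.
Qed.

Lemma to_chain_is_chain n (z : fchain (sing X n)) : is_chain (to_chain z).
Proof.
split; first by apply: sub_finite_set (finite_seq _) => f; exact: to_chain_support.
move=> f /to_chain_support; elim: z => [//|x z IH] /=; rewrite inE => /orP[/eqP ->|//].
exact: svalP.
Qed.

Lemma sum_to_chain n (z : fchain (sing X n)) (F : ('rV[RR]_n.+1 -> X) -> RR) :
  \sum_(f \in Defs.support (to_chain z)) to_chain z f * F f = pairing (fun s => F (sval s)) z.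
Proof.
set r := undup [seq sval x.2 | x <- z].
rewrite (@fsbig_fwiden _ _ _ _ r); first last.
- by move=> f [_ /negP]; rewrite /Defs.support /= negbK => /eqP ->; rewrite mul0r.
- exact: undup_uniq.
- by move=> f /to_chain_support; rewrite /= mem_undup.
have zr : supported (fun s => sval s \in r) z.
  have : all (mem r) [seq sval x.2 | x <- z] by apply/allP => f; rewrite /= mem_undup.
  by elim: (z) => [//|x z' IH] /= /andP[xr /IH].
transitivity (pairing (fun s => \sum_(f <- r) F f * (asbool (sval s = f))%:R) z).
  by rewrite pairing_sum; apply: eq_bigr => f _; rewrite pairingZ mulrC.
apply: (eq_pairing zr) => s sr; rewrite (bigD1_seq (sval s)) ?undup_uniq //=.
rewrite asboolT // mulr1 big1 ?addr0 // => f /eqP fx.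
by rewrite asboolF ?mulr0 // => e; apply: fx.
Qed.

Lemma l1norm_to_chain n (z : fchain (sing X n)) : l1norm (to_chain z) <= mass z.
Proof.
have -> : l1norm (to_chain z) =
    \sum_(f \in Defs.support (to_chain z)) to_chain z f * Num.sg (to_chain z f).
  by apply: eq_fsbigr => f _; rewrite mulrC -normrEsg.
rewrite sum_to_chain; apply: le_trans (ler_norm _) _; rewrite -[leRHS]mul1r.
apply: (pairing_bound (supportedT _)) => s _.
by rewrite normr_sg; case: (_ != _).
Qed.

Lemma boundary_to_chain n (z : fchain (sing X n.+1)) tau :
  boundary (to_chain z) tau = pairing (cob (@dS X n) (fun s => (asbool (sval s = tau))%:R)) z.
Proof.
transitivity (pairing (fun s => \sum_(i < n.+2) (-1) ^+ i * (asbool (face i (sval s) = tau))%:R) z).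
  rewrite -(sum_to_chain z (fun f => \sum_(i < n.+2) (-1) ^+ i * (asbool (face i f = tau))%:R)).
  apply: eq_fsbigr => f _; rewrite mulr_sumr; apply: eq_bigr => i _.
  by rewrite mulrCA mulrA.
by apply: eq_pairingT => s; apply: eq_bigr => i _; rewrite dS_face.
Qed.

(** The values of a function chain are pairings with indicators, and a finite combination of these
    recovers every pairing. *)
Lemma to_chain0 n (z : fchain (sing X n)) : to_chain z = (fun _ => 0) ->
  forall phi, pairing phi z = 0.
Proof.
move=> z0 phi.
have -> : phi = (fun s => phi (to_sing (sval s))).
  apply/funext => s; congr phi; apply: sing_ext => x sx.
  by rewrite to_singE //; exact: sing_cton.
by rewrite -(sum_to_chain z (fun f => phi (to_sing f))) fsbig1 // => f _; rewrite z0 mul0r.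
Qed.

Lemma of_chain n (c : chain X n) : is_chain c -> exists z, to_chain z = c.
Proof.
move=> [/finite_seqP[r0 hr0] sg]; pose r := undup r0.
have inj (f : 'rV[RR]_n.+1 -> X) : is_singular_simplex f -> sval (to_sing f) = f.
  move=> sf; have [cf e] := sf; have [_ e'] := svalP (to_sing f).
  rewrite -{2}e -e'; apply: eq_normalize => x sx; rewrite to_singE //; exact: Cton cf.
exists [seq (c f, to_sing f) | f <- r]; apply/funext => f.
rewrite /to_chain /pairing big_map /=.
have rP g : g \in r <-> c g != 0.
  have -> : (g \in r) = (g \in r0) by rewrite mem_undup.
  by have := congr1 (fun A : set _ => A g) hr0; rewrite /Defs.support /= => ->.
have E g : g \in r -> c g * (asbool (sval (to_sing g) = f))%:R = if g == f then c f else 0.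
  move=> gr; have sgg : is_singular_simplex g by apply: sg; apply/rP.
  rewrite inj //; case: eqP => [->|ne]; first by rewrite asboolT // mulr1.
  by rewrite asboolF // mulr0.
rewrite (eq_big_seq _ E).
have [fr|fr] := boolP (f \in r).
  rewrite (bigD1_seq f) ?undup_uniq //= eqxx big1 ?addr0 // => g /negbTE ->; by [].
rewrite big_seq big1.
  by apply/esym/eqP; apply: contraNT fr => /rP.
by move=> g gr; case: eqP => // e; move: fr; rewrite -e gr.
Qed.

Lemma to_chain_cycle n (z : fchain (sing X n.+1)) : boundary (to_chain z) = (fun _ => 0) ->
  forall phi, pairing (cob (@dS X n) phi) z = 0.
Proof.
(* Here the boundary is formed as a list, so that [to_chain0] applies to it. *)
move=> bz phi; pose w := signed_sum (fun i => map_chain (dS i) z).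
have wE f : pairing f w = pairing (cob (@dS X n) f) z.
  rewrite pairing_signed_sum /cob pairing_sum; apply: eq_bigr => i _.
  by rewrite pairing_map pairingZ.
rewrite -wE; apply: to_chain0; apply/funext => f.
by rewrite /to_chain wE -boundary_to_chain bz.
Qed.
End ToChain.

(** * Multiplicity, convergence and conclusion *)

Lemma multiplicity_le (X I : Type) (U : I -> set X) k : multiplicity_eq U k ->
  forall m (c : nat -> I) x, (forall i j, (i < m)%N -> (j < m)%N -> c i = c j -> i = j) ->
  (forall j, (j < m)%N -> U (c j) x) -> (m <= k)%N.
Proof.
move=> [mult _] m c x cI cU; rewrite -card_le_II.
have h : (c @` `I_m #= `I_m)%card.
  by apply: inj_card_eq => i j /set_mem im /set_mem jm; exact: cI.
apply: (card_le_trans (B := c @` `I_m)); first by have [] := (card_eqPle _ _).1 h.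
by apply: mult; exists x => i [j jm <-]; exact: cU.
Qed.

Lemma expr_half_lt (e : RR) : 0 < e -> exists N, forall p, (N <= p)%N -> 2^-1 ^+ p < e.
Proof.
move=> e0; have h : `|2^-1 : RR| < 1 by rewrite ger0_norm ?invr_ge0 // invf_lt1 ?ltr1n.
have [|N _ hN] := cvg_expr h (t := ball 0 e); first exact: nbhsx_ballx.
exists N => p Np; have := hN p Np.
by rewrite /= /ball /= sub0r normrN ger0_norm // exprn_ge0 // invr_ge0.
Qed.

(** Minus [b0] and minus the partial sums of [bs] has boundary [z] minus [ws p]; the masses decay
    geometrically, which gives both the Cauchy property and the limit. *)
Lemma l1_boundary_limit (X : topologicalType) n (z : fchain (sing X n))
  (b0 : fchain (sing X n.+1)) (ws : nat -> fchain (sing X n))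
  (bs : nat -> fchain (sing X n.+1)) (C : RR) : 0 <= C ->
  (forall j, mass (ws j.+1) <= 2^-1 ^+ j.+1) ->
  (forall j, mass (bs j) <= C * mass (ws j)) ->
  (forall j phi, pairing (cob (@dS X n) phi) (bs j) = pairing phi (ws j.+1) - pairing phi (ws j)) ->
  (forall phi, pairing (cob (@dS X n) phi) b0 = pairing phi (ws 0%N) - pairing phi z) ->
  l1_boundary (to_chain z).
Proof.
move=> C0 ws_small bs_small bs_cob b0_cob.
pose B := fix B p : fchain (sing X n.+1) :=
  if p is p'.+1 then B p' ++ scale_chain (-1) (bs p') else scale_chain (-1) b0.
pose rest q := fix rest d : fchain (sing X n.+1) :=
  if d is d'.+1 then rest d' ++ scale_chain (-1) (bs (q + d')%N) else [::].
have B_rest q d : B (q + d)%N = B q ++ rest q d.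
  by elim: d => [|d IH]; rewrite ?addn0 ?cats0 // addnS /= IH catA.
have B_cob p phi : pairing (cob (@dS X n) phi) (B p) = pairing phi z - pairing phi (ws p).
  elim: p => [|p IH] /=; first by rewrite pairing_scale b0_cob; lra.
  by rewrite pairing_cat pairing_scale IH bs_cob; lra.
(* Powers of one half bound [ws] from index 1 on, hence [0 < q]. The bound telescopes, since the
   j-th power of one half is twice its difference with the next. *)
have rest_mass q d : (0 < q)%N -> mass (rest q d) <= 2 * C * (2^-1 ^+ q - 2^-1 ^+ (q + d)).
  case: q => // q _; elim: d => [|d IH]; first by rewrite addn0 subrr mulr0 mass_nil.
  rewrite /= mass_cat mass_scale normrN1 mul1r addnS (exprS _ (q.+1 + d)).
  have h : mass (bs (q.+1 + d)%N) <= C * 2^-1 ^+ (q.+1 + d).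
    by apply: le_trans (bs_small _) _; apply: ler_wpM2l => //; exact: ws_small.
  by move: IH h; move: (2^-1 ^+ q.+1 : RR) (2^-1 ^+ (q.+1 + d) : RR) => u v; lra.
have cauchy q d : (0 < q)%N -> mass (rest q d) <= 2 * C * 2^-1 ^+ q.
  move=> q0; apply: le_trans (rest_mass q d q0) _; apply: ler_wpM2l; first by rewrite mulr_ge0.
  by rewrite gerBl exprn_ge0 // invr_ge0.
exists (fun p => to_chain (B p)); split; first by move=> p; exact: to_chain_is_chain.
split=> [e e0|e e0].
  have e1 : 0 < e / (2 * C + 1) by apply: divr_gt0 => //; lra.
  have [N hN] := expr_half_lt e1.
  have small q d : (N.+1 <= q)%N -> mass (rest q d) < e.
    move=> Nq; apply: le_lt_trans (cauchy q d (leq_trans (ltn0Sn N) Nq)) _.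
    have := hN q (ltnW Nq); rewrite ltr_pdivlMr; last by lra.
    have : 0 < 2^-1 ^+ q :> RR by rewrite exprn_gt0 // invr_gt0.
    by move: (2^-1 ^+ q : RR) => u; nra.
  exists N.+1 => p q Np Nq; have [pq|qp] := leqP p q.
    rewrite -(subnKC pq) B_rest.
    rewrite (_ : (fun f => _) = to_chain (scale_chain (-1) (rest p (q - p)%N))).
      apply: le_lt_trans (l1norm_to_chain _) _.
      by rewrite mass_scale normrN1 mul1r; exact: small.
    by apply/funext => f; rewrite /to_chain pairing_cat pairing_scale; lra.
  rewrite -(subnKC (ltnW qp)) B_rest.
  rewrite (_ : (fun f => _) = to_chain (rest q (p - q)%N)).
    by apply: le_lt_trans (l1norm_to_chain _) _; exact: small.
  by apply/funext => f; rewrite /to_chain pairing_cat; lra.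
have [N hN] := expr_half_lt e0.
exists N.+1 => p Np.
rewrite (_ : (fun f => _) = to_chain (scale_chain (-1) (ws p))).
  apply: le_lt_trans (l1norm_to_chain _) _; rewrite mass_scale normrN1 mul1r.
  case: p Np => // p Np; apply: le_lt_trans (ws_small p) _; apply: hN; exact: ltnW.
apply/funext => f; rewrite boundary_to_chain B_cob /to_chain pairing_scale; lra.
Qed.

Theorem theorem2 (X : topologicalType) (I : Type) (U : I -> set X) (k : nat) :
  (forall i, open (U i)) ->
  (\bigcup_i U i = setT) ->
  (forall i, amenable_in (U i)) ->
  multiplicity_eq U k ->
  forall n : nat, (k <= n)%N ->
  forall z : chain X n, is_chain z -> is_cycle z -> l1_boundary z.
Proof.
move=> U_open U_cov U_amenable mult n kn z z_chain z_cycle.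
have U_cover x : exists i, U i x.
  have : (\bigcup_i U i) x by rewrite U_cov.
  by move=> [i _ Ui]; exists i.
have [_ [J [[x0 _] _]]] := mult.
have [i0 Ui0] := U_cover x0.
(* The attained multiplicity provides a point of [X], which some member of the cover contains; so
   degree 0 does not occur. *)
have k_gt0 : (0 < k)%N.
  by apply: (@multiplicity_le _ _ _ _ mult 1 (fun _ => i0) x0) => [[|i] [|j]|[|j]].
case: n kn z z_chain z_cycle => [|n] kn z z_chain z_cycle.
  by move: (leq_trans k_gt0 kn).
have [z0 z0E] := of_chain z_chain; rewrite -z0E in z_cycle *.
have z0_cycle := to_chain_cycle z_cycle.
(* The degree is now written [n.+1], so [n.+2] exceeds the multiplicity. *)
have mult' (c : 'I_n.+2 -> I) x : (forall a, U (c a) x) -> ~ injective c.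
  move=> cU cI; have : (n.+2 <= k)%N.
    apply: (multiplicity_le mult (c := c \o inord)) => [i j im jm /cI e|j jm]; last exact: cU.
    by rewrite -(inordK im) e inordK.
  by rewrite leqNgt ltnS kn.
have [y [b0 [y_cycle y_vanish b0_cob]]] := initial i0 U_open U_cover mult' z0_cycle.
have [zs [bs [zs0 zs_small bs_small bs_cob]]] := rounds U_amenable (conj y_cycle y_vanish).
apply: (@l1_boundary_limit _ _ z0 b0 (fun j => map_chain fst (zs j)) bs (round_cst n)).
- by apply: mulr_ge0 => //; exact: mass_ge0.
- by move=> j; rewrite mass_map.
- by move=> j; rewrite mass_map.
- by move=> j phi; rewrite !pairing_map.
- by move=> phi; rewrite pairing_map zs0.
Qed.
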